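(* Let $G$ be a discrete group that is virtually abelian. Then \[ \mathrm{AM}(\mathrm{A}(G))\leq 1+(\mathrm{maxdeg}(G)-1)\left(1-\frac{1}{|[G,G]|}\right). \]
   Context: A group is virtually abelian if it has an abelian subgroup of finite index. $\mathrm{maxdeg}(G)$ is the supremum of the degrees (Hilbert space dimensions) of the irreducible unitary representations of $G$. $[G,G]$ is the commutator subgroup, with the convention $|[G,G]|^{-1}=0$ if $[G,G]$ is infinite. Fourier algebra: for a locally compact group $G$ with a fixed left Haar measure and left regular representation $\lambda:G\to\mathcal{U}(L^2(G))$, let $\alpha_G:L^2(G)\widehat{\otimes}L^2(G)\to C_0(G)$ be the contractive linear map with $\alpha_G(\xi\otimes\overline{\eta})=\langle\lambda(\cdot)\xi,\eta\rangle$, where $\widehat{\otimes}$ is the projective tensor product of Banach spaces. The Fourier algebra $\mathrm{A}(G)$ is the image of $\alpha_G$ with the quotient norm from $(L^2(G)\widehat{\otimes}L^2(G))/\ker\alpha_G$; it is a Banach algebra under pointwise product. Amenability constant: for a Banach algebra $A$ let $\Delta:A\widehat{\otimes}A\to A$ be the linearized product. A bounded approximate diagonal for $A$ is a bounded net $(m_\alpha)$ in $A\widehat{\otimes}A$ such that for each $a\in A$, $\|a\cdot m_\alpha-m_\alpha\cdot a\|\to0$ and $\|a\Delta(m_\alpha)-a\|\to0$. The amenability constant $\mathrm{AM}(A)\in[1,\infty]$ is the infimum of $\sup_\alpha\|m_\alpha\|$ over all bounded approximate diagonals for $A$, with $\mathrm{AM}(A)=+\infty$ if none exists. *)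

(* Defs.v *)
From HB Require Import structures.
From mathcomp Require Import all_boot all_order all_algebra.
From mathcomp Require Import sesquilinear.
From mathcomp Require Import all_classical all_reals all_analysis.
From mathcomp Require Import complex.
From mathcomp.analysis.showcase Require summability.

Set Implicit Arguments.
Unset Strict Implicit.
Unset Printing Implicit Defensive.

Import Order.TTheory GRing.Theory Num.Theory.
Import numFieldNormedType.Exports.

Local Open Scope classical_set_scope.
Local Open Scope ring_scope.

(* Complex numbers are R[i]; R[i]^o is R[i] as a normed space over itself.
   Groups are of type [groupType], hence discrete and possibly infinite. *)

Section groups.
Local Open Scope group_scope.

Definition is_subgroup (G : groupType) (S : set G) : Prop :=
  [/\ S 1, forall x y, S x -> S y -> S (x * y) & forall x, S x -> S x^-1].

Definition left_cosets (G : groupType) (S : set G) : set (set G) :=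
  range (fun g : G => [set g * s | s in S]).

Definition virtually_abelian (G : groupType) : Prop :=
  exists S : set G, [/\ is_subgroup S,
    forall x y, S x -> S y -> x * y = y * x & finite_set (left_cosets S)].

Definition commutator_subgroup (G : groupType) : set G :=
  smallest (@is_subgroup G) [set z | exists x y : G, z = commg x y].

End groups.

(* In \bar R one has +oo^-1 = 0, so this is 0 when [G, G] is infinite. *)
Definition inv_card_commutator (R : realType) (G : groupType) : \bar R :=
  ((counting (@commutator_subgroup G))^-1)%E.

(* A Hilbert space is a complete normed space over R[i] together with a
   positive definite Hermitian form (linear in its first argument) inducing
   its norm. *)

Section representations.
Variables (R : realType) (G : groupType).

Definition is_hilbert (H : completeNormedModType R[i])
    (dot : {dot H for Num.conj}) : Prop :=
  forall x : H, `|x| ^+ 2 = dot x x.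

(* Each pi g is a linear isometry with inverse pi g^-1, hence unitary. *)
Definition unitary_rep (H : completeNormedModType R[i])
    (dot : {dot H for Num.conj}) (pi : G -> {linear H -> H}) : Prop :=
  [/\ forall x, pi 1%g x = x,
      forall g h x, pi (g * h)%g x = pi g (pi h x)
    & forall g x y, dot (pi g x) (pi g y) = dot x y].

Definition closed_invariant_subspace (H : completeNormedModType R[i])
    (pi : G -> {linear H -> H}) (W : set H) : Prop :=
  [/\ closed W, W 0, forall (a : R[i]) x y, W x -> W y -> W (a *: x + y)
    & forall g x, W x -> W (pi g x)].

Definition irreducible_rep (H : completeNormedModType R[i])
    (pi : G -> {linear H -> H}) : Prop :=
  (exists x : H, x != 0) /\
  forall W, closed_invariant_subspace pi W -> W = [set 0] \/ W = setT.

(* Orthonormal bases in the Hilbert space sense: maximal orthonormal sets. *)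
Definition orthonormal_basis (H : completeNormedModType R[i])
    (dot : {dot H for Num.conj}) (B : set H) : Prop :=
  [/\ forall e, B e -> dot e e = 1,
      forall e f, B e -> B f -> e != f -> dot e f = 0
    & forall x, (forall e, B e -> dot x e = 0) -> x = 0].

(* [counting B] is the cardinality of B if B is finite, and +oo otherwise. *)
Definition maxdeg : \bar R :=
  ereal_sup [set d | exists (H : completeNormedModType R[i])
    (dot : {dot H for Num.conj}) (pi : G -> {linear H -> H}) (B : set H),
    [/\ is_hilbert dot, unitary_rep dot pi, irreducible_rep pi,
        orthonormal_basis dot B & d = counting B]].

End representations.

(* A normed space is given here as a linear subspace [carrier] of an ambient
   vector space E, with a norm that is only meaningful on that subspace. *)

Record normed_space (R : realType) (E : lmodType R[i]) := NormedSpace {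
  carrier : set E;
  normof : E -> R }.

Section projective_tensor.
Variables (R : realType) (E F : lmodType R[i]).
Variables (X : normed_space E) (Y : normed_space F).

(* The list (x_1, y_1), ..., (x_n, y_n) stands for the finite tensor
   sum_i x_i (x) y_i in the algebraic tensor product of X and Y. *)
Definition finite_tensor (t : seq (E * F)) : Prop :=
  forall p, p \in t -> carrier X p.1 /\ carrier Y p.2.

Definition bilinear_on (V : lmodType R[i]) (b : E -> F -> V) : Prop :=
  (forall (a : R[i]) x x' y, carrier X x -> carrier X x' -> carrier Y y ->
     b (a *: x + x') y = a *: b x y + b x' y) /\
  (forall (a : R[i]) x y y', carrier X x -> carrier Y y -> carrier Y y' ->
     b x (a *: y + y') = a *: b x y + b x y').

(* Equality in the algebraic tensor product, via its universal property. *)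
Definition tensor_eq (t u : seq (E * F)) : Prop :=
  forall (V : lmodType R[i]) (b : E -> F -> V), bilinear_on b ->
    \sum_(p <- t) b p.1 p.2 = \sum_(p <- u) b p.1 p.2.

Definition tensor_sub (t u : seq (E * F)) : seq (E * F) :=
  t ++ [seq (- p.1, p.2) | p <- u].

Definition proj_norm (t : seq (E * F)) : R :=
  inf [set \sum_(p <- u) normof X p.1 * normof Y p.2 |
        u in [set u | finite_tensor u /\ tensor_eq t u]].

(* The projective tensor product is the completion of the algebraic tensor
   product for the projective norm; its elements are represented by the
   Cauchy sequences of finite tensors, and the norm of the class of such a
   sequence is the limit of the norms. *)
Definition ptensor : set (nat -> seq (E * F)) :=
  [set t | (forall n, finite_tensor (t n)) /\
    forall eps : R, 0 < eps -> exists N, forall m n, (N <= m)%N -> (N <= n)%N ->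
      proj_norm (tensor_sub (t m) (t n)) < eps].

Definition ptensor_norm (t : nat -> seq (E * F)) : R :=
  lim (proj_norm (t n) @[n --> \oo]).

End projective_tensor.

Section amenability.
Variables (R : realType) (E : lmodType R[i]).
(* The Banach algebra is the normed space A with the product mul. *)
Variables (A : normed_space E) (mul : E -> E -> E).

Definition lact (a : E) (t : nat -> seq (E * E)) : nat -> seq (E * E) :=
  fun n => [seq (mul a p.1, p.2) | p <- t n].

Definition ract (t : nat -> seq (E * E)) (a : E) : nat -> seq (E * E) :=
  fun n => [seq (p.1, mul p.2 a) | p <- t n].

Definition ptensor_sub (t u : nat -> seq (E * E)) : nat -> seq (E * E) :=
  fun n => tensor_sub (t n) (u n).

(* The linearized product: the limit in A of the products of the finite
   tensors t n.  The default value 0 is irrelevant when A is complete. *)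
Definition Delta (t : nat -> seq (E * E)) : E :=
  xget 0 [set d | carrier A d /\
    normof A (\sum_(p <- t n) mul p.1 p.2 - d) @[n --> \oo] --> (0 : R)].

Definition directed (I : Type) (le : I -> I -> Prop) : Prop :=
  [/\ inhabited I, forall i, le i i,
      forall i j k, le i j -> le j k -> le i k
    & forall i j, exists k, le i k /\ le j k].

(* Convergence of nets indexed by I is convergence along this filter. *)
Definition net_tails (I : Type) (le : I -> I -> Prop) : set_system I :=
  filter_from setT (fun i => [set j | le i j]).

Definition bounded_approximate_diagonal (I : Type) (le : I -> I -> Prop)
    (m : I -> nat -> seq (E * E)) : Prop :=
  [/\ directed le,
      forall i, ptensor A A (m i),
      exists M : R, forall i, ptensor_norm A A (m i) <= M,
      forall a, carrier A a ->
        ptensor_norm A A (ptensor_sub (lact a (m i)) (ract (m i) a))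
          @[i --> net_tails le] --> (0 : R)
    & forall a, carrier A a ->
        normof A (mul a (Delta (m i)) - a) @[i --> net_tails le] --> (0 : R)].

Definition AM : \bar R :=
  ereal_inf [set c | exists (I : Type) (le : I -> I -> Prop)
    (m : I -> nat -> seq (E * E)), bounded_approximate_diagonal le m /\
    c = ereal_sup (range (fun i => (ptensor_norm A A (m i))%:E))].

End amenability.

Section fourier.
Variables (R : realType) (G : groupType).

Definition ell2 : normed_space (G -> R[i]^o) :=
  NormedSpace
    [set f | (\esum_(x in setT) (Normc.normc (f x) ^+ 2)%:E < +oo)%E]
    (fun f => Num.sqrt (fine (\esum_(x in setT) (Normc.normc (f x) ^+ 2)%:E))).

(* [summability.sum] is the unconditional sum over the index set G. *)
Definition inner (f g : G -> R[i]^o) : R[i]^o :=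
  summability.sum (fun x => f x * Num.conj (g x) : R[i]^o).

Definition regular (s : G) (f : G -> R[i]^o) : G -> R[i]^o :=
  fun x => f (s^-1 * x)%g.

Definition fconj (f : G -> R[i]^o) : G -> R[i]^o := fun x => Num.conj (f x).

(* alpha (xi (x) conj eta) = <lambda(.) xi, eta>, extended by linearity to
   finite tensors and by continuity to the projective tensor product. *)
Definition alpha (t : nat -> seq ((G -> R[i]^o) * (G -> R[i]^o))) :
    G -> R[i]^o :=
  fun s => lim (\sum_(p <- t n) inner (regular s p.1) (fconj p.2) @[n --> \oo]).

Definition fourier : normed_space (G -> R[i]^o) :=
  NormedSpace
    [set alpha t | t in ptensor ell2 ell2]
    (fun u => inf [set ptensor_norm ell2 ell2 t |
                    t in [set t | ptensor ell2 ell2 t /\ alpha t = u]]).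

Definition pointwise_mul (u v : G -> R[i]^o) : G -> R[i]^o :=
  fun s => u s * v s.

End fourier.

(* Main.v *)
(* Write lambda for the left regular representation of G.  Let e(s) =
   <lambda(s) xi, xi> with xi a finitely supported unit vector that is almost
   invariant (G is amenable), and let rho be a unitary representation of finite
   dimension n whose normalized trace is small on a given finite set of
   nontrivial elements (G is maximally almost periodic: tensor powers of
   representations separating points).  Choosing orthonormal bases of
   irreducible components of rho writes tr rho(x^-1 y) as the sum, over the
   matrix coefficients u inside the irreducible blocks, of conj(u(x)) u(y), so
     m(x, y) = n^-1 e(x) e(y) tr rho(x^-1 y)
   is a finite tensor of A(G) (x) A(G).  By Fell's absorption principle e u has
   norm at most 1 in A(G), so the norm of m is at most n^-1 times the number of
   coefficients, the sum of the squared dimensions of the blocks.  One-dimensional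
   blocks account for the [G, G]-invariant vectors of rho, whose dimension
   |[G, G]|^-1 sum_(h in [G, G]) tr rho(h) is close to n / |[G, G]|; the other
   blocks have dimension at most maxdeg G.  Off the diagonal m is small, whence
   a.m - m.a -> 0, and on the diagonal it is e^2, an approximate unit. *)

From HB Require Import structures.
Require Import Defs.
From mathcomp Require Import all_boot all_order all_algebra.
From mathcomp Require Import sesquilinear spectral.
From mathcomp Require Import all_classical all_reals all_analysis.
From mathcomp Require Import complex finmap ring lra zify.
From mathcomp.analysis.showcase Require summability.

Set Implicit Arguments.
Unset Strict Implicit.
Unset Printing Implicit Defensive.

Import Order.TTheory GRing.Theory Num.Theory.
Import numFieldNormedType.Exports.

Local Open Scope classical_set_scope.
Local Open Scope ring_scope.
Local Open Scope sesquilinear_scope.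

(** The ideal m would be the indicator function of the diagonal of G x G, and n^-1 tr rho(x^-1 y)
    approximates it pointwise; the factors e(x) e(y) cut it down to a finite set, where tensors can
    be expanded in point masses and estimated crudely. Hence the order of choices: e comes first,
    because its support K determines both the finite set of x^-1 y at which the trace must be small
    and the factor |K|^2 that this smallness has to beat. The constant arises by counting. If m of
    the n dimensions lie in one-dimensional blocks and the other blocks have dimension at most D,
    there are at most m + D(n - m) coefficients; with l = |[G, G]| and m/n close to 1/l this is
    about n(1/l + D(1 - 1/l)) = n(1 + (D - 1)(1 - 1/l)). If maxdeg is +oo, so is the bound, unless
    [G, G] is trivial: there oo * 0 = 0, and this case is treated apart with D = 1. *)

Local Notation normc := Normc.normc.

(** * Finite-dimensional Hilbert spaces *)

(* An alias is needed because 'rV already carries the sup norm. *)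
Definition hvec (R : realType) (d : nat) := 'rV[R[i]]_d.

HB.instance Definition _ (R : realType) (d : nat) :=
  GRing.Lmodule.copy (hvec R d) 'rV[R[i]]_d.

Definition hdot (R : realType) (d : nat) (u v : hvec R d) : R[i] :=
  dotmx (u : 'rV[R[i]]_d) (v : 'rV[R[i]]_d).

Section hvec_dot.
Context (R : realType) (d : nat).

HB.instance Definition _ := Bilinear.copy (@hdot R d) (@dotmx R[i] d).
HB.instance Definition _ := Hermitian.copy (@hdot R d) (@dotmx R[i] d).
HB.instance Definition _ := Dot.copy (@hdot R d) (@dotmx R[i] d).

Definition hnorm (u : hvec R d) : R[i] := sqrtC (dotmx (u : 'rV[R[i]]_d) u).

Lemma hnormD (u v : hvec R d) : hnorm (u + v) <= hnorm u + hnorm v.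
Proof. exact: (triangle_lerif (@dotmx R[i] d) u v).1. Qed.

Lemma hnormZ (a : R[i]) (u : hvec R d) : hnorm (a *: u) = `|a| * hnorm u.
Proof.
rewrite /hnorm dnormZ rootCMl ?exprn_ge0// sqrCK//.
Qed.

Lemma hnorm0_eq0 (u : hvec R d) : hnorm u = 0 -> u = 0.
Proof. by move/eqP; rewrite sqrt_dnorm_eq0 => /eqP. Qed.

HB.instance Definition _ :=
  Lmodule_isNormed.Build R[i] (hvec R d) hnormD hnormZ hnorm0_eq0.

Lemma hdotE (u v : hvec R d) : hdot u v = \sum_j u 0 j * (v 0 j)^*.
Proof.
by rewrite /hdot dotmxE mxE; apply: eq_bigr => j _; rewrite !mxE.
Qed.

Lemma hnormE (u : hvec R d) : `|u| = sqrtC (hdot u u).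
Proof. by []. Qed.

Lemma normr_coord_le (u : hvec R d) j : `|u 0 j| <= `|u|.
Proof.
rewrite -(@ler_pXn2r _ 2) ?nnegrE//.
rewrite hnormE sqrtCK hdotE normCK (bigD1 j)//= lerDl sumr_ge0// => k _.
exact: mul_conjC_ge0.
Qed.

Lemma hnorm_le_sum (u : hvec R d) : `|u| <= \sum_j `|u 0 j|.
Proof.
have -> : u = \sum_j u 0 j *: (delta_mx 0 j : hvec R d).
  by rewrite {1}[u](row_sum_delta (u : 'rV[R[i]]_d)).
rewrite (le_trans (ler_norm_sum _ _ _))// ler_sum// => j _.
rewrite normrZ hnormE hdotE (bigD1 j)//= big1 ?addr0; last first.
  by move=> k /negbTE kj; rewrite !mxE kj andbF mul0r.
rewrite !mxE !eqxx/= mul1r conjC1 sqrtC1 mulr1.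
rewrite summxE (bigD1 j)//= big1 ?addr0; last first.
  by move=> k kj; rewrite !mxE eq_sym (negbTE kj) andbF mulr0.
by rewrite !mxE !eqxx mulr1.
Qed.

End hvec_dot.

Section hvec_complete.
Context (R : realType) (d : nat).

(** Completeness is pulled back from R: real and imaginary parts of coordinates are 1-Lipschitz for
    the norm, which in turn is at most the sum of the moduli of the coordinates. *)
Lemma hvec_complete (F : set_system (hvec R d)) :
  ProperFilter F -> cauchy F -> cvg F.
Proof.
move=> FF /cauchy_ballP Fc.
have cvgp (p : R[i] -> R) : (forall z w, p (z - w) = p z - p w) ->
    (forall z, `|p z|%:C%C <= `|z|) ->
    forall j, exists l : R, (fun x : hvec R d => p (x 0 j)) @ F --> l.
  move=> pB pn j; apply/cvg_ex.
  have /R_complete : ProperFilter ((fun x : hvec R d => p (x 0 j)) @ F).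
    exact: fmap_proper_filter.
  apply; apply/cauchy_ballP => e e0.
  have /Fc : 0 < e%:C%C by rewrite ltcR.
  rewrite !near_simpl => -[[A B] /= [FA FB] AB].
  exists ((fun x : hvec R d => p (x 0 j)) @` A, (fun x : hvec R d => p (x 0 j)) @` B) => /=.
    by split; [apply: filterS FA => x Ax | apply: filterS FB => x Ax]; exists x.
  move=> [_ _] [/= [x Ax <-] [y By <-]].
  have /= := AB (x, y) (conj Ax By).
  rewrite -ball_normE /= -ball_normE /= => xy.
  rewrite -ltcR (le_lt_trans _ xy)//= -pB (le_trans (pn _))//.
  by have := normr_coord_le (x - y) j; rewrite !mxE.
have [lr lrP] : {lr : 'I_d -> R & forall j,
    (fun x : hvec R d => complex.Re (x 0 j)) @ F --> lr j}.
  apply: (choice (P := fun j l => (fun x : hvec R d => complex.Re (x 0 j)) @ F --> l)).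
  apply: cvgp; first by move=> [? ?] [? ?].
  exact: normc_ge_Re.
have [li liP] : {lr : 'I_d -> R & forall j,
    (fun x : hvec R d => complex.Im (x 0 j)) @ F --> lr j}.
  apply: (choice (P := fun j l => (fun x : hvec R d => complex.Im (x 0 j)) @ F --> l)).
  apply: cvgp; first by move=> [? ?] [? ?].
  move=> [a b]; rewrite normc_def lecR /= -sqrtr_sqr ler_wsqrtr// lerDr sqr_ge0//.
apply/cvg_ex; exists ((\row_j (lr j +i* li j)%C) : hvec R d).
apply/cvgrPdist_lt => e e0.
have [r r0 er] : exists2 r : R, 0 < r & e = r%:C%C.
  exists (complex.Re e); last by rewrite RRe_real// gtr0_real.
  by rewrite -ltcR RRe_real// gtr0_real.
(* The 2 accounts for real and imaginary parts; [d.+1] instead of d makes the final inequality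
   strict and covers d = 0. *)
pose r' := r / (d.+1%:R * 2).
have r'0 : 0 < r' by rewrite divr_gt0// mulr_gt0// ltr0Sn.
have H : F [set x : hvec R d | forall j, `|lr j - complex.Re (x 0 j)| < r' /\ `|li j - complex.Im (x 0 j)| < r'].
  apply: filter_forall => j; apply: filterI.
    by move/cvgrPdist_lt : (lrP j); apply.
  by move/cvgrPdist_lt : (liP j); apply.
apply: filterS H => x xP.
rewrite (le_lt_trans (hnorm_le_sum _))//.
rewrite (@le_lt_trans _ _ (\sum_(j < d) (r' * 2)%:C%C))//.
  apply: ler_sum => j _; rewrite !mxE.
  have [] := xP j.
  case: (x 0 j) => a b /= h1 h2.
  have -> : ((lr j +i* li j) - (a +i* b))%C =
    (lr j - a)%:C%C + (li j - b)%:C%C * 'i%C :> R[i] by simpc.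
  rewrite (le_trans (ler_normD _ _))// normrM.
  rewrite [leRHS](_ : _ = r'%:C%C + r'%:C%C); last by rewrite mulr_natr mulr2n rmorphD.
  apply: lerD.
    by rewrite normc_def/= expr0n addr0 sqrtr_sqr lecR ltW.
  rewrite !normc_def/= expr0n/= expr1n add0r sqrtr1 addr0 mulr1.
  by rewrite sqrtr_sqr lecR ltW.
have rE : r = r' * 2 * d.+1%:R by rewrite /r' -[RHS]mulrA [2 * _]mulrC divfK// mulf_neq0 ?pnatr_eq0.
rewrite sumr_const card_ord -rmorphMn/= er ltcR -[ltLHS]mulr_natr [ltRHS]rE.
by rewrite ltr_pM2l ?mulr_gt0// ltr_nat.
Qed.

HB.instance Definition _ := Uniform_isComplete.Build (hvec R d) hvec_complete.

End hvec_complete.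

(** * Finite-dimensional unitary representations *)

Definition unitary_mxrep (C : numClosedFieldType) (G : groupType) n
    (rho : G -> 'M[C]_n) : Prop :=
  [/\ rho 1%g = 1%:M, forall g h, rho (g * h)%g = rho g *m rho h
    & forall g, rho g \is unitarymx].

Definition mxstable (C : numClosedFieldType) (G : groupType) m n
    (rho : G -> 'M[C]_n) (W : 'M[C]_(m, n)) : Prop :=
  forall g, (W *m rho g <= W)%MS.

Definition mxirr (C : numClosedFieldType) (G : groupType) m n
    (rho : G -> 'M[C]_n) (W : 'M[C]_(m, n)) : Prop :=
  W != 0 /\ forall k (U : 'M[C]_(k, n)),
    (U <= W)%MS -> mxstable rho U -> U != 0 -> (W <= U)%MS.

(** Among matrices with rows in W take one of maximal rank: adjoining an element of W as a new row
    cannot raise the rank. This turns the subspaces in [irreducible_rep] into the row spaces of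
    [mxirr]. *)
Lemma linear_set_rowspace (F : fieldType) d (W : set 'rV[F]_d) :
  W 0 -> (forall a x y, W x -> W y -> W (a *: x + y)) ->
  exists m (A : 'M[F]_(m, d)), forall v, W v <-> (v <= A)%MS.
Proof.
move=> W0 WP.
pose P k := `[< exists m (A : 'M[F]_(m, d)), (forall i, W (row i A)) /\ \rank A = k >].
have P0 : exists k, P k.
  exists 0%N; apply/asboolP; exists 0%N, 0; split; first by case.
  by rewrite mxrank0.
have Pd k : P k -> (k <= d)%N.
  by move=> /asboolP[m [A [_ <-]]]; apply: rank_leq_col.
case: (ex_maxnP P0 Pd) => k /asboolP[m [A [AW rA]]] kmax.
exists m, A => v; split=> [Wv|/submxP[u ->]].
  have /kmax : P (\rank (col_mx A v)).
    apply/asboolP; exists (m + 1)%N, (col_mx A v); split=> // i.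
    by case: (split_ordP i) => j ->; rewrite ?rowKu ?rowKd// row_id.
  rewrite -rA => rle.
  have /andP[_] : (A == col_mx A v)%MS.
    by rewrite -(mxrank_leqif_eq _).2 ?eqn_leq ?rle ?mxrankS// -addsmxE addsmxSl.
  by apply: submx_trans; rewrite -addsmxE addsmxSr.
rewrite mulmx_sum_row; elim/big_rec: _ => // i x _ Wx; exact: WP.
Qed.

Lemma counting_range_inj (R : realType) (T : choiceType) d (f : 'I_d -> T) :
  injective f -> counting (range f) = d%:R%:E :> \bar R.
Proof.
move=> fi; have rE : range f = [set` [fset f i | i in 'I_d]%fset].
  apply/seteqP; split=> [_ [i _ <-]|x /imfsetP[i _ ->]] /=; last by exists i.
  exact: in_imfset.
rewrite /counting rE asboolT// set_fsetK card_imfset//=.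
by rewrite -cardE card_ord.
Qed.

Section maxdeg.
Context (R : realType) (G : groupType) (n : nat).
Variable rho : G -> 'M[R[i]]_n.
Hypothesis rho_rep : unitary_mxrep rho.

(** The rows of B are an orthonormal basis of the block, so compressing rho by B gives an
    irreducible unitary representation on [hvec R d], whose standard basis has d elements. *)
Lemma maxdeg_ge d (B : 'M[R[i]]_(d, n)) : B \is unitarymx ->
  mxstable rho B -> mxirr rho B -> (d%:R%:E <= maxdeg R G)%E.
Proof.
move=> Bu Bst [B0 Birr]; have [r1 rM rU] := rho_rep.
pose sigma g : 'M[R[i]]_d := B *m rho g *m B^t*.
have sE g : B *m rho g = sigma g *m B.
  have /submxP[X XE] := Bst g.
  by rewrite /sigma XE -(mulmxA X) (unitarymxP Bu) mulmx1.
have sM g h : sigma (g * h)%g = sigma g *m sigma h.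
  by rewrite {1}/sigma rM !mulmxA sE -!mulmxA /sigma !mulmxA.
(* Matrices act on rows from the right, so the left action of g is by g^-1. *)
pose pi g : {linear hvec R d -> hvec R d} := mulmxr (sigma g^-1%g).
have piE g (x : hvec R d) : pi g x = (x : 'rV[R[i]]_d) *m sigma g^-1%g by [].
apply: ereal_sup_ubound; exists (hvec R d), (@hdot R d), pi,
  (range (fun j : 'I_d => (delta_mx 0 j : hvec R d))); split.
- move=> x; rewrite hnormE sqrtCK//.
- split.
  + move=> x; rewrite piE invg1 /sigma r1 mulmx1 (unitarymxP Bu) mulmx1//.
  + move=> g h x; have E : sigma (g * h)^-1%g = sigma h^-1%g *m sigma g^-1%g.
      by rewrite invgM sM.
    exact: (etrans (congr1 (mulmx (x : 'rV[R[i]]_d)) E) (mulmxA _ _ _)).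
  + move=> g x y; rewrite !piE.
    rewrite -[LHS]/(@dotmx R[i] d (x *m sigma g^-1%g) (y *m sigma g^-1%g)).
    rewrite -[RHS]/(@dotmx R[i] d x y) !dotmxE.
    have su : sigma g^-1%g *m (sigma g^-1%g)^t* = 1%:M.
      have sB : sigma g^-1%g *m B \is unitarymx by rewrite -sE mul_unitarymx.
      have := unitarymxP sB; rewrite trmx_mul map_mxM mulmxA -(mulmxA _ B).
      by rewrite (unitarymxP Bu) mulmx1.
    rewrite trmx_mul map_mxM /= mulmxA -(mulmxA x) su mulmx1//.
- split.
    have d0 : (0 < d)%N by rewrite lt0n; apply: contra_neq B0 => d0; move: B {Bu Bst Birr sigma sE sM pi piE}; rewrite d0 => B; rewrite flatmx0.
    exists (const_mx 1 : hvec R d); apply/eqP => /rowP/(_ (Ordinal d0)).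
    by move/eqP; rewrite !mxE oner_eq0.
  move=> W [_ W0 WL Wst].
  have [m [A AP]] := linear_set_rowspace W0 WL.
  have [A0|A0] := eqVneq A 0.
    left; apply/seteqP; split=> [x /AP|_ -> //].
    by move=> /submxP[u ->]; rewrite A0 mulmx0.
  (* [A *m B] transports W into the row space of B, where minimality makes it everything;
     multiplication by B^t* returns to coordinates. *)
  right; apply/seteqP; split=> // x _; apply/AP.
  have : (B <= A *m B)%MS.
    apply: Birr; first exact: submxMl.
      move=> g; rewrite -mulmxA sE mulmxA submxMr//.
      apply/row_subP => i; rewrite row_mul; apply/AP.
      have := Wst g^-1%g (row i A); rewrite piE invgK; apply.
      by apply/AP; apply: row_sub.
    apply: contra_neq A0 => /(congr1 (fun M => M *m B^t*)) /=.
    by rewrite -mulmxA (unitarymxP Bu) mulmx1 mul0mx.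
  move=> BA; have := submxMr (B^t*) BA; rewrite -mulmxA (unitarymxP Bu) mulmx1.
  by apply: submx_trans; apply: submx1.
- split.
  + move=> _ [j _ <-]; apply: (etrans (hdotE _ _)).
    rewrite (bigD1 j)//= big1; first by rewrite !mxE !eqxx conjC1 mulr1 addr0.
    by move=> k /negbTE kj; rewrite !mxE kj mul0r.
  + move=> _ _ [j _ <-] [k _ <-] jk; apply: (etrans (hdotE _ _)).
    rewrite big1// => l _.
    rewrite !mxE eqxx/=; have [->|] := eqVneq l j; last by rewrite mul0r.
    have [jk'|] := eqVneq j k; last by rewrite conjC0 mulr0.
    by rewrite jk' eqxx in jk.
  + move=> x xP; apply/rowP => j; rewrite mxE.
    have := xP _ (ex_intro2 _ _ j I erefl).
    move/(etrans (esym (hdotE _ _))); rewrite (bigD1 j)//= big1.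
      by rewrite addr0 !mxE !eqxx conjC1 mulr1.
    by move=> k /negbTE kj; rewrite !mxE kj conjC0 mulr0.
- rewrite counting_range_inj// => i j /matrixP/(_ 0 i); rewrite !mxE !eqxx/=.
  by case: eqVneq => // _ /eqP; rewrite oner_eq0.
Qed.

End maxdeg.

(** * Splitting a unitary representation into irreducible blocks *)

Section decomposition.
Context (C : numClosedFieldType) (G : groupType) (n : nat).
Variable rho : G -> 'M[C]_n.
Hypothesis rho_rep : unitary_mxrep rho.

Lemma unitary_mxrepV g : rho g^-1%g = (rho g)^t*.
Proof.
have [r1 rM rU] := rho_rep.
by rewrite -[LHS](mulmxtVK _ (rU g)) -rM mulVg r1 mul1mx.
Qed.

Lemma unitarymxK d (B : 'M[C]_(d, n)) : B \is unitarymx -> B *m B^t* = 1%:M.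
Proof. by move/unitarymxP. Qed.

Lemma submx_unitaryE d m (B : 'M[C]_(d, n)) (V : 'M[C]_(m, n)) :
  B \is unitarymx -> (V <= B)%MS -> V *m B^t* *m B = V.
Proof.
by move=> Bu /submxP[X ->]; rewrite -(mulmxA X) unitarymxK// mulmx1.
Qed.

Lemma adjmxM m1 m2 m3 (A : 'M[C]_(m1, m2)) (B : 'M[C]_(m2, m3)) :
  (A *m B)^t* = B^t* *m A^t*.
Proof. by rewrite trmx_mul map_mxM. Qed.

(** An orthogonal projection is determined by its range: with Q = V^t* V one has P Q = P and Q P =
    Q, and the adjoint of the former is Q P = P. *)
Lemma hermitian_idempotentE d (V : 'M[C]_(d, n)) (P : 'M[C]_n) :
  V \is unitarymx -> P^t* = P -> P *m P = P -> (V :=: P)%MS -> V^t* *m V = P.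
Proof.
move=> Vu Ph PP VP.
have h1 : P *m (V^t* *m V) = P by rewrite mulmxA submx_unitaryE ?VP.
have h2 : V^t* *m V *m P = V^t* *m V.
  have /submxP[X ->] : (V <= P)%MS by rewrite VP.
  by rewrite -!mulmxA PP.
by rewrite -h2 -[RHS]Ph -[in RHS]h1 !adjmxM trmxCK Ph.
Qed.

Lemma proj_rowspace d e (B : 'M[C]_(d, n)) (B' : 'M[C]_(e, n)) :
  B \is unitarymx -> B' \is unitarymx -> (B :=: B')%MS ->
  B^t* *m B = B'^t* *m B'.
Proof.
move=> Bu Bu' BB'; apply: hermitian_idempotentE => //.
- by rewrite adjmxM trmxCK.
- by rewrite -mulmxA (mulmxA B') unitarymxK// mul1mx.
- apply: (eqmx_trans BB'); apply/eqmxP; rewrite submxMl andbT.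
  by rewrite -{1}[B']mul1mx -(unitarymxK Bu') -mulmxA submxMl.
Qed.

Lemma schmidt_row_base m (U : 'M[C]_(m, n)) :
  exists2 B : 'M[C]_(\rank U, n), B \is unitarymx & (B :=: U)%MS.
Proof.
exists (schmidt (row_base U)).
  by rewrite schmidt_unitarymx// rank_leq_col.
apply: (eqmx_trans _ (eq_row_base U)).
by apply: eqmx_schmidt_free; apply: row_base_free.
Qed.

(** Here c counts products conj(u(x)) u(y) with u a matrix coefficient between unit vectors (a
    unitary matrix with one row is a unit vector). It is a budget: every such product will cost at
    most 1/n in the norm of the diagonal. *)
Definition coef_decomposition (P : 'M[C]_n) (c : nat) : Prop :=
  exists s : seq ('rV[C]_n * 'rV[C]_n),
  [/\ (size s <= c)%N,
      forall p, p \in s -> p.1 \is unitarymx /\ p.2 \is unitarymx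
    & forall x y, \tr (P *m rho (x^-1 * y)%g) =
        \sum_(p <- s) ((p.1 *m rho x *m p.2^t*) 0 0)^* *
          (p.1 *m rho y *m p.2^t*) 0 0].

Lemma coef_decompositionD P1 P2 c1 c2 :
  coef_decomposition P1 c1 -> coef_decomposition P2 c2 ->
  coef_decomposition (P1 + P2) (c1 + c2).
Proof.
move=> [s1 [c1P u1 t1]] [s2 [c2P u2 t2]]; exists (s1 ++ s2); split.
- by rewrite size_cat leq_add.
- by move=> p; rewrite mem_cat => /orP[/u1|/u2].
- by move=> x y; rewrite mulmxDl mxtraceD t1 t2 big_cat.
Qed.

Section restriction.
Context (d : nat) (B : 'M[C]_(d, n)).
Hypotheses (Bu : B \is unitarymx) (Bst : mxstable rho B).

Definition mxrestr g := B *m rho g *m B^t*.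

Lemma mxrestrE g : B *m rho g = mxrestr g *m B.
Proof. by rewrite /mxrestr submx_unitaryE. Qed.

Lemma mxrestrM g h : mxrestr (g * h)%g = mxrestr g *m mxrestr h.
Proof.
have [_ rM _] := rho_rep.
by rewrite {1}/mxrestr rM mulmxA mxrestrE /mxrestr !mulmxA.
Qed.

Lemma mxrestrV g : mxrestr g^-1%g = (mxrestr g)^t*.
Proof. by rewrite /mxrestr !adjmxM trmxCK unitary_mxrepV mulmxA. Qed.

Lemma mxrestr_entry g i j :
  mxrestr g i j = (row i B *m rho g *m (row j B)^t*) 0 0.
Proof.
rewrite /mxrestr -row_mul mxE [RHS]mxE; apply: eq_bigr => k _.
by rewrite [row i _ _ _]mxE !mxE.
Qed.

Lemma row_unitary i : row i B \is unitarymx.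
Proof.
apply/unitarymxP/matrixP => a b; rewrite !ord1.
have /matrixP/(_ i i) := unitarymxK Bu; rewrite !mxE !eqxx => <-.
by apply: eq_bigr => k _; rewrite !mxE.
Qed.

(** The trace of sigma(x)^* sigma(y), with sigma the restriction of rho to the block, is the
    Hilbert-Schmidt product of two d x d matrices: one product for each of the d^2 entries. *)
Lemma coef_decomposition_square : coef_decomposition (B^t* *m B) (d * d).
Proof.
exists [seq (row k B, row j B) | k <- enum 'I_d, j <- enum 'I_d]; split.
- by rewrite size_allpairs -cardE card_ord.
- by move=> p /allpairsP[[k j] [_ _ ->]] /=; split; apply: row_unitary.
move=> x y; rewrite -mulmxA mxtrace_mulC -[X in \tr X]/(mxrestr _).
rewrite mxrestrM mxrestrV big_allpairs_dep mxtrace_mulC /mxtrace big_enum/=.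
apply: eq_bigr => k _; rewrite mxE big_enum/=; apply: eq_bigr => j _.
rewrite -!mxrestr_entry mulrC; congr (_ * _).
by rewrite [LHS]mxE; congr (_^*); rewrite mxE.
Qed.

Lemma stablemx_restr k (U : 'M[C]_(k, d)) :
  (forall g, (U *m mxrestr g <= U)%MS) -> mxstable rho (U *m B).
Proof. by move=> Ust g; rewrite -mulmxA mxrestrE mulmxA submxMr. Qed.

(** This kernel is the orthogonal complement of the row space of B; it is stable because the adjoint
    of rho(g) is rho(g^-1), which preserves that row space. *)
Lemma ortho_complement_stable : mxstable rho (kermx (B^t*)).
Proof.
move=> g; apply/sub_kermxP; rewrite -mulmxA.
have -> : rho g *m B^t* = B^t* *m (mxrestr g^-1%g)^t*.
  rewrite -adjmxM -mxrestrE adjmxM; congr (_ *m _).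
  by rewrite unitary_mxrepV trmxCK.
by rewrite mulmxA mulmx_ker mul0mx.
Qed.

End restriction.

Lemma minimal_stable m (V : 'M[C]_(m, n)) : V != 0 -> mxstable rho V ->
  exists d (B : 'M[C]_(d, n)), [/\ B \is unitarymx, (B <= V)%MS,
    mxstable rho B & mxirr rho B].
Proof.
move=> V0 Vst.
pose P k := `[< exists m (U : 'M[C]_(m, n)),
  [/\ (U <= V)%MS, mxstable rho U, U != 0 & \rank U = k] >].
have exP : exists k, P k by exists (\rank V); apply/asboolP; exists m, V.
case: (ex_minnP exP) => k /asboolP[m' [U [UV Ust U0 rU]]] kmin.
have [B Bu BU] := schmidt_row_base U.
exists (\rank U), B; split => //; first by rewrite BU.
  by move=> g; rewrite BU (eqmxMr _ BU) Ust.
split; first by apply: contra_neq U0 => B0; apply/eqP; rewrite -mxrank_eq0 -BU B0 mxrank0.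
move=> k' W WB Wst W0.
have WU : (W <= U)%MS by rewrite -BU.
have /kmin : P (\rank W).
  by apply/asboolP; exists k', W; split=> //; apply: submx_trans UV.
rewrite -rU BU => rle.
have /andP[_ //] : (W == U)%MS.
by rewrite -(mxrank_leqif_eq WU).2 eqn_leq rle mxrankS.
Qed.

(** Strong induction on d: an irreducible block of dimension e costs e * e <= D * e, and the rest of
    V is its orthogonal complement inside V. *)
Lemma coef_decomposition_irr D d (V : 'M[C]_(d, n)) : V \is unitarymx ->
  mxstable rho V ->
  (forall e (B : 'M[C]_(e, n)), B \is unitarymx -> (B <= V)%MS ->
     mxstable rho B -> mxirr rho B -> (e <= D)%N) ->
  coef_decomposition (V^t* *m V) (D * d).
Proof.
elim/ltn_ind: d V => d IH V Vu Vst VD.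
have [d0|d0] := posnP d.
  exists [::]; split=> // x y; rewrite big_nil.
  have -> : V = 0 by clear IH Vu Vst VD; move: V; rewrite d0 => V; exact: flatmx0.
  by rewrite mulmx0 mul0mx mxtrace0.
have V0 : V != 0 by rewrite -mxrank_eq0 mxrank_unitary// -lt0n.
have [e [B [Bu BV Bst Birr]]] := minimal_stable V0 Vst.
pose K := (V :&: kermx (B^t*))%MS.
have [B2 B2u B2K] := schmidt_row_base K.
have B2V : (B2 <= V)%MS by rewrite B2K capmxSl.
have B2B : B2 *m B^t* = 0 by apply/sub_kermxP; rewrite B2K capmxSr.
have B2st : mxstable rho B2.
  move=> g; rewrite B2K (eqmxMr _ B2K) sub_capmx.
  rewrite (submx_trans _ (Vst g)) ?submxMr ?capmxSl//=.
  by rewrite (submx_trans _ (ortho_complement_stable Bu Bst g)) ?submxMr ?capmxSr.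
have Mu : col_mx B B2 \is unitarymx.
  apply/unitarymxP; rewrite tr_col_mx map_row_mx mul_col_row !unitarymxK//.
  by rewrite B2B -[B *m _]trmxCK adjmxM trmxCK B2B trmx0 map_mx0 scalar_mx_block.
have MV : (col_mx B B2 :=: V)%MS.
  apply/eqmxP; rewrite col_mx_sub BV B2V/= -addsmxE.
  (* V minus its orthogonal projection to the block lies in K. *)
  rewrite -[V in (V <= _)%MS](subrK (V *m B^t* *m B)) addrC.
  rewrite addmx_sub_adds ?submxMl// B2K sub_capmx; apply/andP; split.
    by rewrite addmx_sub// eqmx_opp mulmx_sub.
  apply/sub_kermxP; rewrite mulmxBl -[V *m _ *m B *m _]mulmxA unitarymxK//.
  by rewrite mulmx1 subrr.
have ded : d = (e + \rank K)%N.
  by rewrite -(mxrank_unitary Vu) -(mxrank_unitary Mu) MV.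
have e0 : (0 < e)%N.
  by rewrite -(mxrank_unitary Bu) lt0n mxrank_eq0; case: Birr.
rewrite -(proj_rowspace Mu Vu MV) tr_col_mx map_row_mx mul_row_col ded mulnDr.
apply: coef_decompositionD.
  have eD := VD _ _ Bu BV Bst Birr.
  have [s [ss su st]] := coef_decomposition_square Bu Bst.
  by exists s; split=> //; rewrite (leq_trans ss)// leq_mul2r eD orbT.
apply: IH => //; first by rewrite ded -[X in (X < _)%N]add0n ltn_add2r.
by move=> k U Uu UB2; apply: VD => //; apply: submx_trans B2V.
Qed.

End decomposition.

(** Schur's argument: an eigenspace of one operator on the block is stable under all of them, hence
    is the whole block. So every group element acts as a scalar, and any single row of B spans a
    stable line. *)
Lemma commuting_irr_dim1 (C : numClosedFieldType) (G : groupType) n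
    (rho : G -> 'M[C]_n) (rho_rep : unitary_mxrep rho) d (B : 'M[C]_(d, n)) :
  B \is unitarymx -> mxstable rho B -> mxirr rho B ->
  (forall g h, B *m rho (g * h)%g = B *m rho (h * g)%g) -> (d <= 1)%N.
Proof.
move=> Bu Bst [B0 Birr] Bc.
have [//|d1] := leqP d 1; have d0 : (0 < d)%N by apply: ltnW.
pose s := mxrestr rho B.
have sC g h : s g *m s h = s h *m s g.
  by rewrite -!(mxrestrM rho_rep Bu Bst) /s /mxrestr Bc.
have sc g : exists a, s g = a%:M.
  have [a ea] := eigenvalue_closed (s g) d0; exists a.
  have EB0 : eigenspace (s g) a *m B != 0.
    apply: contraNneq ea => E0; apply/eqP.
    by rewrite -[LHS]mulmx1 -(unitarymxK Bu) mulmxA E0 mul0mx.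
  have Est : mxstable rho (eigenspace (s g) a *m B).
    apply: (stablemx_restr Bu Bst) => h.
    by have /comm_mx_stable_eigenspace := sC g h; apply.
  have := submxMr (B^t*) (Birr _ _ (submxMl _ _) Est EB0).
  rewrite -mulmxA unitarymxK// mulmx1 => /eigenspaceP.
  by rewrite mul1mx scalemx1.
pose v := row (Ordinal d0) B.
have vst : mxstable rho v.
  move=> g; have [a sa] := sc g.
  rewrite /v -row_mul (mxrestrE Bu Bst) -/(s g) sa mul_scalar_mx.
  by rewrite linearZ scalemx_sub.
have v0 : v != 0.
  rewrite -mxrank_eq0 mxrank_unitary//; exact: row_unitary.
have := Birr _ v (row_sub _ _) vst v0.
move=> /mxrankS; rewrite mxrank_unitary// => dv.
by have := leq_trans dv (rank_leq_row v); rewrite leqNgt d1.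
Qed.

(** * The projection onto the vectors fixed by the commutator subgroup *)

Section average.
Context (C : numClosedFieldType) (G : groupType) (n : nat).
Variable rho : G -> 'M[C]_n.
Hypothesis rho_rep : unitary_mxrep rho.
Variable L : seq G.
Hypotheses (Lu : uniq L) (L1 : 1%g \in L)
  (LM : forall x y, x \in L -> y \in L -> (x * y)%g \in L)
  (LV : forall x, x \in L -> x^-1%g \in L)
  (LJ : forall g x, x \in L -> (g * x * g^-1)%g \in L)
  (LR : forall x y : G, commg x y \in L).

(** L lists a finite normal subgroup that contains all commutators, so this is the orthogonal
    projection onto the vectors fixed by that subgroup, and it commutes with rho. *)
Definition mxaverage := (size L)%:R^-1 *: \sum_(h <- L) rho h.

Let N0 : (size L)%:R != 0 :> C.
Proof. by rewrite pnatr_eq0 -lt0n; case: L L1. Qed.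

Lemma perm_bij (f g : G -> G) : cancel f g -> (forall x, x \in L -> f x \in L) ->
  perm_eq (map f L) L.
Proof.
move=> fK fL; have fu : uniq (map f L) by rewrite map_inj_uniq//; exact: can_inj fK.
have fs : {subset map f L <= L} by move=> _ /mapP[x xL ->]; apply: fL.
have [_ fe] := uniq_min_size fu fs (eq_leq (esym (size_map f L))).
exact: uniq_perm.
Qed.

Lemma mxaverageJ g : rho g *m mxaverage = mxaverage *m rho g.
Proof.
have [r1 rM rU] := rho_rep.
rewrite /mxaverage -scalemxAr -scalemxAl; congr (_ *: _).
rewrite mulmx_sumr mulmx_suml.
have LJp : perm_eq (map (fun x => g * x * g^-1)%g L) L.
  apply: (perm_bij (g := fun x => g^-1 * x * g)%g); last by move=> ? /LJ.
  by move=> x; rewrite !mulgA mulVg mul1g mulgVK.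
rewrite -[RHS](perm_big _ LJp)/= big_map.
by apply: eq_bigr => h _; rewrite -!rM mulgVK.
Qed.

Lemma mxaverageM k : k \in L -> rho k *m mxaverage = mxaverage.
Proof.
move=> kL; have [r1 rM rU] := rho_rep.
rewrite /mxaverage -scalemxAr; congr (_ *: _).
have p : perm_eq (map (fun x => k * x)%g L) L.
  by apply: (perm_bij (g := fun x => k^-1 * x)%g); [exact: mulKg | move=> x; apply: LM].
rewrite mulmx_sumr -[RHS](perm_big _ p)/= big_map.
by apply: eq_bigr => h _; rewrite rM.
Qed.

Lemma mxaverage_idem : mxaverage *m mxaverage = mxaverage.
Proof.
rewrite {1}/mxaverage -scalemxAl mulmx_suml.
rewrite [X in _ *: X](eq_big_seq (fun=> mxaverage)); last first.
  by move=> h hL; rewrite mxaverageM.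
by rewrite big_const_seq count_predT iter_addr_0 -[mxaverage *+ _]scaler_nat scalerA mulVf ?scale1r.
Qed.

Lemma mxaverage_herm : mxaverage^t* = mxaverage.
Proof.
rewrite /mxaverage linearZ map_mxZ/= fmorphV rmorph_nat; congr (_ *: _).
have p : perm_eq (map (fun x => x^-1)%g L) L.
  by apply: (perm_bij (g := fun x => x^-1)%g); [exact: invgK | exact: LV].
rewrite raddf_sum map_mx_sum -[RHS](perm_big _ p)/= big_map.
by apply: eq_bigr => h _; rewrite (unitary_mxrepV rho_rep).
Qed.

Lemma herm_idem_unitary (P : 'M[C]_n) : P^t* = P -> P *m P = P ->
  (forall g, rho g *m P = P *m rho g) ->
  exists d (V : 'M[C]_(d, n)), [/\ V \is unitarymx, mxstable rho V,
    V^t* *m V = P & \tr P = d%:R].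
Proof.
move=> Ph PP Pc; have [V Vu VP] := schmidt_row_base P.
have VE := hermitian_idempotentE Vu Ph PP VP.
exists (\rank P), V; split=> //.
  move=> g; rewrite VP (eqmxMr _ VP) -Pc.
  exact: submxMl.
by rewrite -[in LHS]VE mxtrace_mulC unitarymxK// mxtrace1.
Qed.

(** Split 1 = P + (1 - P) with P the average. On the range of P commutators act trivially, so
    irreducible blocks are lines and cost 1 per dimension; on the complement the cost is D per
    dimension. The number m is the rank of P, which is its trace. *)
Lemma coef_decomposition_average D :
  (forall e (B : 'M[C]_(e, n)), B \is unitarymx ->
     mxstable rho B -> mxirr rho B -> (e <= D)%N) ->
  exists m, [/\ (m <= n)%N, \tr mxaverage = m%:R &
    coef_decomposition rho 1%:M (m + D * (n - m))].
Proof.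
move=> HD; set P := mxaverage.
have [d1 [V1 [V1u V1st V1P trP1]]] :=
  herm_idem_unitary mxaverage_herm mxaverage_idem mxaverageJ.
have [] := @herm_idem_unitary (1%:M - P).
- rewrite linearB map_mxB/= trmx1 map_mx1; congr (_ - _); exact: mxaverage_herm.
- by rewrite mulmxBl mul1mx mulmxBr mulmx1 mxaverage_idem subrr subr0.
- by move=> g; rewrite mulmxBl mulmxBr mul1mx mulmx1 mxaverageJ.
move=> d2 [V2 [V2u V2st V2P trP2]].
have dn : (d1 + d2)%N = n.
  apply/eqP; rewrite -(eqr_nat C) natrD -trP1 -trP2 -mxtraceD addrC subrK.
  by rewrite mxtrace1.
exists d1; split; first by rewrite -dn leq_addr.
  by rewrite trP1.
have -> : (n - d1 = d2)%N by rewrite -dn addKn.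
rewrite -/P in V1P. rewrite -(subrK P 1%:M) addrC -V2P -{1}V1P.
apply: coef_decompositionD; last first.
  by apply: coef_decomposition_irr => // e B Bu _; apply: HD.
rewrite -[d1 in X in coef_decomposition _ _ X]mul1n; apply: coef_decomposition_irr => // e B Bu BV1 Bst Birr.
apply: (commuting_irr_dim1 rho_rep Bu Bst Birr) => g h.
have [r1 rM rU] := rho_rep.
have BP : B = B *m P by rewrite -V1P mulmxA submx_unitaryE.
(* The products g h and h g differ by a commutator, which P absorbs. *)
rewrite commgCV (rM (commg _ _)) {1}BP -(mulmxA B) (mulmxA P) -mxaverageJ mxaverageM//.
by rewrite mulmxA -BP.
Qed.

End average.

(** * Characters and induced representations *)

Section character_extension.
Context (C : numClosedFieldType) (G : groupType) (S : set G).
Hypotheses (Ssub : is_subgroup S)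
  (SC : forall x y, S x -> S y -> (x * y = y * x)%g).

Let S1 : S 1%g. Proof. by case: Ssub. Qed.
Let SM x y : S x -> S y -> S (x * y)%g. Proof. by case: Ssub => _ + _; apply. Qed.
Let SV x : S x -> S x^-1%g. Proof. by case: Ssub => _ _; apply. Qed.
Let SX x k : S x -> S (x ^+ k)%g.
Proof. by move=> Sx; elim: k => [//|k IH]; rewrite expgS; apply: SM. Qed.

(* A is the graph of a unitary character of a subgroup of S, for Zorn's lemma. *)
Definition partial_character (A : set (G * C)) : Prop :=
  [/\ forall x a, A (x, a) -> S x /\ `|a| = 1,
      forall x y a b, A (x, a) -> A (y, b) -> A ((x * y)%g, a * b),
      forall x a, A (x, a) -> A (x^-1%g, a^-1)
    & forall a, A (1%g, a) -> a = 1].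

Lemma partial_character_fun A x a b : partial_character A ->
  A (x, a) -> A (x, b) -> a = b.
Proof.
move=> [AS AM AV A1] xa xb; have := AM _ _ _ _ xa (AV _ _ xb).
rewrite mulgV => /A1 /(congr1 (fun t => t * b)); rewrite mul1r mulfVK//.
by have [_ /eqP] := AS _ _ xb; apply: contraTneq => ->; rewrite normr0 eq_sym oner_eq0.
Qed.

Lemma partial_characterX A x a k : partial_character A -> A (1%g, 1) ->
  A (x, a) -> A ((x ^+ k)%g, a ^+ k).
Proof.
move=> [AS AM AV A1] A11 xa; elim: k => [//|k IH].
by rewrite expgS exprS; apply: AM.
Qed.

(** Any root of 1 + X + ... + X^(m-1) will do: this polynomial takes the value m at 1. *)
Lemma unit_root_neq1 m : (1 < m)%N -> exists2 c : C, c ^+ m = 1 & c != 1.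
Proof.
move=> m1; pose p : {poly C} := \poly_(i < m) 1.
have sp : size p = m by rewrite size_poly_eq ?oner_neq0.
have [c] : exists c, root p c.
  by apply/closed_rootP; rewrite sp; case: m m1 {p sp} => [|[]].
rewrite /root horner_poly => /eqP pc.
have pc' : \sum_(i < m) c ^+ i = 0.
  by rewrite -[RHS]pc; apply: eq_bigr => i _; rewrite mul1r.
exists c; first by apply/eqP; rewrite -subr_eq0 subrX1 pc' mulr0.
apply: contra_eq_neq pc' => ->.
rewrite (eq_bigr (fun=> 1)) => [|i _]; last by rewrite expr1n.
by rewrite sumr_const card_ord pnatr_eq0 -lt0n ltnW.
Qed.

(** If a positive power of x is already in the domain, take the least exponent m; the exponents in
    question are the multiples of m, and c must be an m-th root of the value at x^m. Otherwise c is
    unconstrained, and -1 is taken to have c != 1. Over the trivial character a nontrivial root of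
    unity is available, which is what separates x from 1. *)
Lemma partial_character_value A x : partial_character A -> A (1%g, 1) -> S x ->
  exists c : C, [/\ `|c| = 1, forall k b, A ((x ^+ k)%g, b) -> b = c ^+ k
    & A = [set (1%g, 1)] -> x != 1%g -> c != 1].
Proof.
move=> Ap A11 Sx; have [AS AM AV A1] := Ap.
pose P k := `[< (0 < k)%N /\ exists b, A ((x ^+ k)%g, b) >].
have [exP|nP] := pselect (exists k, P k); last first.
  exists (-1); split; first by rewrite normrN1.
    move=> [|k] b xb; first by rewrite expr0; apply: A1.
    by case: nP; exists k.+1; apply/asboolP; split=> //; exists b.
  move=> _ _; rewrite -subr_eq0 -opprD oppr_eq0 -[1 + 1]/(2%:R).
  by rewrite pnatr_eq0.
case: (ex_minnP exP) => m /asboolP[m0 [b0 xb0]] mmin.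
have dvd k b : A ((x ^+ k)%g, b) -> (m %| k)%N.
  move=> xk; rewrite /dvdn; have [//|r0] := posnP (k %% m)%N.
  suff /mmin : P (k %% m)%N by rewrite leqNgt ltn_mod m0.
  apply/asboolP; split=> //.
  exists (b * (b0 ^+ (k %/ m))^-1).
  have -> : (x ^+ (k %% m) = x ^+ k * (x ^+ m ^+ (k %/ m))^-1)%g.
    rewrite {2}(divn_eq k m) addnC expgnDr -expgnA [(m * _)%N]mulnC.
    by rewrite mulgK.
  by apply: AM => //; apply: AV; apply: partial_characterX.
have [c [cm c1 c2]] : exists c : C, [/\ c ^+ m = b0, `|c| = 1 &
    A = [set (1%g, 1)] -> x != 1%g -> c != 1].
  have nc (c : C) : c ^+ m = b0 -> `|c| = 1.
    move=> cm; apply/eqP; rewrite -(@pexpr_eq1 _ _ m)// -?normrX ?cm//.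
    by have [_ ->] := AS _ _ xb0.
  have [AE|AE] := pselect (A = [set (1%g, 1)] /\ x != 1%g); last first.
    exists (m.-root b0); split; [exact: rootCK | apply: nc; exact: rootCK |].
    by move=> A0 x1; case: AE.
  case: AE => AE x1; move: xb0; rewrite AE => -[xm b1].
  have m2 : (1 < m)%N.
    rewrite ltn_neqAle m0 andbT; apply: contraNneq x1 => m1.
    by move: xm; rewrite -m1 expg1 => ->.
  have [c cm c1] := unit_root_neq1 m2.
  by exists c; split=> //; [rewrite cm b1 | apply: nc; rewrite cm b1].
exists c; split=> // k b xk.
have /dvdnP[q kq] := dvd _ _ xk.
apply: (partial_character_fun Ap xk).
by rewrite kq mulnC expgnA exprM cm; apply: partial_characterX.
Qed.

Lemma partial_character_extend A x c : partial_character A -> A (1%g, 1) -> S x ->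
  `|c| = 1 -> (forall k b, A ((x ^+ k)%g, b) -> b = c ^+ k) ->
  exists B, [/\ partial_character B, A `<=` B & B (x, c)].
Proof.
move=> Ap A11 Sx nc cP; have [AS AM AV A1] := Ap.
have c0 : c != 0 by rewrite -normr_eq0 nc oner_eq0.
have cX k : c ^+ k != 0 by rewrite expf_neq0.
(* Consistency of the extension: A and the powers of c agree wherever a power of x meets the domain
   of A. *)
have key y b m l : A (y, b) -> (y * x ^+ m = x ^+ l)%g -> b * c ^+ m = c ^+ l.
  move=> yb; have [ml|lm] := leqP m l => E.
    have yE : y = (x ^+ (l - m))%g.
      by rewrite -[LHS](mulgK (x ^+ m)%g) E -{1}(subnK ml) expgnDr mulgK.
    by move: yb; rewrite yE => /cP ->; rewrite -exprD subnK.
  have yE : (y^-1 = x ^+ (m - l))%g.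
    apply: (@mulIg _ (x ^+ l)%g); rewrite -expgnDr subnK ?(ltnW lm)//.
    by rewrite -E mulKg.
  have /AV := yb; rewrite yE => /cP bE.
  have b0 : b != 0 by rewrite -normr_eq0 (AS _ _ yb).2 oner_eq0.
  by rewrite -{1}(subnK (ltnW lm)) exprD -bE mulrA mulfV// mul1r.
(* The extension to the subgroup generated by the domain and x sends y x^k to b c^k; powers on both
   sides of the equation replace negative exponents. *)
pose B : set (G * C) := [set p | S p.1 /\ `|p.2| = 1 /\ exists i j y b, [/\ A (y, b),
   (p.1 * x ^+ i = y * x ^+ j)%g & p.2 * c ^+ i = b * c ^+ j]].
exists B; split; last 2 first.
- move=> [y b] yb; have [Sy nb] := AS _ _ yb; do 2 split=> //.
  by exists 0%N, 0%N, y, b.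
- by do 2 split=> //; exists 0%N, 1%N, 1%g, 1; split; rewrite ?mulg1 ?mul1g ?expr0 ?mulr1 ?mul1r ?expr1.
split.
- by move=> y b [? [? _]].
- move=> y z a b [Sy [na [i [j [y' [a' [ya Ey Ea]]]]]]].
  move=> [Sz [nb [k [l [z' [b' [zb Ez Eb]]]]]]] /=; split; first exact: SM.
  rewrite normrM na nb mulr1; split=> //.
  have [Sy' _] := AS _ _ ya; have [Sz' _] := AS _ _ zb.
  exists (i + k)%N, (j + l)%N, (y' * z')%g, (a' * b'); split; first exact: AM.
    rewrite !expgnDr !mulgA -(mulgA y) (SC Sz (SX i Sx)) mulgA Ey.
    rewrite -!mulgA (_ : x ^+ j * (z * x ^+ k) = z' * (x ^+ j * x ^+ l))%g//.
    by rewrite Ez !mulgA (SC (SX j Sx) Sz').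
  by rewrite !exprD mulrACA Ea Eb mulrACA.
- move=> y a [Sy [na [i [j [y' [a' [ya Ey Ea]]]]]]]; split; first exact: SV.
  split; first by rewrite normfV na invr1.
  have [Sy' na'] := AS _ _ ya.
  exists j, i, y'^-1%g, a'^-1; split; first exact: AV.
    apply: (@mulgI _ y); rewrite mulVKg mulgA (SC Sy (SV Sy')) -mulgA Ey.
    by rewrite mulKg.
  have a0 : a != 0 by rewrite -normr_eq0 na oner_eq0.
  have a0' : a' != 0 by rewrite -normr_eq0 na' oner_eq0.
  rewrite /= mulrC [RHS]mulrC; apply/eqP; rewrite eqr_div//.
  by rewrite [_ * a']mulrC -Ea mulrC.
- move=> a [_ [na [i [j [y [b [yb]]]]]]]; rewrite mul1g /= => E Ea.
  apply: (mulIf (cX i)); rewrite Ea mul1r.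
  exact: key yb (esym E).
Qed.

(** Zorn's lemma: a character of the subgroup generated by z with value c != 1 at z extends to a
    maximal partial character, whose domain must be S. *)
Lemma character_separates z : S z -> z != 1%g ->
  exists chi : G -> C, [/\ forall x, S x -> `|chi x| = 1,
    forall x y, S x -> S y -> chi (x * y)%g = chi x * chi y & chi z != 1].
Proof.
move=> Sz z1; pose A0 : set (G * C) := [set (1%g, 1)].
have A0p : partial_character A0.
  split=> [_ _ [-> ->]|_ _ _ _ [-> ->] [-> ->]|_ _ [-> ->]|_ [->]] //.
  - by rewrite normr1.
  - by rewrite mulg1 mulr1.
  - by rewrite invg1 invr1.
have [c [nc cP cz]] := partial_character_value A0p erefl Sz.
have [A1 [A1p A01 A1z]] := partial_character_extend A0p erefl Sz nc cP.
pose P : set (set (G * C)) := [set A | partial_character A /\ (A !=set0 -> A (z, c))].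
have [F FP Ftot|A [[Ap Az] Amax]] := @Zorn_bigcup _ P.
  have F2 p q : (\bigcup_(X in F) X) p -> (\bigcup_(X in F) X) q ->
      exists X, [/\ F X, X p & X q].
    move=> [X FX Xp] [Y FY Yq]; have [XY|YX] := Ftot _ _ FX FY.
      by exists Y; split=> //; apply: XY.
    by exists X; split=> //; apply: YX.
  split; last first.
    by move=> [p [X FX Xp]]; exists X => //; apply: (FP _ FX).2; exists p.
  split.
  - by move=> x a [X FX Xp]; have [[+ _ _ _] _] := FP _ FX; apply.
  - move=> x y a b /F2 H /H[X [FX Xp Xq]]; exists X => //.
    by have [[_ + _ _] _] := FP _ FX; apply.
  - move=> x a [X FX Xp]; exists X => //.
    by have [[_ _ + _] _] := FP _ FX; apply.
  - by move=> a [X FX Xp]; have [[_ _ _ +] _] := FP _ FX; apply.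
have [An|An] := pselect (A !=set0); last first.
  exfalso; apply: (Amax A1); last by split.
  split; last by move=> A1A; case: An; exists (z, c); apply: A1A.
  by move=> p Apt; case: An; exists p.
have {Az} Az := Az An; have [AS AM AV A1'] := Ap.
have A11 : A (1%g, 1).
  have [p Ap'] := An; have := AM _ _ _ _ Az (AV _ _ Az).
  rewrite mulgV divff// -normr_eq0 nc oner_eq0//.
have dom x : S x -> exists a, A (x, a).
  move=> Sx; apply: contrapT => nx.
  have [d [nd dP _]] := partial_character_value Ap A11 Sx.
  have [B [Bp AB Bx]] := partial_character_extend Ap A11 Sx nd dP.
  apply: (Amax B); last by split=> // _; apply: AB.
  split=> // BA; apply: nx; exists d; exact: BA.
have [chi chiP] : {chi : G -> C & forall x, S x -> A (x, chi x)}.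
  apply: (choice (P := fun x a => S x -> A (x, a))) => x.
  have [Sx|nSx] := pselect (S x); last by exists 0.
  by have [a xa] := dom _ Sx; exists a.
exists chi; split.
- by move=> x Sx; have [] := AS _ _ (chiP _ Sx).
- move=> x y Sx Sy; apply: (partial_character_fun Ap (chiP _ (SM Sx Sy))).
  by apply: AM; apply: chiP.
- by rewrite (partial_character_fun Ap (chiP _ Sz) Az) cz.
Qed.

End character_extension.

Lemma finite_index_reps (G : groupType) (S : set G) : is_subgroup S ->
  finite_set (left_cosets S) ->
  exists n (r : 'I_n -> G), (forall g, exists i, S ((r i)^-1 * g)%g) /\
    forall g i j, S ((r i)^-1 * g)%g -> S ((r j)^-1 * g)%g -> i = j.
Proof.
move=> [S1 SM SV] fin; pose e : seq (set G) := fset_set (left_cosets S).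
have eP A : A \in e <-> left_cosets S A.
  have E : (A \in e) = (A \in left_cosets S) by rewrite -in_fset_set.
  by rewrite E; split=> [/set_mem|/mem_set].
pose coset (g : G) : set G := [set (g * s)%g | s in S].
have cosetP g h : coset g = coset h <-> S (g^-1 * h)%g.
  split=> [E|Sgh].
    have : coset h h by exists 1%g => //; rewrite mulg1.
    by rewrite -E => -[s Ss <-]; rewrite mulKg.
  apply/seteqP; split=> _ [s Ss <-].
    exists (h^-1 * g * s)%g; last by rewrite -!mulgA mulVKg.
    by apply: SM => //; rewrite -[(h^-1 * g)%g]invgK invgM invgK; apply: SV.
  by exists (g^-1 * h * s)%g; [apply: SM | rewrite -!mulgA mulVKg].
pose r (i : 'I_(size e)) : G := xget 1%g [set g | coset g = nth set0 e i].
have rP i : coset (r i) = nth set0 e i.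
  have : left_cosets S (nth set0 e i) by apply/eP; rewrite mem_nth.
  by move=> [g _ gE]; rewrite /r; case: xgetP => [h _|/(_ g)].
exists (size e), r; split=> [g|g i j].
  have ge : coset g \in e by apply/eP; exists g.
  have ig : (index (coset g) e < size e)%N by rewrite index_mem.
  by exists (Ordinal ig); apply/cosetP; rewrite rP /= nth_index.
move=> /cosetP gi /cosetP gj; apply/val_inj/eqP.
by rewrite -(nth_uniq set0 (ltn_ord i) (ltn_ord j)) ?fset_uniq// -!rP gi gj.
Qed.

Section induced.
Context (C : numClosedFieldType) (G : groupType) (S : set G) (chi : G -> C).
Hypotheses (Ssub : is_subgroup S) (chi1 : forall x, S x -> `|chi x| = 1)
  (chiM : forall x y, S x -> S y -> chi (x * y)%g = chi x * chi y).
Context (n : nat) (r : 'I_n -> G).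
Hypotheses (rex : forall g, exists i, S ((r i)^-1 * g)%g)
  (runiq : forall g i j, S ((r i)^-1 * g)%g -> S ((r j)^-1 * g)%g -> i = j).

(** The representation induced from the character chi of S, as a monomial matrix in the basis of the
    coset representatives r i. *)
Definition induced (g : G) : 'M[C]_n :=
  \matrix_(i, j) if `[< S ((r i)^-1 * g * r j)%g >]
                 then chi ((r i)^-1 * g * r j)%g else 0.

Lemma character1 : chi 1%g = 1.
Proof.
have [S1 SM SV] := Ssub.
have := chiM S1 S1; rewrite mulg1 => /eqP.
rewrite -subr_eq0 -{1}[chi _]mulr1 -mulrBr mulf_eq0 -normr_eq0 chi1// oner_eq0/=.
by rewrite subr_eq0 eq_sym => /eqP.
Qed.

Lemma characterV x : S x -> chi x^-1%g = (chi x)^*.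
Proof.
have [S1 SM SV] := Ssub => Sx; have Sx' := SV _ Sx.
have x0 : chi x != 0 by rewrite -normr_eq0 chi1// oner_eq0.
apply: (mulfI x0); rewrite -chiM// mulgV character1 -normCK chi1//.
by rewrite expr1n.
Qed.

Lemma induced_rep : unitary_mxrep induced.
Proof.
have [S1 SM SV] := Ssub.
have i1 : induced 1%g = 1%:M.
  apply/matrixP => i j; rewrite !mxE mulg1.
  have [->|ij] := eqVneq i j; first by rewrite mulVg asboolT// character1.
  rewrite asboolF// => Sij; move/eqP: ij; apply; apply: runiq Sij _.
  by rewrite mulVg.
have iM g h : induced (g * h)%g = induced g *m induced h.
  apply/matrixP => i k; rewrite !mxE.
  (* The coset of g^-1 r i gives the only nonzero entry in row i of [induced g], so the matrix
     product reduces to one term. *)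
  have [j Sj] := rex (g^-1 * r i)%g.
  have Sj' : S ((r i)^-1 * g * r j)%g.
    by have := SV _ Sj; rewrite !invgM !invgK ?mulgA.
  rewrite (bigD1 j)//= big1 ?addr0.
    rewrite !mxE (asboolT Sj').
    have E : ((r i)^-1 * (g * h) * r k = ((r i)^-1 * g * r j) * ((r j)^-1 * h * r k))%g.
      by rewrite !mulgA mulgK.
    case: asboolP => [Sik|nSik]; case: asboolP => [Sjk|nSjk].
    - by rewrite E chiM.
    - case: nSjk; rewrite -[X in S X](mulKg ((r i)^-1 * g * r j)%g) -E.
      by apply: SM => //; apply: SV.
    - by case: nSik; rewrite E; apply: SM.
    - by rewrite mulr0.
  move=> l lj; rewrite !mxE asboolF ?mul0r// => Sl.
  move/eqP: lj; apply; apply: runiq Sj.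
  by have := SV _ Sl; rewrite !invgM !invgK ?mulgA.
have iV g : induced g^-1%g = (induced g)^t*.
  apply/matrixP => i j; rewrite !mxE.
  have E : ((r i)^-1 * g^-1 * r j = ((r j)^-1 * g * r i)^-1)%g.
    by rewrite !invgM !invgK ?mulgA.
  case: asboolP => [Sij|nSij]; case: asboolP => [Sji|nSji].
  - by rewrite E characterV.
  - by case: nSji; move: Sij; rewrite E => /SV; rewrite invgK.
  - by case: nSij; rewrite E; apply: SV.
  - by rewrite conjC0.
by split=> // g; apply/unitarymxP; rewrite -iV -iM mulgV i1.
Qed.

End induced.

(** Induce a character of S. The diagonal entry at the coset S itself is chi z if z is in S, where
    chi is chosen to separate z from 1, and 0 otherwise. *)
Lemma virtually_abelian_map (C : numClosedFieldType) (G : groupType) (z : G) :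
  virtually_abelian G -> z != 1%g ->
  exists n (rho : G -> 'M[C]_n), unitary_mxrep rho /\ exists i, rho z i i != 1.
Proof.
move=> [S [Ssub SC fin]] z1; have [S1 SM SV] := Ssub.
have [n [r [rex runiq]]] := finite_index_reps Ssub fin.
have [chi [chi1 chiM chiz]] : exists chi : G -> C, [/\ forall x, S x -> `|chi x| = 1,
    forall x y, S x -> S y -> chi (x * y)%g = chi x * chi y & S z -> chi z != 1].
  have [Sz|nSz] := pselect (S z).
    by have [chi [? ? ?]] := character_separates C Ssub SC Sz z1; exists chi.
  by exists (fun=> 1); split=> //; [rewrite normr1 | rewrite mulr1].
exists n, (induced S chi r); split; first exact: induced_rep.
have [i Si] := rex 1%g; exists i; rewrite mulg1 in Si.
have Sri : S (r i) by have := SV _ Si; rewrite invgK.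
rewrite mxE; case: asboolP => [Sz|_]; last by rewrite eq_sym oner_eq0.
have {}Sz : S z.
  have -> : (z = r i * ((r i)^-1 * z * r i) * (r i)^-1)%g.
    by rewrite -!mulgA mulVKg mulgA mulgK.
  by apply: (SM) => //; apply: (SM).
by rewrite (SC _ _ Si Sz) mulgVK; apply: chiz.
Qed.

(** * Representations with small trace *)

Section kronecker.
Context (C : numClosedFieldType).

Definition mxpair m n (i : 'I_(m * n)) : 'I_m * 'I_n :=
  enum_val (cast_ord (esym (mxvec_cast m n)) i).

Lemma mxpairK m n (i : 'I_m) (j : 'I_n) : mxpair (mxvec_index i j) = (i, j).
Proof. by rewrite /mxpair /mxvec_index cast_ordK enum_rankK. Qed.

Definition kron m n (A : 'M[C]_m) (B : 'M[C]_n) : 'M[C]_(m * n) :=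
  \matrix_(i, j) (A (mxpair i).1 (mxpair j).1 * B (mxpair i).2 (mxpair j).2).

Lemma kronE m n (A : 'M[C]_m) (B : 'M[C]_n) a b c d :
  kron A B (mxvec_index a b) (mxvec_index c d) = A a c * B b d.
Proof. by rewrite mxE !mxpairK. Qed.

Lemma sum_mxvec_index m n (F : 'I_(m * n) -> C) :
  \sum_i F i = \sum_(a < m) \sum_(b < n) F (mxvec_index a b).
Proof.
rewrite pair_bigA /= (reindex (uncurry (@mxvec_index m n))) /=; last first.
  exact: curry_mxvec_bij.
by apply: eq_bigr => -[].
Qed.

Lemma kronM m n (A A' : 'M[C]_m) (B B' : 'M[C]_n) :
  kron (A *m A') (B *m B') = kron A B *m kron A' B'.
Proof.
apply/matrixP => i j; case/mxvec_indexP: i => a b; case/mxvec_indexP: j => c d.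
rewrite kronE !mxE sum_mxvec_index mulr_suml; apply: eq_bigr => k _.
by rewrite mulr_sumr; apply: eq_bigr => l _; rewrite !kronE mulrACA.
Qed.

Lemma kron1 m n : kron 1%:M 1%:M = 1%:M :> 'M[C]_(m * n).
Proof.
apply/matrixP => i j; case/mxvec_indexP: i => a b; case/mxvec_indexP: j => c d.
rewrite kronE !mxE -natrM mulnb; congr (_%:R); congr (nat_of_bool _).
apply/andP/eqP => [[/eqP -> /eqP ->]//|/(congr1 (@mxpair m n))].
by rewrite !mxpairK => -[-> ->].
Qed.

Lemma kronC m n (A : 'M[C]_m) (B : 'M[C]_n) : kron (A^t*) (B^t*) = (kron A B)^t*.
Proof. by apply/matrixP => i j; rewrite !mxE rmorphM. Qed.

Lemma mxtrace_kron m n (A : 'M[C]_m) (B : 'M[C]_n) :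
  \tr (kron A B) = \tr A * \tr B.
Proof.
rewrite /mxtrace sum_mxvec_index mulr_suml; apply: eq_bigr => a _.
by rewrite mulr_sumr; apply: eq_bigr => b _; rewrite kronE.
Qed.

Context (G : groupType).

Lemma kron_rep m n (rho : G -> 'M[C]_m) (sigma : G -> 'M[C]_n) :
  unitary_mxrep rho -> unitary_mxrep sigma ->
  unitary_mxrep (fun g => kron (rho g) (sigma g)).
Proof.
move=> [r1 rM rU] [s1 sM sU]; split=> [|g h|g].
- by rewrite r1 s1 kron1.
- by rewrite rM sM kronM.
- by apply/unitarymxP; rewrite -kronC -kronM !unitarymxK// kron1.
Qed.

(* With a trivial summand, the trace of a nonidentity unitary is smaller than
   the dimension in modulus even if that unitary is a scalar. *)
Lemma add_trivial_rep n (rho : G -> 'M[C]_n) : unitary_mxrep rho ->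
  unitary_mxrep (fun g => block_mx (rho g) 0 0 (1%:M : 'M[C]_1)).
Proof.
move=> [r1 rM rU]; split=> [|g h|g].
- by rewrite r1 -scalar_mx_block.
- by rewrite rM mulmx_block !mulmx0 !mul0mx !addr0 add0r mulmx1.
- apply/unitarymxP; rewrite tr_block_mx map_block_mx mulmx_block.
  rewrite !trmx0 !map_mx0 !mulmx0 !mul0mx !addr0 add0r unitarymxK//.
  by rewrite trmx1 map_mx1 mulmx1 -scalar_mx_block.
Qed.

Lemma unitary_entry_le1 n (A : 'M[C]_n) i j : A \is unitarymx -> `|A i j| <= 1.
Proof.
move=> /unitarymxP/matrixP/(_ i i); rewrite !mxE eqxx mulr1n => Ai.
rewrite -(@expr_le1 _ 2)// -Ai (bigD1 j)//= !mxE normCK lerDl sumr_ge0// => k _.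
by rewrite !mxE mul_conjC_ge0.
Qed.

Lemma mxtrace_unitary_le n (A : 'M[C]_n) : A \is unitarymx -> `|\tr A| <= n%:R.
Proof.
move=> Au; rewrite /mxtrace (le_trans (ler_norm_sum _ _ _))//.
rewrite (le_trans (ler_sum _ (fun i _ => unitary_entry_le1 i i Au)))//.
by rewrite sumr_const card_ord.
Qed.

(** The equality case of the triangle inequality would force w to be 1. *)
Lemma norm1D_lt2 (w : C) : `|w| <= 1 -> w != 1 -> `|1 + w| < 2.
Proof.
move=> w1 wn; rewrite lt_neqAle; apply/andP; split; last first.
  by rewrite (le_trans (ler_normD _ _))// normr1 (_ : 2 = 1 + 1)// lerD2l.
apply: contra_neq wn => E.
have h : `|1 + w| = `|1| + `|w|.
  apply/eqP; rewrite eq_le ler_normD/= E normr1 (_ : 2 = 1 + 1)//.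
  by rewrite lerD2l.
have nw : `|w| = 1.
  by move: h; rewrite E normr1 => /eqP; rewrite (_ : 2 = 1 + 1)// (inj_eq (addrI _)) => /eqP.
have [t _ [t1 tw]] := normCDeq h.
by move: tw; rewrite nw mul1r => ->; rewrite t1 normr1 mul1r.
Qed.

Lemma mxtrace_add_trivial_lt n (A : 'M[C]_n) i : A \is unitarymx -> A i i != 1 ->
  `|\tr (block_mx A 0 0 (1%:M : 'M[C]_1))| < (n + 1)%:R.
Proof.
move=> Au Ai; rewrite mxtrace_block mxtrace1 /mxtrace (bigD1 i)//= [_ + 1]addrC addrA.
rewrite (le_lt_trans (ler_normD _ _))//.
have s : `|\sum_(j < n | j != i) A j j| <= (n - 1)%:R.
  rewrite (le_trans (ler_norm_sum _ _ _))//.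
  rewrite (le_trans (ler_sum _ (fun j _ => unitary_entry_le1 j j Au)))//.
  rewrite sumr_const (_ : #|_| = (n - 1)%N)//.
  by rewrite (eq_card (B := predC1 i))// cardC1 card_ord subn1.
have n0 : (0 < n)%N by case: n i {A Au Ai s} => // -[].
have -> : (n + 1)%:R = 2 + (n - 1)%:R :> C by rewrite -natrD; congr (_%:R); lia.
by rewrite ltr_leD// norm1D_lt2// unitary_entry_le1.
Qed.

End kronecker.

Lemma normr_normc (R : rcfType) (z : R[i]) : `|z| = (Normc.normc z)%:C%C.
Proof. by []. Qed.

Section trace.
Context (R : realType) (G : groupType).
Hypothesis hG : virtually_abelian G.

(** The normalized trace is multiplicative for Kronecker products. Its modulus q at z is below 1
    once a trivial summand has been added, so a power q^k is below eps. *)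
Lemma small_trace_one (z : G) (eps : R) : z != 1%g -> 0 < eps ->
  exists n (rho : G -> 'M[R[i]]_n), [/\ (0 < n)%N, unitary_mxrep rho &
    `|\tr (rho z)| <= (eps * n%:R)%:C%C].
Proof.
move=> z1 eps0; have [n0 [rho0 [rep0 [i zi]]]] := virtually_abelian_map R[i] hG z1.
pose n := (n0 + 1)%N; pose rho g := block_mx (rho0 g) 0 0 (1%:M : 'M[R[i]]_1).
have rep : unitary_mxrep rho := add_trivial_rep rep0.
have n_gt0 : (0 < n)%N by rewrite /n addn1.
have : `|\tr (rho z)| < n%:R by apply: mxtrace_add_trivial_lt zi; case: rep0.
rewrite normr_normc -(rmorph_nat (real_complex R)) ltcR => tlt.
pose q := Normc.normc (\tr (rho z)) / n%:R.
have nR0 : 0 < n%:R :> R by rewrite ltr0n.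
have q0 : 0 <= q.
  by rewrite divr_ge0 ?ler0n// -ler0c -normr_normc.
have q1 : q < 1 by rewrite ltr_pdivrMr// mul1r.
have [k qk] : exists k, q ^+ k <= eps.
  have : q ^+ k @[k --> \oo] --> (0 : R) by apply: cvg_expr; rewrite ger0_norm.
  move=> /cvgrPdist_le /(_ _ eps0) [N _ /(_ N) /=]; rewrite sub0r normrN.
  by move=> /(_ (leqnn _)) qN; exists N; apply: le_trans (ler_norm _) qN.
have [m [sigma [m0 srep sE]]] : exists m (sigma : G -> 'M[R[i]]_m),
    [/\ (0 < m)%N, unitary_mxrep sigma &
    `|\tr (sigma z)| = (q ^+ k * m%:R)%:C%C].
  elim: k {qk} => [|k [m [sigma [m0 srep sE]]]].
    exists 1%N, (fun=> 1%:M); split=> //; last by rewrite mxtrace1 normr1 mulr1.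
    by split=> [//|g h|g]; [rewrite mulmx1 | apply/unitarymxP; rewrite trmx1 map_mx1 mulmx1].
  exists (n * m)%N, (fun g => kron (rho g) (sigma g)); split.
  - by rewrite muln_gt0 n_gt0.
  - exact: kron_rep.
  rewrite mxtrace_kron normrM sE normr_normc -rmorphM/=; congr (_%:C%C).
  rewrite exprS natrM -[Normc.normc _](mulfVK (lt0r_neq0 nR0)) -/q.
  by ring.
by exists m, sigma; split=> //; rewrite sE lecR ler_wpM2r.
Qed.

(** Kronecker product of one representation for each element of F: at z one factor has small
    normalized trace, and the others contribute at most 1 in modulus. *)
Lemma small_trace (F : seq G) (eps : R) : 1%g \notin F -> 0 < eps ->
  exists n (rho : G -> 'M[R[i]]_n), [/\ (0 < n)%N, unitary_mxrep rho &
    forall z, z \in F -> `|\tr (rho z)| <= (eps * n%:R)%:C%C].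
Proof.
move=> + eps0; elim: F => [_|z F IH].
  exists 1%N, (fun=> 1%:M); split=> //.
  by split=> [//|g h|g]; [rewrite mulmx1 | apply/unitarymxP; rewrite trmx1 map_mx1 mulmx1].
rewrite inE negb_or => /andP[]; rewrite eq_sym => z1 /IH[n [rho [n0 rep rP]]].
have [m [sigma [m0 srep sP]]] := small_trace_one z1 eps0.
exists (m * n)%N, (fun g => kron (sigma g) (rho g)); split.
- by rewrite muln_gt0 m0.
- exact: kron_rep.
move=> w; rewrite mxtrace_kron normrM inE => /predU1P[->|/rP rw].
  rewrite natrM mulrA rmorphM/= ler_pM// rmorph_nat mxtrace_unitary_le//.
  by case: rep.
rewrite natrM mulrCA rmorphM/= ler_pM// rmorph_nat mxtrace_unitary_le//.
by case: srep.
Qed.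

End trace.

(** * Folner sequences *)

Section folner.
Context (G : groupType).

(** The multisets s L and L agree up to X and Y, and X is at most a J-th of L. Lists are read as
    multisets because the products from which L is built may coincide. *)
Definition almost_invariant (J : nat) (L : seq G) (s : G) : Prop :=
  exists X Y, perm_eq ([seq (s * x)%g | x <- L] ++ X) (L ++ Y) /\
    (J * size X <= size L)%N.

Lemma count_allpairs (I : Type) (a : pred G) (js : seq I) (f : I -> G -> G)
    (Z : I -> seq G) :
  count a [seq f j y | j <- js, y <- Z j] =
  (\sum_(j <- js) count a [seq f j y | y <- Z j])%N.
Proof.
elim: js => [|j js IH]; first by rewrite big_nil.
by rewrite /= count_cat IH big_cons.
Qed.

(** To treat one more element h, replace L by L, h L, ..., h^(J-1) L. Multiplication by h shifts
    these blocks, so only L is lost and h^J L gained, a J-th of the total; commutativity preserves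
    the almost invariance under the earlier elements in each block. *)
Lemma folner_abelian (S : set G) (J : nat) (H : seq G) : is_subgroup S ->
  (forall x y, S x -> S y -> x * y = y * x)%g -> (forall h, h \in H -> S h) ->
  (0 < J)%N ->
  exists L : seq G, [/\ (0 < size L)%N, forall x, x \in L -> S x &
    forall h, h \in H -> almost_invariant J L h].
Proof.
move=> [S1 SM SV] SC + J0; elim: H => [_|h H IH HS].
  by exists [:: 1%g]; split=> // x; rewrite inE => /eqP ->.
have Sh : S h by apply: HS; rewrite mem_head.
have ShX j : S (h ^+ j)%g by elim: j => [//|j Sj]; rewrite expgS; apply: (SM).
have [|L [L0 LS LH]] := IH; first by move=> k kH; apply: HS; rewrite inE kH orbT.
pose blocks js (Z : seq G) := [seq (h ^+ j * y)%g | j <- js, y <- Z].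
exists (blocks (iota 0 J) L); split.
- by rewrite size_allpairs size_iota muln_gt0 J0.
- by move=> x /allpairsP[[j y] [_ yL ->]]; apply: (SM) => //; apply: (LS).
move=> k; rewrite inE => /predU1P[->|kH].
  exists L, [seq (h ^+ J * y)%g | y <- L]; split; last by rewrite size_allpairs size_iota.
  apply/permP => a; rewrite !count_cat map_allpairs !count_allpairs.
  pose c j := count a [seq (h ^+ j * y)%g | y <- L].
  have c0 : count a L = c 0%N by rewrite /c (eq_map (g := id)) ?map_id// => y; exact: mul1g.
  rewrite (eq_bigr (fun j => c j.+1)) => [|j _]; last first.
    by congr count; apply: eq_map => y; rewrite mulgA -expgS.
  rewrite -/(c J) c0 (_ : iota 0 J = index_iota 0 J); last by rewrite /index_iota subn0.
  by rewrite addnC -big_nat_recl// big_nat_recr.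
have [X [Y [XY JX]]] := LH _ kH.
exists (blocks (iota 0 J) X), (blocks (iota 0 J) Y); split; last first.
  by rewrite !size_allpairs size_iota leq_mul2l JX orbT.
apply/permP => a; rewrite !count_cat map_allpairs !count_allpairs -!big_split.
apply: eq_bigr => j _ /=; rewrite -!count_cat -map_cat.
have := perm_map (fun y => h ^+ j * y)%g XY => /permP/(_ a) <-.
rewrite map_cat !count_cat -map_comp; congr (count _ _ + _)%N.
apply: eq_map => y /=; rewrite !mulgA; congr (_ * _)%g; apply: SC => //.
by apply: HS; rewrite inE kH orbT.
Qed.

(** Multiplication by s permutes the cosets of S: s r_i = r_(t s i) h with h in S. Hence the union
    of the r_i L is almost invariant under F as soon as L in S is so under the finitely many
    elements h that occur. *)
Lemma folner (F : seq G) (J : nat) : virtually_abelian G -> (0 < J)%N ->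
  exists L : seq G, (0 < size L)%N /\ forall s, s \in F -> almost_invariant J L s.
Proof.
move=> [S [Ssub SC fin]] J0; have [S1 SM SV] := Ssub.
have [n [r [rex runiq]]] := finite_index_reps Ssub fin.
have jP s i : exists j, S ((r j)^-1 * (s * r i))%g by apply: rex.
pose t s i := projT1 (cid (jP s i)).
have tP s i : S ((r (t s i))^-1 * (s * r i))%g by rewrite /t; case: cid.
have t_inj s : injective (t s).
  move=> i i' E; have := tP s i; rewrite E => /SV Si.
  have : S ((r i)^-1 * r i')%g.
    have := SM _ _ Si (tP s i').
    by rewrite !invgM invgK -!mulgA mulVKg mulKg.
  by move=> /(runiq (r i')); apply; rewrite mulVg.
pose h s i := ((r (t s i))^-1 * (s * r i))%g.
have [|L [L0 _ LP]] := @folner_abelian S J [seq h s i | s <- F, i <- enum 'I_n] Ssub SC _ J0.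
  by move=> _ /allpairsP[[s i] [_ _ ->]]; apply: tP.
have n0 : (0 < n)%N by have [i _] := rex 1%g; case: n i {r rex runiq jP t tP t_inj h LP} => // -[].
exists [seq (r i * y)%g | i <- enum 'I_n, y <- L]; split.
  by rewrite size_allpairs -cardE card_ord muln_gt0 n0.
move=> s sF.
have XYP i : exists XY : seq G * seq G,
    perm_eq ([seq (h s i * x)%g | x <- L] ++ XY.1) (L ++ XY.2) /\
    (J * size XY.1 <= size L)%N.
  have [|X [Y XY]] := LP (h s i); last by exists (X, Y).
  by apply: allpairs_f => //; rewrite mem_enum.
pose XY i := projT1 (cid (XYP i)).
have XYE i : perm_eq ([seq (h s i * x)%g | x <- L] ++ (XY i).1) (L ++ (XY i).2) /\
    (J * size (XY i).1 <= size L)%N by rewrite /XY; case: cid.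
exists [seq (r (t s i) * y)%g | i <- enum 'I_n, y <- (XY i).1],
  [seq (r (t s i) * y)%g | i <- enum 'I_n, y <- (XY i).2]; split; last first.
  rewrite size_allpairs_dep size_allpairs -cardE card_ord sumnE big_map big_enum/=.
  rewrite big_distrr/= -[X in (_ <= X * _)%N](card_ord n) -sum_nat_const.
  by apply: leq_sum => i _; have [] := XYE i.
apply/permP => a; rewrite !count_cat map_allpairs !count_allpairs !big_enum/=.
rewrite [X in (_ = X + _)%N](reindex_inj (t_inj s))/= -!big_split/=.
apply: eq_bigr => i _ /=; rewrite -!count_cat -map_cat.
have /permP/(_ a) <- := perm_map (fun y => r (t s i) * y)%g (XYE i).1.
rewrite map_cat !count_cat -map_comp; congr (count _ _ + _)%N.
by apply: eq_map => y /=; rewrite /h !mulgA mulgV mul1g.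
Qed.

End folner.

(** * Unconditional sums *)

Section normc.
Context (R : realType).
Implicit Types z w : R[i].

Lemma normc_ge0 z : 0 <= normc z.
Proof. by rewrite -ler0c -normr_normc. Qed.

Lemma normcM z w : normc (z * w) = normc z * normc w.
Proof. exact: Normc.normcM. Qed.

Lemma ler_normcD z w : normc (z + w) <= normc z + normc w.
Proof. by rewrite -lecR rmorphD/= -!normr_normc ler_normD. Qed.

Lemma normcN z : normc (- z) = normc z.
Proof. by apply: complexI; rewrite -!normr_normc normrN. Qed.

Lemma normc_conj z : normc (Num.conj z) = normc z.
Proof. by apply: complexI; rewrite -!normr_normc norm_conjC. Qed.

Lemma normc_sum (I : Type) (r : seq I) (P : pred I) (F : I -> R[i]) :
  normc (\sum_(i <- r | P i) F i) <= \sum_(i <- r | P i) normc (F i).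
Proof.
by rewrite -lecR rmorph_sum/= -normr_normc ler_norm_sum.
Qed.

Lemma normc_eq0 z : (normc z == 0) = (z == 0).
Proof. by rewrite -(inj_eq (@complexI R)) -normr_normc normr_eq0. Qed.

Lemma cvg_normcP (T : Type) (F : set_system T) (FF : Filter F) (f : T -> R[i]^o) (l : R[i]^o) :
  f @ F --> l <-> forall e : R, 0 < e -> \forall x \near F, normc (l - f x) <= e.
Proof.
split=> [/cvgrPdist_le fl e e0|fl].
  have /fl : 0 < e%:C%C by rewrite ltcR.
  by apply: filterS => x; rewrite normr_normc lecR.
apply/cvgrPdist_le => e e0.
have er : e = (complex.Re e)%:C%C by rewrite RRe_real// gtr0_real.
have : 0 < complex.Re e by rewrite -ltcR -er.
move=> /fl; apply: filterS => x; rewrite -lecR -er; exact.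
Qed.

(** Completeness of R[i] is read off from that of [hvec R 1]. *)
Lemma complex_cauchy_cvg (T : Type) (F : set_system T) (FF : ProperFilter F)
    (f : T -> R[i]^o) :
  (forall e : R, 0 < e -> exists2 A, F A & forall x y, A x -> A y -> normc (f x - f y) <= e) ->
  exists l : R[i]^o, f @ F --> l.
Proof.
move=> fc.
have [l lP] : exists l : hvec R 1, (fun x => const_mx (f x) : hvec R 1) @ F --> l.
  apply/cvg_ex; apply: hvec_complete; apply/cauchy_ballP => e e0.
  have er : e = (complex.Re e)%:C%C by rewrite RRe_real// gtr0_real.
  have r0 : 0 < complex.Re e by rewrite -ltcR -er.
  have r20 : 0 < complex.Re e / 2 by rewrite divr_gt0.
  have [A FA AP] := fc _ r20.
  rewrite !near_simpl; exists (A, A) => //= -[x y] [/= Ax Ay].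
  rewrite -ball_normE /= (le_lt_trans (hnorm_le_sum _))// big_ord1 !mxE.
  rewrite normr_normc er ltcR (le_lt_trans (AP _ _ Ax Ay))//.
  by rewrite gtr_pMr// invf_lt1// ltr1n.
exists (l 0 0); apply/cvg_normcP => e e0.
move/cvgrPdist_le : lP => /(_ e%:C%C); rewrite ltcR => /(_ e0).
apply: filterS => x; rewrite -lecR -normr_normc.
by apply: le_trans; have := normr_coord_le (l - const_mx (f x)) 0; rewrite !mxE.
Qed.

End normc.

Section cauchy_schwarz.
Context (R : realType).

Lemma cauchy_schwarz_step (a b p q : R) : 0 <= p -> 0 <= q ->
  a * b + p * q <= Num.sqrt (a ^+ 2 + p ^+ 2) * Num.sqrt (b ^+ 2 + q ^+ 2).
Proof.
move=> p0 q0; rewrite -sqrtrM ?addr_ge0 ?sqr_ge0//.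
rewrite (le_trans (ler_norm _))// -sqrtr_sqr ler_wsqrtr//.
have := sqr_ge0 (p * b - q * a); nra.
Qed.

Lemma cauchy_schwarz_sum (I : Type) (r : seq I) (a b : I -> R) :
  \sum_(i <- r) a i * b i <=
  Num.sqrt (\sum_(i <- r) a i ^+ 2) * Num.sqrt (\sum_(i <- r) b i ^+ 2).
Proof.
elim: r => [|i r IH]; first by rewrite !big_nil sqrtr0 mulr0.
rewrite !big_cons.
set A := \sum_(j <- r) a j ^+ 2 in IH *; set B := \sum_(j <- r) b j ^+ 2 in IH *.
have A0 : 0 <= A by apply: sumr_ge0 => j _; rewrite sqr_ge0.
have B0 : 0 <= B by apply: sumr_ge0 => j _; rewrite sqr_ge0.
rewrite -(sqr_sqrtr A0) -(sqr_sqrtr B0).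
by apply: le_trans (cauchy_schwarz_step _ _ _ _); rewrite ?sqrtr_ge0// lerD2l.
Qed.

End cauchy_schwarz.

Section unconditional_sum.
Context (R : realType) (I : choiceType).
Implicit Types h k : I -> R[i]^o.
Import summability.

Lemma totallyP (P : set {fset I}) :
  (\forall A \near (@totally I), P A) <-> exists A0, forall A, (A0 `<=` A)%fset -> P A.
Proof.
split=> [[A0 _ A0P]|[A0 A0P]]; first by exists A0 => A /A0P.
by exists A0 => // A /A0P.
Qed.

Definition abs_bounded (M : R) h := forall A : {fset I}, \sum_(x <- A) normc (h x) <= M.

Lemma partial_sumE (h : I -> R[i]^o) A : partial_sum h A = \sum_(x <- A) h x.
Proof. by rewrite /partial_sum big_seq_fsetE. Qed.

Lemma sum_subset_diff (V : zmodType) (h : I -> V) (A B : {fset I}) : (A `<=` B)%fset ->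
  \sum_(x <- B) h x = \sum_(x <- A) h x + \sum_(x <- (B `\` A)%fset) h x.
Proof.
move=> AB; rewrite (big_fsetID _ (mem A))/=; congr (_ + _).
  by apply: eq_fbigl => x; rewrite !inE andbC; case: (boolP (x \in A)) => //= /(fsubsetP AB).
by apply: eq_fbigl => x; rewrite !inE andbC.
Qed.

(** Absolute convergence: once the sum of moduli over A0 is within e/2 of its supremum, whatever
    lies outside A0 contributes at most e/2. *)
Lemma abs_bounded_cvg M h : abs_bounded M h ->
  exists l : R[i]^o, partial_sum h @ totally --> l.
Proof.
move=> hM.
pose E := [set \sum_(x <- A) normc (h x) | A in [set: {fset I}]].
have Es : has_sup E.
  split; first by exists (\sum_(x <- fset0) normc (h x)), fset0.
  by exists M => _ [A _ <-].
have tail e : 0 < e -> exists A0 : {fset I}, forall A B, (A0 `<=` A)%fset -> (A0 `<=` B)%fset ->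
    normc (\sum_(x <- A) h x - \sum_(x <- B) h x) <= e.
  move=> e0; have e20 : 0 < e / 2 by rewrite divr_gt0.
  have [_ [A0 _ <-] A0e] := sup_adherent e20 Es.
  exists A0 => A B AA AB.
  have D A' : (A0 `<=` A')%fset -> normc (\sum_(x <- (A' `\` A0)%fset) h x) <= e / 2.
    move=> AA'; rewrite (le_trans (normc_sum _ _ _))//.
    have : \sum_(x <- A') normc (h x) <= sup E by apply: sup_upper_bound => //; exists A'.
    rewrite (sum_subset_diff _ AA'); lra.
  rewrite (sum_subset_diff _ AA) (sum_subset_diff _ AB) opprD addrACA subrr add0r.
  rewrite (le_trans (ler_normcD _ _))// normcN.
  by have := D _ AA; have := D _ AB; lra.
have FF : ProperFilter (@totally I) by exact: totally_filter.
apply: complex_cauchy_cvg => e e0; have [A0 A0P] := tail _ e0.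
exists [set A | (A0 `<=` A)%fset] => [|A B AA AB]; first by exists A0.
by rewrite !partial_sumE A0P.
Qed.

Lemma sum_cvg M h : abs_bounded M h ->
  partial_sum h @ totally --> (summability.sum h : R[i]^o).
Proof.
move=> /abs_bounded_cvg[l hl]; have FF : ProperFilter (@totally I) by exact: totally_filter.
by rewrite /summability.sum (cvg_lim _ hl)//; exact: norm_hausdorff.
Qed.

Lemma sum_unique h l : partial_sum h @ totally --> (l : R[i]^o) -> summability.sum h = l.
Proof.
move=> hl; have FF : ProperFilter (@totally I) by exact: totally_filter.
by apply: cvg_lim => //; exact: norm_hausdorff.
Qed.

Lemma sum_approx M h e : abs_bounded M h -> 0 < e ->
  exists A0 : {fset I}, forall A, (A0 `<=` A)%fset ->
    normc (summability.sum h - \sum_(x <- A) h x) <= e.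
Proof.
move=> /sum_cvg hM e0; have FF : ProperFilter (@totally I) by exact: totally_filter.
move/cvg_normcP : hM => /(_ _ e0)/totallyP[A0 A0P].
by exists A0 => A /A0P; rewrite partial_sumE.
Qed.

Lemma normc_sum_le M h : abs_bounded M h -> normc (summability.sum h) <= M.
Proof.
move=> hM; apply/ler_addgt0Pr => e e0.
have [A0 /(_ _ (fsubset_refl A0)) A0P] := sum_approx hM e0.
rewrite -[X in normc X](subrK (\sum_(x <- A0) h x)) (le_trans (ler_normcD _ _))//.
by rewrite addrC lerD// (le_trans (normc_sum _ _ _))// hM.
Qed.

Lemma sum_linear M N h k (a : R[i]) : abs_bounded M h -> abs_bounded N k ->
  summability.sum (fun x => a * h x + k x : R[i]^o) =
  a * summability.sum h + summability.sum k :> R[i]^o.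
Proof.
move=> hM kN; have FF : ProperFilter (@totally I) by exact: totally_filter.
apply: sum_unique; apply/cvg_normcP => e e0.
(* Adding 1 keeps the denominator positive when a = 0; the same device recurs below. *)
pose d := e / (normc a + 1) / 2.
have a1 : 0 < normc a + 1 by rewrite ltr_wpDl// normc_ge0.
have d0 : 0 < d by rewrite !divr_gt0.
have [A0 A0P] := sum_approx hM d0; have [B0 B0P] := sum_approx kN d0.
apply/totallyP; exists (A0 `|` B0)%fset => A; rewrite fsubUset => /andP[/A0P hA /B0P hB].
rewrite partial_sumE big_split/= -mulr_sumr opprD addrACA -mulrBr.
rewrite (le_trans (ler_normcD _ _))// normcM.
have -> : e = normc a * d + d + (normc a + 1) * d.
  by rewrite /d; field; rewrite gt_eqF.
have := normc_ge0 a; nra.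
Qed.

Lemma sum_finite_support h (A : {fset I}) : (forall x, x \notin A -> h x = 0) ->
  summability.sum h = \sum_(x <- A) h x.
Proof.
move=> hA; have FF : ProperFilter (@totally I) by exact: totally_filter.
apply: sum_unique; apply/cvg_normcP => e e0; apply/totallyP; exists A => B AB.
rewrite partial_sumE (sum_subset_diff _ AB) [X in _ - (_ + X)]big1_seq.
  by rewrite addr0 subrr Normc.normc0 ltW.
by move=> x /andP[_]; rewrite inE => /andP[/hA].
Qed.

End unconditional_sum.

(** * Projective tensor products *)

(** What the calculus of projective norms uses of each factor; it is verified below for [ell2] and
    for [fourier]. *)
Definition seminormed (R : realType) (E : lmodType R[i]) (X : normed_space E) : Prop :=
  [/\ carrier X 0, forall (a : R[i]) x y, carrier X x -> carrier X y -> carrier X (a *: x + y),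
      forall x, 0 <= normof X x
    & forall (a : R[i]) x, carrier X x -> normof X (a *: x) <= normc a * normof X x].

Section seminormed.
Context (R : realType) (E : lmodType R[i]) (X : normed_space E).
Hypothesis Xs : seminormed X.

Lemma carrierZ (a : R[i]) x : carrier X x -> carrier X (a *: x).
Proof. by case: Xs => X0 XL _ _ Xx; rewrite -[_ *: _]addr0; apply: XL. Qed.

Lemma carrierD x y : carrier X x -> carrier X y -> carrier X (x + y).
Proof. by case: Xs => X0 XL _ _ Xx Xy; rewrite -[x]scale1r; apply: XL. Qed.

Lemma carrierN x : carrier X x -> carrier X (- x).
Proof. by move=> Xx; rewrite -scaleN1r; apply: carrierZ. Qed.

Lemma carrierB x y : carrier X x -> carrier X y -> carrier X (x - y).
Proof. by move=> Xx Xy; apply: carrierD => //; apply: carrierN. Qed.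

Lemma carrier_sum (I : Type) (r : seq I) (P : pred I) (f : I -> E) :
  (forall i, P i -> carrier X (f i)) -> carrier X (\sum_(i <- r | P i) f i).
Proof.
move=> Xf; elim/big_ind : _ => //; first by case: Xs.
exact: carrierD.
Qed.

Lemma normof_ge0 x : 0 <= normof X x. Proof. by case: Xs. Qed.

Lemma normofN_le x : carrier X x -> normof X (- x) <= normof X x.
Proof.
case: Xs => _ _ _ XZ Xx; rewrite -scaleN1r (le_trans (XZ _ _ Xx))//.
by rewrite normcN Normc.normc1 mul1r.
Qed.

End seminormed.

Section projective.
Context (R : realType) (E F : lmodType R[i]).
Context (X : normed_space E) (Y : normed_space F).
Hypotheses (Xs : seminormed X) (Ys : seminormed Y).
Implicit Types t u v : seq (E * F).

Local Notation cost t := (\sum_(p <- t) normof X p.1 * normof Y p.2).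
Local Notation pnorm := (proj_norm X Y).
Local Notation ft := (finite_tensor X Y).
Local Notation teq := (tensor_eq X Y).

Lemma cost_ge0 t : 0 <= cost t.
Proof. by apply: sumr_ge0 => p _; rewrite mulr_ge0// normof_ge0. Qed.

Lemma tensor_eq_sym t u : teq t u -> teq u t.
Proof. by move=> tu V b bb; rewrite tu. Qed.

Lemma tensor_eq_trans t u v : teq t u -> teq u v -> teq t v.
Proof. by move=> tu uv V b bb; rewrite tu// uv. Qed.

Lemma tensor_eq_cat t t' u u' : teq t t' -> teq u u' -> teq (t ++ u) (t' ++ u').
Proof. by move=> tt' uu' V b bb; rewrite !big_cat/= tt'// uu'. Qed.

Lemma finite_tensor_cat t u : ft t -> ft u -> ft (t ++ u).
Proof. by move=> tt tu p; rewrite mem_cat => /orP[/tt|/tu]. Qed.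

Lemma finite_tensor_cons p t : carrier X p.1 -> carrier Y p.2 -> ft t -> ft (p :: t).
Proof. by move=> Xp Yp tt q; rewrite inE => /predU1P[->//|/tt]. Qed.

Definition tensor_scale (a : R[i]) t := [seq (a *: p.1, p.2) | p <- t].

Lemma tensor_scaleN1 u : [seq (- p.1, p.2) | p <- u] = tensor_scale (-1) u.
Proof. by apply: eq_map => p; rewrite scaleN1r. Qed.

Lemma finite_tensor_scale a t : ft t -> ft (tensor_scale a t).
Proof. by move=> tt _ /mapP[p /tt[p1 p2] ->] /=; split=> //; apply: carrierZ. Qed.

Lemma finite_tensor_sub t u : ft t -> ft u -> ft (tensor_sub t u).
Proof.
move=> tt tu; rewrite /tensor_sub tensor_scaleN1.
by apply: finite_tensor_cat => //; apply: finite_tensor_scale.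
Qed.

Section bilinear.
Context (V : lmodType R[i]) (b : E -> F -> V).
Hypothesis bb : bilinear_on X Y b.

Lemma bilinear_on0l y : carrier Y y -> b 0 y = 0.
Proof.
case: bb => bl _ Yy; have X0 : carrier X 0 by case: Xs.
have := bl 1 0 0 y X0 X0 Yy; rewrite !scale1r addr0 => /eqP.
by rewrite -subr_eq0 opprD addrA subrr sub0r oppr_eq0 => /eqP.
Qed.

Lemma bilinear_on0r x : carrier X x -> b x 0 = 0.
Proof.
case: bb => _ br Xx; have Y0 : carrier Y 0 by case: Ys.
have := br 1 x 0 0 Xx Y0 Y0; rewrite !scale1r addr0 => /eqP.
by rewrite -subr_eq0 opprD addrA subrr sub0r oppr_eq0 => /eqP.
Qed.

Lemma bilinear_onZl a x y : carrier X x -> carrier Y y -> b (a *: x) y = a *: b x y.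
Proof.
move=> Xx Yy; have X0 : carrier X 0 by case: Xs.
by rewrite -[a *: x]addr0 bb.1// bilinear_on0l// addr0.
Qed.

Lemma bilinear_onZr a x y : carrier X x -> carrier Y y -> b x (a *: y) = a *: b x y.
Proof.
move=> Xx Yy; have Y0 : carrier Y 0 by case: Ys.
by rewrite -[a *: y]addr0 bb.2// bilinear_on0r// addr0.
Qed.

Lemma bilinear_onDl x x' y : carrier X x -> carrier X x' -> carrier Y y ->
  b (x + x') y = b x y + b x' y.
Proof. by move=> Xx Xx' Yy; rewrite -[x]scale1r bb.1// !scale1r. Qed.

Lemma bilinear_onDr x y y' : carrier X x -> carrier Y y -> carrier Y y' ->
  b x (y + y') = b x y + b x y'.
Proof. by move=> Xx Yy Yy'; rewrite -[y]scale1r bb.2// !scale1r. Qed.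

Lemma bilinear_on_suml (I : Type) (r : seq I) (f : I -> E) y :
  (forall i, carrier X (f i)) -> carrier Y y ->
  b (\sum_(i <- r) f i) y = \sum_(i <- r) b (f i) y.
Proof.
move=> Xf Yy; elim: r => [|i r IH]; first by rewrite !big_nil bilinear_on0l.
by rewrite !big_cons bilinear_onDl// ?IH//; apply: carrier_sum.
Qed.

Lemma bilinear_on_sumr (I : Type) (r : seq I) (f : I -> F) x :
  (forall i, carrier Y (f i)) -> carrier X x ->
  b x (\sum_(i <- r) f i) = \sum_(i <- r) b x (f i).
Proof.
move=> Yf Xx; elim: r => [|i r IH]; first by rewrite !big_nil bilinear_on0r.
by rewrite !big_cons bilinear_onDr// ?IH//; apply: carrier_sum.
Qed.

Lemma sum_tensor_scale a t : ft t ->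
  \sum_(p <- tensor_scale a t) b p.1 p.2 = a *: \sum_(p <- t) b p.1 p.2.
Proof.
move=> tt; rewrite big_map scaler_sumr; apply: eq_big_seq => p /tt[Xp Yp] /=.
exact: bilinear_onZl.
Qed.

Lemma sum_tensor_sub t u : ft u ->
  \sum_(p <- tensor_sub t u) b p.1 p.2 =
  \sum_(p <- t) b p.1 p.2 - \sum_(p <- u) b p.1 p.2.
Proof.
by move=> tu; rewrite /tensor_sub big_cat/= tensor_scaleN1 sum_tensor_scale// scaleN1r.
Qed.

End bilinear.

Let costs t := [set cost u | u in [set u | ft u /\ teq t u]].

Let has_lbound_costs t : has_lbound (costs t).
Proof. by exists 0 => _ [u _ <-]; apply: cost_ge0. Qed.

Lemma proj_norm_le t u : ft u -> teq t u -> pnorm t <= cost u.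
Proof. by move=> tu e; apply: (ge_inf (has_lbound_costs t)); exists u. Qed.

Lemma proj_norm_le_cost t : ft t -> pnorm t <= cost t.
Proof. by move=> tt; apply: proj_norm_le. Qed.

Lemma proj_norm_ge0 t : 0 <= pnorm t.
Proof.
(* Without any finite representation of t the infimum is over the empty set and has the default
   value 0. *)
rewrite /proj_norm -/(costs t); have [->|/set0P c0] := eqVneq (costs t) set0.
  by rewrite inf0.
by apply: lb_le_inf => // _ [u _ <-]; apply: cost_ge0.
Qed.

Lemma proj_norm_attain t e : ft t -> 0 < e ->
  exists u, [/\ ft u, teq t u & cost u < pnorm t + e].
Proof.
move=> tt e0; have ci : has_inf (costs t) by split=> //; exists (cost t), t.
have [_ [u [tu e' <-]] ue] := inf_adherent e0 ci.
by exists u.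
Qed.

Lemma le_proj_norm t u : ft t -> ft u -> (forall v, ft v -> teq t v -> pnorm u <= cost v) ->
  pnorm u <= pnorm t.
Proof.
move=> tt tu H; apply/ler_addgt0Pr => e e0.
have [v [vt tv /ltW]] := proj_norm_attain tt e0.
by apply: le_trans; apply: H.
Qed.

Lemma proj_norm_eq t u : ft t -> ft u -> teq t u -> pnorm t = pnorm u.
Proof.
move=> tt tu e; apply/eqP; rewrite eq_le; apply/andP; split; apply: le_proj_norm => //.
  by move=> v tv uv; apply: proj_norm_le => //; apply: tensor_eq_trans uv.
by move=> v tv uv; apply: proj_norm_le => //; apply: tensor_eq_trans uv; apply: tensor_eq_sym.
Qed.

Lemma proj_norm_cat t u : ft t -> ft u -> pnorm (t ++ u) <= pnorm t + pnorm u.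
Proof.
move=> tt tu; apply/ler_addgt0Pr => e e0.
have e20 : 0 < e / 2 by rewrite divr_gt0.
have [t' [tt' te' ct']] := proj_norm_attain tt e20.
have [u' [tu' ue' cu']] := proj_norm_attain tu e20.
have := proj_norm_le (finite_tensor_cat tt' tu') (tensor_eq_cat te' ue').
rewrite big_cat/=; lra.
Qed.

Lemma cost_scale a t : ft t -> cost (tensor_scale a t) <= normc a * cost t.
Proof.
move=> tt; rewrite big_map mulr_sumr big_seq [leRHS]big_seq; apply: ler_sum => p /tt[Xp _] /=.
by rewrite mulrA ler_wpM2r ?normof_ge0//; case: Xs => _ _ _; apply.
Qed.

Lemma tensor_eq_scale a t u : ft t -> ft u -> teq t u ->
  teq (tensor_scale a t) (tensor_scale a u).
Proof. by move=> tt tu e V b bb; rewrite !sum_tensor_scale// e. Qed.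

Lemma proj_norm_scale a t : ft t -> pnorm (tensor_scale a t) <= normc a * pnorm t.
Proof.
move=> tt; apply/ler_addgt0Pr => e e0.
have a1 : 0 < normc a + 1 by rewrite ltr_wpDl// normc_ge0.
have e20 : 0 < e / (normc a + 1) by rewrite divr_gt0.
have [u [tu te cu]] := proj_norm_attain tt e20.
have := proj_norm_le (@finite_tensor_scale a _ tu) (@tensor_eq_scale a _ _ tt tu te).
move=> /le_trans; apply; rewrite (le_trans (cost_scale _ tu))//.
have eE : e = e / (normc a + 1) * (normc a + 1) by rewrite divfK// gt_eqF.
have := normc_ge0 a; nra.
Qed.

Lemma proj_norm_sub_triangle t u v : ft t -> ft u -> ft v ->
  pnorm (tensor_sub t v) <= pnorm (tensor_sub t u) + pnorm (tensor_sub u v).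
Proof.
move=> tt tu tv.
have := proj_norm_cat (finite_tensor_sub tt tu) (finite_tensor_sub tu tv).
rewrite (@proj_norm_eq _ (tensor_sub t v))//.
- by apply: finite_tensor_cat; apply: finite_tensor_sub.
- exact: finite_tensor_sub.
- by move=> V b bb; rewrite big_cat/= !sum_tensor_sub// addrA subrK.
Qed.

Lemma proj_norm_subC t u : ft t -> ft u ->
  pnorm (tensor_sub t u) <= pnorm (tensor_sub u t).
Proof.
move=> tt tu; have := proj_norm_scale (-1) (finite_tensor_sub tu tt).
rewrite normcN Normc.normc1 mul1r.
rewrite (@proj_norm_eq _ (tensor_sub t u))//.
- by apply/finite_tensor_scale/finite_tensor_sub.
- exact: finite_tensor_sub.
- move=> V b bb; rewrite sum_tensor_scale ?sum_tensor_sub//; last exact: finite_tensor_sub.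
  by rewrite scaleN1r opprB.
Qed.

Lemma proj_norm_le_sub t u : ft t -> ft u -> pnorm t <= pnorm u + pnorm (tensor_sub t u).
Proof.
move=> tt tu; have := proj_norm_cat tu (finite_tensor_sub tt tu).
rewrite (@proj_norm_eq (_ ++ _) t)//.
- by apply: finite_tensor_cat => //; apply: finite_tensor_sub.
- by move=> V b bb; rewrite big_cat/= sum_tensor_sub// addrC subrK.
Qed.

Implicit Types T U : nat -> seq (E * F).

(** By the reverse triangle inequality the norms along a Cauchy sequence are Cauchy in R, so the
    [lim] in [ptensor_norm] is a genuine limit. *)
Lemma ptensor_norm_cvg T : ptensor X Y T ->
  pnorm (T n) @[n --> \oo] --> ptensor_norm X Y T.
Proof.
move=> [Tft Tc]; rewrite /ptensor_norm.
have FP : ProperFilter ((fun n => pnorm (T n)) @ \oo) by exact: fmap_proper_filter.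
have := R_complete FP; apply; apply/cauchy_ballP => e e0.
have [N NP] := Tc _ e0.
rewrite !near_simpl; exists ([set n | (N <= n)%N], [set n | (N <= n)%N]) => /=.
  by split; exists N.
move=> [m n] [/= Nm Nn]; rewrite -ball_normE /= ltr_norml.
have h1 := proj_norm_le_sub (Tft m) (Tft n).
have h2 := proj_norm_le_sub (Tft n) (Tft m).
by have := NP _ _ Nm Nn; have := NP _ _ Nn Nm; lra.
Qed.

Lemma ptensor_norm_ge0 T : ptensor X Y T -> 0 <= ptensor_norm X Y T.
Proof.
move=> /ptensor_norm_cvg Tc; apply: limr_ge; first exact: cvgP Tc.
by near=> n; apply: proj_norm_ge0.
Unshelve. all: by end_near. Qed.

Lemma ptensor_norm_eventually_le T M : ptensor X Y T ->
  (exists N, forall n, (N <= n)%N -> pnorm (T n) <= M) -> ptensor_norm X Y T <= M.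
Proof.
move=> /ptensor_norm_cvg Tc [N NP]; apply: limr_le; first exact: cvgP Tc.
by exists N.
Qed.

Lemma ptensor_norm_approx T e : ptensor X Y T -> 0 < e ->
  exists N, forall n, (N <= n)%N -> pnorm (T n) <= ptensor_norm X Y T + e.
Proof.
move=> /ptensor_norm_cvg/cvgrPdist_le Tc e0; have [N _ NP] := Tc _ e0.
by exists N => n /NP /=; rewrite ler_norml; lra.
Qed.

Lemma ptensor_const t : ft t -> ptensor X Y (fun=> t).
Proof.
move=> tt; split=> // e e0; exists 0%N => _ _ _ _.
have nilt : ft [::] by [].
have te : teq (tensor_sub t t) [::] by move=> V b bb; rewrite sum_tensor_sub// subrr big_nil.
rewrite (proj_norm_eq _ nilt te); last exact: finite_tensor_sub.
by apply: le_lt_trans e0; have := proj_norm_le_cost nilt; rewrite big_nil.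
Qed.

Lemma ptensor_norm_const t : ptensor_norm X Y (fun=> t) = pnorm t.
Proof. exact: (cvg_lim (@Rhausdorff R) (cvg_cst (pnorm t))). Qed.

Lemma ptensor_cat T U : ptensor X Y T -> ptensor X Y U -> ptensor X Y (fun n => T n ++ U n).
Proof.
move=> [Tft Tc] [Uft Uc]; split=> [n|e e0]; first exact: finite_tensor_cat.
have e20 : 0 < e / 2 by rewrite divr_gt0.
have [N NP] := Tc _ e20; have [M MP] := Uc _ e20.
exists (maxn N M) => m n; rewrite !geq_max => /andP[Nm Mm] /andP[Nn Mn].
have := proj_norm_cat (finite_tensor_sub (Tft m) (Tft n)) (finite_tensor_sub (Uft m) (Uft n)).
rewrite (@proj_norm_eq (_ ++ _) (tensor_sub (T m ++ U m) (T n ++ U n))).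
- by have := NP _ _ Nm Nn; have := MP _ _ Mm Mn; lra.
- by apply: finite_tensor_cat; apply: finite_tensor_sub.
- by apply: finite_tensor_sub; apply: finite_tensor_cat.
- move=> V b bb; rewrite big_cat/= !sum_tensor_sub//; last exact: finite_tensor_cat.
  by rewrite !big_cat/= opprD addrACA.
Qed.

Lemma ptensor_scale a T : ptensor X Y T -> ptensor X Y (fun n => tensor_scale a (T n)).
Proof.
move=> [Tft Tc]; split=> [n|e e0]; first exact: finite_tensor_scale.
have a1 : 0 < normc a + 1 by rewrite ltr_wpDl// normc_ge0.
have e20 : 0 < e / (normc a + 1) by rewrite divr_gt0.
have [N NP] := Tc _ e20.
exists N => m n Nm Nn.
have := proj_norm_scale a (finite_tensor_sub (Tft m) (Tft n)).
rewrite (@proj_norm_eq (tensor_scale _ _) (tensor_sub (tensor_scale a (T m)) (tensor_scale a (T n)))).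
- move=> /le_lt_trans; apply; have := NP _ _ Nm Nn.
  have eE : e = e / (normc a + 1) * (normc a + 1) by rewrite divfK// gt_eqF.
  by have := normc_ge0 a; nra.
- by apply: finite_tensor_scale; apply: finite_tensor_sub.
- by apply: finite_tensor_sub; apply: finite_tensor_scale.
- move=> V b bb; rewrite sum_tensor_scale ?sum_tensor_sub//.
  + by rewrite !sum_tensor_scale// scalerBr.
  + exact: finite_tensor_scale.
  + exact: finite_tensor_sub.
Qed.

Lemma ptensor_norm_cat T U : ptensor X Y T -> ptensor X Y U ->
  ptensor_norm X Y (fun n => T n ++ U n) <= ptensor_norm X Y T + ptensor_norm X Y U.
Proof.
move=> Tp Up; apply/ler_addgt0Pr => e e0.
have e20 : 0 < e / 2 by rewrite divr_gt0.
apply: ptensor_norm_eventually_le; first exact: ptensor_cat.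
have [N NP] := ptensor_norm_approx Tp e20; have [M MP] := ptensor_norm_approx Up e20.
exists (maxn N M) => n; rewrite !geq_max => /andP[/NP Nn /MP Mn].
have := proj_norm_cat (Tp.1 n) (Up.1 n); lra.
Qed.

Lemma ptensor_norm_scale a T : ptensor X Y T ->
  ptensor_norm X Y (fun n => tensor_scale a (T n)) <= normc a * ptensor_norm X Y T.
Proof.
move=> Tp; apply/ler_addgt0Pr => e e0.
have a1 : 0 < normc a + 1 by rewrite ltr_wpDl// normc_ge0.
have e20 : 0 < e / (normc a + 1) by rewrite divr_gt0.
apply: ptensor_norm_eventually_le; first exact: ptensor_scale.
have [N NP] := ptensor_norm_approx Tp e20; exists N => n /NP Nn.
have := proj_norm_scale a (Tp.1 n).
have eE : e = e / (normc a + 1) * (normc a + 1) by rewrite divfK// gt_eqF.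
have := normc_ge0 a; nra.
Qed.

End projective.

Section tensor_map.
Context (R : realType) (E F : lmodType R[i]).
Context (X : normed_space E) (Y : normed_space F).
Hypotheses (Xs : seminormed X) (Ys : seminormed Y).
Context (I : eqType) (Z : seq I) (S : I -> E -> E) (T : I -> F -> F).
Hypotheses (SL : forall z (a : R[i]) x y, S z (a *: x + y) = a *: S z x + S z y)
  (TL : forall z (a : R[i]) x y, T z (a *: x + y) = a *: T z x + T z y)
  (SX : forall z x, carrier X x -> carrier X (S z x))
  (TY : forall z x, carrier Y x -> carrier Y (T z x)).
Hypothesis ST : forall x y, carrier X x -> carrier Y y ->
  \sum_(z <- Z) normof X (S z x) * normof Y (T z y) <= normof X x * normof Y y.

(** The operator summing S z (x) T z over z in Z; a bound on elementary tensors, as in [ST], makes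
    it a contraction for the projective norm. *)
Definition tensor_map (t : seq (E * F)) : seq (E * F) :=
  [seq (S z p.1, T z p.2) | p <- t, z <- Z].

Lemma big_tensor_map (V : nmodType) (b : E -> F -> V) t :
  \sum_(p <- tensor_map t) b p.1 p.2 =
  \sum_(p <- t) \sum_(z <- Z) b (S z p.1) (T z p.2).
Proof. by rewrite big_allpairs_dep. Qed.

Lemma finite_tensor_map t : finite_tensor X Y t -> finite_tensor X Y (tensor_map t).
Proof.
by move=> tt _ /allpairsP[[p z] /= [/tt[p1 p2] _ ->]] /=; split; [apply: SX|apply: TY].
Qed.

Lemma tensor_eq_map t u : tensor_eq X Y t u -> tensor_eq X Y (tensor_map t) (tensor_map u).
Proof.
move=> tu V b bb; rewrite !big_tensor_map.
apply: (tu _ (fun x y => \sum_(z <- Z) b (S z x) (T z y))); split.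
- move=> a x x' y Xx Xx' Yy; rewrite scaler_sumr -big_split; apply: eq_bigr => z _.
  by rewrite SL bb.1//; [apply: SX|apply: SX|apply: TY].
- move=> a x y y' Xx Yy Yy'; rewrite scaler_sumr -big_split; apply: eq_bigr => z _.
  by rewrite TL bb.2//; [apply: SX|apply: TY|apply: TY].
Qed.

Lemma proj_norm_map t : finite_tensor X Y t ->
  proj_norm X Y (tensor_map t) <= proj_norm X Y t.
Proof.
move=> tt; apply: le_proj_norm => //; first exact: finite_tensor_map.
move=> v vt tv.
rewrite (le_trans (proj_norm_le Xs Ys (finite_tensor_map vt) (tensor_eq_map tv)))//.
rewrite (big_tensor_map (fun x y => normof X x * normof Y y)).
rewrite big_seq [leRHS]big_seq; apply: ler_sum => p /vt[]; exact: ST.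
Qed.

End tensor_map.

(** * Square-summable functions *)

Section ell2.
Context (R : realType) (G : groupType).
Implicit Types (f g : G -> R[i]^o) (A B : {fset G}).
Local Notation L2 := (ell2 R G).
Local Notation E2 f := (\esum_(x in setT) (normc (f x) ^+ 2)%:E)%E.

Lemma ell2_sqr f : carrier L2 f -> (normof L2 f ^+ 2)%:E = E2 f.
Proof.
move=> Lf; have E0 : (0 <= E2 f)%E by apply: esum_ge0 => x _; rewrite lee_fin sqr_ge0.
by rewrite /= sqr_sqrtr ?fine_ge0// fineK// ge0_fin_numE.
Qed.

Lemma ell2_ge0 f : 0 <= normof L2 f. Proof. exact: sqrtr_ge0. Qed.

Lemma ell2_bounded f M : (forall A, \sum_(x <- A) normc (f x) ^+ 2 <= M) ->
  carrier L2 f /\ normof L2 f ^+ 2 <= M.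
Proof.
move=> fM; have EM : (E2 f <= M%:E)%E.
  apply: ge_ereal_sup => _ [A [finA _] <-].
  by rewrite fsbig_finite//= sumEFin lee_fin.
have Lf : carrier L2 f by apply: le_lt_trans EM _; rewrite ltry.
by split=> //; rewrite -lee_fin ell2_sqr.
Qed.

Lemma ell2_bounded_norm f M : 0 <= M -> (forall A, \sum_(x <- A) normc (f x) ^+ 2 <= M ^+ 2) ->
  carrier L2 f /\ normof L2 f <= M.
Proof.
move=> M0 /ell2_bounded[Lf fM]; split=> //.
by rewrite -ler_sqr ?nnegrE// ?ell2_ge0.
Qed.

Lemma ell2_le f A : carrier L2 f -> \sum_(x <- A) normc (f x) ^+ 2 <= normof L2 f ^+ 2.
Proof.
move=> Lf; rewrite -lee_fin ell2_sqr// -sumEFin.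
apply: esum_ge; exists [set` A]; first by split=> //; exact: finite_fset.
by rewrite fsbig_finite ?finite_fset//= set_fsetK.
Qed.

Lemma ell2_seminormed : seminormed L2.
Proof.
split.
- have [] := @ell2_bounded_norm 0 0 => // A.
  by rewrite big1 ?expr0n// => x _; rewrite Normc.normc0 expr0n.
- move=> a f g Lf Lg.
  have [] := @ell2_bounded (a *: f + g) (2 * (normc a ^+ 2 * normof L2 f ^+ 2) + 2 * normof L2 g ^+ 2) => // A.
  rewrite (@le_trans _ _ (\sum_(x <- A) (2 * (normc a ^+ 2 * normc (f x) ^+ 2) + 2 * normc (g x) ^+ 2)))//.
    apply: ler_sum => x _; have := ler_normcD (a * f x) (g x); rewrite normcM => h.
    rewrite (_ : (a *: f + g) x = a * f x + g x)//.
    have := sqr_ge0 (normc a * normc (f x) - normc (g x)); have := normc_ge0 (a * f x + g x).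
    nra.
  rewrite big_split/= -!mulr_sumr lerD//; rewrite ler_wpM2l// ?ler_wpM2l ?sqr_ge0//; exact: ell2_le.
- exact: ell2_ge0.
- move=> a f Lf; have [] := @ell2_bounded_norm (a *: f) (normc a * normof L2 f) => //.
    by rewrite mulr_ge0 ?normc_ge0 ?ell2_ge0.
  move=> A; rewrite exprMn (eq_bigr (fun x => normc a ^+ 2 * normc (f x) ^+ 2)).
    by rewrite -mulr_sumr ler_wpM2l ?sqr_ge0// ell2_le.
  by move=> x _; rewrite -exprMn -normcM.
Qed.

Lemma ell2_mul f (phi : G -> R[i]) : (forall x, normc (phi x) <= 1) -> carrier L2 f ->
  carrier L2 (fun x => f x * phi x) /\ normof L2 (fun x => f x * phi x) <= normof L2 f.
Proof.
move=> p1 Lf; apply: ell2_bounded_norm; first exact: ell2_ge0.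
move=> A; apply: le_trans (ell2_le A Lf); apply: ler_sum => x _.
rewrite normcM exprMn ler_piMr ?sqr_ge0// expr_le1//; exact: normc_ge0.
Qed.

(** At each point the squared moduli of the f phi_z add up to at most |f|^2; exchange the two
    sums. *)
Lemma ell2_mul_sum (I : choiceType) (Z : seq I) f (phi : I -> G -> R[i]) :
  (forall x, \sum_(z <- Z) normc (phi z x) ^+ 2 <= 1) -> carrier L2 f ->
  (forall z, carrier L2 (fun x => f x * phi z x)) ->
  \sum_(z <- Z) normof L2 (fun x => f x * phi z x) ^+ 2 <= normof L2 f ^+ 2.
Proof.
move=> p1 Lf Lfz; rewrite -lee_fin -sumEFin.
rewrite (eq_bigr (fun z => E2 (fun x => f x * phi z x))) => [|z _]; last exact: ell2_sqr.
rewrite -esum_sum => [|x z _ _]; last by rewrite lee_fin sqr_ge0.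
rewrite ell2_sqr//; apply: le_esum => x _; rewrite sumEFin lee_fin.
rewrite (eq_bigr (fun z => normc (f x) ^+ 2 * normc (phi z x) ^+ 2)).
  by rewrite -mulr_sumr ler_piMr ?sqr_ge0.
by move=> z _; rewrite normcM exprMn.
Qed.

Lemma ell2_finite f A : (forall x, x \notin A -> f x = 0) ->
  carrier L2 f /\ normof L2 f ^+ 2 <= \sum_(x <- A) normc (f x) ^+ 2.
Proof.
move=> fA; apply: ell2_bounded => B.
rewrite (@le_trans _ _ (\sum_(x <- (A `|` B)%fset) normc (f x) ^+ 2))//.
  rewrite (sum_subset_diff _ (fsubsetUr A B)) lerDl sumr_ge0// => x _; exact: sqr_ge0.
rewrite (sum_subset_diff _ (fsubsetUl A B)) [X in _ + X]big1_seq ?addr0//.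
move=> x /andP[_]; rewrite inE => /andP[/fA -> _].
by rewrite Normc.normc0 expr0n.
Qed.

Definition restrict_fun (P : pred G) f : G -> R[i]^o := fun x => f x * (P x)%:R.

Lemma restrict_fun_ell2 P f : carrier L2 f ->
  carrier L2 (restrict_fun P f) /\ normof L2 (restrict_fun P f) <= normof L2 f.
Proof.
by apply: ell2_mul => x; case: (P x); rewrite ?Normc.normc1 ?Normc.normc0.
Qed.

Lemma restrict_fun_approx f e : carrier L2 f -> 0 < e -> exists A0 : {fset G}, forall A,
  (A0 `<=` A)%fset -> normof L2 (restrict_fun [pred x | x \notin A] f) <= e.
Proof.
move=> Lf e0.
have [A0 A0P] : exists A0 : {fset G}, normof L2 f ^+ 2 - e ^+ 2 < \sum_(x <- A0) normc (f x) ^+ 2.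
  (* Otherwise every finite sum, and so the squared norm itself, would be at most the squared norm
     minus e^2. *)
  apply: contrapT => nA; have [|_] := @ell2_bounded f (normof L2 f ^+ 2 - e ^+ 2).
    by move=> A; rewrite leNgt; apply/negP => h; apply: nA; exists A.
  by have := exprn_gt0 2 e0; lra.
exists A0 => A AA; have [] := @ell2_bounded_norm (restrict_fun [pred x | x \notin A] f) e (ltW e0) => // B.
have h : \sum_(x <- B) normc (restrict_fun [pred x | x \notin A] f x) ^+ 2 <=
    \sum_(x <- ((A `|` B) `\` A)%fset) normc (f x) ^+ 2.
  rewrite (eq_bigr (fun x => if x \notin A then normc (f x) ^+ 2 else 0)).
    rewrite -big_mkcond big_fset_condE le_eqVlt; apply/orP; left; apply/eqP.
    by apply: eq_fbigl => x; rewrite !inE -[x \in mem_fin _]/(x \in B); case: (x \in A); rewrite ?andbF ?andbT.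
  move=> x _; rewrite /restrict_fun /=; case: (x \in A) => /=; last by rewrite mulr1.
  by rewrite mulr0 Normc.normc0 expr0n.
apply: (le_trans h).
have h1 := sum_subset_diff (fun x => normc (f x) ^+ 2) (fsubsetUl A B).
have h2 := sum_subset_diff (fun x => normc (f x) ^+ 2) AA.
have h3 := ell2_le (A `|` B)%fset Lf.
have h4 : 0 <= \sum_(x <- (A `\` A0)%fset) normc (f x) ^+ 2.
  by apply: sumr_ge0 => x _; exact: sqr_ge0.
lra.
Qed.

(** [fconj] cancels the conjugation inside [inner], so this is bilinear and factors through
    tensors. *)
Definition pairing (s : G) f g : R[i]^o := inner (regular s f) (fconj g).

Lemma pairingE s f g :
  pairing s f g = summability.sum (fun x => f (s^-1 * x)%g * g x : R[i]^o).
Proof.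
rewrite /pairing /inner; congr (summability.sum _); apply/funext => x.
by rewrite /regular /fconj conjCK.
Qed.

Lemma pairing_bounded s f g : carrier L2 f -> carrier L2 g ->
  abs_bounded (normof L2 f * normof L2 g) (fun x => f (s^-1 * x)%g * g x : R[i]^o).
Proof.
move=> Lf Lg A.
rewrite (eq_bigr (fun x => normc (f (s^-1 * x)%g) * normc (g x))) => [|x _]; last exact: normcM.
rewrite (le_trans (cauchy_schwarz_sum _ _ _))//.
have root_le (u k : R) : 0 <= k -> u <= k ^+ 2 -> Num.sqrt u <= k.
  by move=> k0 uk; rewrite -[leRHS]ger0_norm// -sqrtr_sqr ler_wsqrtr.
apply: ler_pM; rewrite ?sqrtr_ge0//; apply: root_le; rewrite ?ell2_ge0//; last exact: ell2_le.
have := ell2_le [fset (s^-1 * x)%g | x in A]%fset Lf; rewrite big_imfset//=.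
by move=> x y _ _; apply: mulgI.
Qed.

Lemma pairing_le s f g : carrier L2 f -> carrier L2 g ->
  normc (pairing s f g) <= normof L2 f * normof L2 g.
Proof. by move=> Lf Lg; rewrite pairingE; apply: normc_sum_le; apply: pairing_bounded. Qed.

Lemma pairing_bilinear s : bilinear_on L2 L2 (pairing s).
Proof.
split=> a x y z Lx Ly Lz; rewrite !pairingE.
- rewrite -(sum_linear _ (pairing_bounded s Lx Lz) (pairing_bounded s Ly Lz)).
  by congr (summability.sum _); apply/funext => w; rewrite [LHS](mulrDl (a * x (s^-1 * w)%g)) mulrA.
- rewrite -(sum_linear _ (pairing_bounded s Lx Ly) (pairing_bounded s Lx Lz)).
  by congr (summability.sum _); apply/funext => w; rewrite [LHS](mulrDr _ (a * y w)) mulrCA.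
Qed.

Lemma pairing_finite s f g A : (forall x, x \notin A -> g x = 0) ->
  pairing s f g = \sum_(x <- A) f (s^-1 * x)%g * g x.
Proof.
by move=> gA; rewrite pairingE; apply: sum_finite_support => x /gA ->; rewrite mulr0.
Qed.

Definition tpairing s (t : seq ((G -> R[i]^o) * (G -> R[i]^o))) : R[i]^o :=
  \sum_(p <- t) pairing s p.1 p.2.

Lemma tpairing_le s t : finite_tensor L2 L2 t ->
  normc (tpairing s t) <= proj_norm L2 L2 t.
Proof.
move=> tt; apply/ler_addgt0Pr => e e0.
have [u [uu tu /ltW cu]] := proj_norm_attain ell2_seminormed ell2_seminormed tt e0.
apply: le_trans cu; rewrite /tpairing (tu _ _ (pairing_bilinear s)).
rewrite (le_trans (normc_sum _ _ _))// big_seq [leRHS]big_seq; apply: ler_sum => p /uu[].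
exact: pairing_le.
Qed.

End ell2.

(** * The Fourier algebra *)

Section fourier.
Context (R : realType) (G : groupType).
Local Notation fn := (G -> R[i]^o).
Local Notation L2 := (ell2 R G).
Local Notation A := (fourier R G).
Implicit Types (T U : nat -> seq (fn * fn)) (t : seq (fn * fn)) (u v : fn).

Let L2s := @ell2_seminormed R G.

Lemma tpairing_cat s t t' : tpairing s (t ++ t') = tpairing s t + tpairing s t'.
Proof. by rewrite /tpairing big_cat. Qed.

Lemma tpairing_scale s a t : finite_tensor L2 L2 t ->
  tpairing s (tensor_scale a t) = a * tpairing s t.
Proof. by move=> tt; rewrite /tpairing (sum_tensor_scale L2s (@pairing_bilinear R G s)). Qed.

Lemma tpairing_sub s t t' : finite_tensor L2 L2 t' ->
  tpairing s (tensor_sub t t') = tpairing s t - tpairing s t'.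
Proof. by move=> tt; rewrite /tpairing (sum_tensor_sub L2s (@pairing_bilinear R G s)). Qed.

Lemma alpha_cvg T s : ptensor L2 L2 T ->
  (tpairing s (T n) : R[i]^o) @[n --> \oo] --> (alpha T s : R[i]^o).
Proof.
move=> [Tft Tc].
have [l hl] : exists l : R[i]^o, (tpairing s (T n) : R[i]^o) @[n --> \oo] --> l.
  apply: complex_cauchy_cvg => e e0; have [N NP] := Tc _ e0.
  exists [set n | (N <= n)%N]; first by exists N.
  move=> m n Nm Nn; rewrite -tpairing_sub// (le_trans (tpairing_le _ _))//.
    exact: finite_tensor_sub.
  by rewrite ltW// NP.
suff -> : alpha T s = l by [].
by apply: cvg_lim => //; exact: norm_hausdorff.
Qed.

Lemma alpha_unique T s (l : R[i]^o) : 
  (tpairing s (T n) : R[i]^o) @[n --> \oo] --> l -> alpha T s = l.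
Proof. by move=> hl; apply: cvg_lim => //; exact: norm_hausdorff. Qed.

Lemma alpha_le T s : ptensor L2 L2 T -> normc (alpha T s) <= ptensor_norm L2 L2 T.
Proof.
move=> Tp; apply/ler_addgt0Pr => e e0.
have e20 : 0 < e / 2 by rewrite divr_gt0.
have /cvg_normcP/(_ _ e20)[N _ NP] := @alpha_cvg T s Tp.
have [M MP] := ptensor_norm_approx L2s L2s Tp e20.
have /= h1 := NP (maxn N M) (leq_maxl _ _).
have h2 := MP (maxn N M) (leq_maxr _ _).
have h3 := tpairing_le s (Tp.1 (maxn N M)).
have := ler_normcD (alpha T s - tpairing s (T (maxn N M))) (tpairing s (T (maxn N M))).
rewrite subrK; lra.
Qed.

Lemma alpha_cat T U : ptensor L2 L2 T -> ptensor L2 L2 U ->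
  alpha (fun n => T n ++ U n) = alpha T + alpha U.
Proof.
move=> Tp Up; apply/funext => s; apply: alpha_unique.
rewrite (_ : (fun n => _) = (fun n => tpairing s (T n) + tpairing s (U n))).
  exact: (cvgD (@alpha_cvg T s Tp) (@alpha_cvg U s Up)).
by apply/funext => n; rewrite tpairing_cat.
Qed.

Lemma alpha_scale a T : ptensor L2 L2 T ->
  alpha (fun n => tensor_scale a (T n)) = a *: alpha T.
Proof.
move=> Tp; apply/funext => s; apply: alpha_unique.
rewrite (_ : (fun n => _) = (fun n => a *: (tpairing s (T n) : R[i]^o))).
  exact: (cvgZl_tmp (k := a) (@alpha_cvg T s Tp)).
by apply/funext => n; rewrite tpairing_scale//; apply: Tp.1.
Qed.

Lemma alpha_const t : alpha (fun=> t) = (fun s => tpairing s t).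
Proof. by apply/funext => s; apply: alpha_unique; apply: cvg_cst. Qed.

Let norms u := [set ptensor_norm L2 L2 T | T in [set T | ptensor L2 L2 T /\ alpha T = u]].

Let norms_lb u : has_lbound (norms u).
Proof. by exists 0 => _ [T [Tp _] <-]; apply: ptensor_norm_ge0. Qed.

Lemma fourier_norm_le T : ptensor L2 L2 T -> normof A (alpha T) <= ptensor_norm L2 L2 T.
Proof. by move=> Tp; apply: (ge_inf (norms_lb (alpha T))); exists T. Qed.

Lemma fourier_norm_attain u e : carrier A u -> 0 < e ->
  exists T, [/\ ptensor L2 L2 T, alpha T = u & ptensor_norm L2 L2 T < normof A u + e].
Proof.
move=> [T Tp Tu] e0.
have ci : has_inf (norms u) by split=> //; exists (ptensor_norm L2 L2 T), T.
by have [_ [U [Up Uu] <-] Ue] := inf_adherent e0 ci; exists U.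
Qed.

Lemma fourier_norm_ge0 u : 0 <= normof A u.
Proof.
rewrite /= -/(norms u); have [->|/set0P c0] := eqVneq (norms u) set0.
  by rewrite inf0.
by apply: lb_le_inf => // _ [T [Tp _] <-]; apply: ptensor_norm_ge0.
Qed.

Lemma fourierD u v : carrier A u -> carrier A v ->
  carrier A (u + v) /\ normof A (u + v) <= normof A u + normof A v.
Proof.
move=> Au Av; split.
  have [T Tp <-] := Au; have [U Up <-] := Av.
  by exists (fun n => T n ++ U n); [apply: ptensor_cat | apply: alpha_cat].
apply/ler_addgt0Pr => e e0.
have e20 : 0 < e / 2 by rewrite divr_gt0.
have [T [Tp Tu Te]] := fourier_norm_attain Au e20.
have [U [Up Uv Ue]] := fourier_norm_attain Av e20.
have := fourier_norm_le (ptensor_cat L2s L2s Tp Up).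
have := ptensor_norm_cat L2s L2s Tp Up.
by rewrite alpha_cat// Tu Uv; lra.
Qed.

Lemma fourierZ a u : carrier A u ->
  carrier A (a *: u) /\ normof A (a *: u) <= normc a * normof A u.
Proof.
move=> Au; split.
  have [T Tp <-] := Au.
  by exists (fun n => tensor_scale a (T n)); [apply: ptensor_scale | apply: alpha_scale].
apply/ler_addgt0Pr => e e0.
have a1 : 0 < normc a + 1 by rewrite ltr_wpDl// normc_ge0.
have e20 : 0 < e / (normc a + 1) by rewrite divr_gt0.
have [T [Tp Tu Te]] := fourier_norm_attain Au e20.
have := fourier_norm_le (ptensor_scale L2s L2s a Tp).
have := ptensor_norm_scale L2s L2s a Tp.
rewrite alpha_scale// Tu.
have eE : e = e / (normc a + 1) * (normc a + 1) by rewrite divfK// gt_eqF.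
have := normc_ge0 a; nra.
Qed.

Lemma fourier_tensor t : finite_tensor L2 L2 t ->
  carrier A (fun s => tpairing s t) /\ normof A (fun s => tpairing s t) <= proj_norm L2 L2 t.
Proof.
move=> tt; have tp := ptensor_const L2s L2s tt.
split; first by exists (fun=> t) => //; rewrite alpha_const.
by have := fourier_norm_le tp; rewrite alpha_const ptensor_norm_const.
Qed.

Lemma fourier_seminormed : seminormed A.
Proof.
split.
- have [] := @fourier_tensor [::] => // + _.
  by congr (carrier A _); apply/funext => s; rewrite /tpairing big_nil.
- by move=> a u v Au Av; apply: (fourierD _ _).1 => //; apply: (fourierZ a Au).1.
- exact: fourier_norm_ge0.
- by move=> a u Au; apply: (fourierZ a Au).2.
Qed.

Lemma fourier_le u s : carrier A u -> normc (u s) <= normof A u.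
Proof.
move=> Au; apply/ler_addgt0Pr => e e0.
have [T [Tp <- /ltW]] := fourier_norm_attain Au e0.
by apply: le_trans; apply: alpha_le.
Qed.

Lemma fourier_norm_sum (I : Type) (r : seq I) (f : I -> fn) :
  (forall i, carrier A (f i)) -> normof A (\sum_(i <- r) f i) <= \sum_(i <- r) normof A (f i).
Proof.
move=> Af; elim: r => [|i r IH].
  rewrite !big_nil; have [A0 _ _ AZ] := fourier_seminormed.
  by have := AZ 0 0 A0; rewrite scale0r Normc.normc0 mul0r.
rewrite !big_cons; have := (fourierD (Af i) (carrier_sum fourier_seminormed r (P := xpredT) (fun i _ => Af i))).2.
by move=> /le_trans; apply; rewrite lerD2l.
Qed.

Definition delta (s : G) : fn := fun x => (x == s)%:R.

Lemma delta_ell2 s : carrier L2 (delta s) /\ normof L2 (delta s) <= 1.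
Proof.
have [x|Ls ns] := @ell2_finite R G (delta s) [fset s]%fset.
  by rewrite inE /delta => /negbTE ->.
split=> //; rewrite -(@expr_le1 _ 2)//; last exact: ell2_ge0.
by rewrite (le_trans ns)// big_seq_fset1 /delta eqxx Normc.normc1 expr1n.
Qed.

(** The point mass at s is the coefficient of lambda at the unit vectors delta_1 and delta_s. *)
Lemma delta_fourier s : carrier A (delta s) /\ normof A (delta s) <= 1.
Proof.
have [L1 n1] := delta_ell2 1%g; have [Ls ns] := delta_ell2 s.
have tt : finite_tensor L2 L2 [:: (delta 1%g, delta s)] by move=> p; rewrite inE => /eqP ->.
have -> : delta s = (fun x => tpairing x [:: (delta 1%g, delta s)]).
  apply/funext => x; rewrite /tpairing big_seq1 (@pairing_finite _ _ _ _ _ [fset s]%fset) /=.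
    rewrite big_seq_fset1 /delta eqxx mulr1; congr (_%:R); congr (nat_of_bool _).
    apply/eqP/eqP => [->|E]; first by rewrite mulVg.
    by rewrite -[s]mul1g -(mulgV x) -mulgA E mulg1.
  by move=> y; rewrite inE /delta => /negbTE ->.
have [As nA] := fourier_tensor tt; split=> //; rewrite (le_trans nA)//.
rewrite (le_trans (proj_norm_le_cost L2s L2s tt))// big_seq1 /=.
by rewrite mulr_ile1 ?ell2_ge0.
Qed.

Lemma finite_support_delta u (K : {fset G}) : (forall x, x \notin K -> u x = 0) ->
  u = \sum_(x <- K) u x *: delta x.
Proof.
move=> uK; apply/funext => y; rewrite fct_sumE.
have [yK|yK] := boolP (y \in K); last first.
  rewrite uK// big1_seq// => x /andP[_ xK].
  have yx : (y == x) = false by apply: contraNF yK => /eqP ->.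
  by rewrite -[LHS]/(u x * delta x y) /delta yx mulr0.
rewrite (big_fsetD1 y)//= big1_seq ?addr0.
  by rewrite -[RHS]/(u y * delta y y) /delta eqxx mulr1.
move=> x /andP[_]; rewrite !inE => /andP[/negbTE xy _].
by rewrite -[LHS]/(u x * delta x y) /delta eq_sym xy mulr0.
Qed.

Lemma finite_support_fourier u (K : {fset G}) : (forall x, x \notin K -> u x = 0) ->
  carrier A u /\ normof A u <= \sum_(x <- K) normc (u x).
Proof.
move=> uK; have As := fourier_seminormed.
have Ad x : carrier A (u x *: delta x).
  by apply: carrierZ => //; apply: (delta_fourier x).1.
rewrite (finite_support_delta uK); split; first exact: carrier_sum.
rewrite (le_trans (fourier_norm_sum _ Ad))// -(finite_support_delta uK).
apply: ler_sum => x _; have [Ax nx] := delta_fourier x.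
by rewrite (le_trans (fourierZ (u x) Ax).2)// ler_piMr ?normc_ge0.
Qed.

End fourier.

(** * Multipliers of the Fourier algebra *)

Section autocorrelation.
Context (R : realType) (G : groupType) (xi : G -> R) (K : {fset G}).
Hypotheses (xiK : forall x, x \notin K -> xi x = 0)
  (xi1 : \sum_(x <- K) xi x ^+ 2 = 1).
Local Notation fn := (G -> R[i]^o).
Local Notation L2 := (ell2 R G).
Local Notation A := (fourier R G).
Let L2s := @ell2_seminormed R G.

Definition autocorrelation : fn := fun s => (\sum_(x <- K) xi (s^-1 * x)%g * xi x)%:C%C.

Local Notation e := autocorrelation.

Lemma sum_xi_sqr_le x (Z : {fset G}) : \sum_(z <- Z) xi (x * z)%g ^+ 2 <= 1.
Proof.
have inj : {in Z &, injective (fun z => x * z)%g} by move=> y z _ _; apply: mulgI.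
have -> : \sum_(z <- Z) xi (x * z)%g ^+ 2 =
    \sum_(y <- [fset (x * z)%g | z in Z]%fset) xi y ^+ 2 by rewrite big_imfset.
set B := [fset _ | _ in _]%fset.
rewrite -xi1 (@le_trans _ _ (\sum_(y <- (K `|` B)%fset) xi y ^+ 2))//.
  rewrite (sum_subset_diff _ (fsubsetUr K B)) lerDl sumr_ge0// => y _; exact: sqr_ge0.
rewrite (sum_subset_diff _ (fsubsetUl K B)) [X in _ + X]big1_seq ?addr0//.
by move=> y /andP[_]; rewrite inE => /andP[/xiK -> _]; rewrite expr0n.
Qed.

Lemma normc_real (x : R) : normc x%:C%C = `|x|.
Proof. by rewrite /= expr0n addr0 sqrtr_sqr. Qed.

Lemma xi_norm_le1 x : `|xi x| <= 1.
Proof.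
rewrite -(@expr_le1 _ 2)// real_normK ?num_real//.
by have := sum_xi_sqr_le x [fset 1%g]%fset; rewrite big_seq_fset1 mulg1.
Qed.

Definition autocorrelation_support : {fset G} :=
  [fset (x * y^-1)%g | x in K, y in K]%fset.

Lemma autocorrelation0 s : s \notin autocorrelation_support -> e s = 0.
Proof.
move=> sK; rewrite /e big1_seq// => x /andP[_ xK].
rewrite xiK ?mul0r//; apply: contra sK => sxK.
apply/imfset2P; exists x => //; exists (s^-1 * x)%g => //.
by rewrite invgM invgK mulgA mulgV mul1g.
Qed.

Definition mult_shift (z : G) (f : fn) : fn := fun x => f x * (xi (x * z)%g)%:C%C.

(** This is why multiplication by e is a contraction. By translation e(s) is, for every x, the sum
    over z of xi(s^-1 x z) xi(x z); so multiplying both legs by xi(. z) and summing over z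
    multiplies [tpairing] by e. Cauchy-Schwarz and the unit norm of xi control the norm. *)
Lemma tensor_mult (B : {fset G}) (t : seq (fn * fn)) : finite_tensor L2 L2 t ->
  (forall p, p \in t -> forall x, x \notin B -> p.2 x = 0) ->
  exists t', [/\ finite_tensor L2 L2 t',
    forall p, p \in t' -> forall x, x \notin B -> p.2 x = 0,
    forall s, tpairing s t' = tpairing s t * e s &
    proj_norm L2 L2 t' <= proj_norm L2 L2 t].
Proof.
(* Z contains every z for which x z meets K for some x in B, so the finite sum over Z misses
   nothing. *)
move=> tt tB; pose Z := [fset (x^-1 * y)%g | x in B, y in K]%fset.
have shL z f : carrier L2 f -> carrier L2 (mult_shift z f).
  move=> Lf; apply: (ell2_mul _ Lf).1 => x; rewrite normc_real; exact: xi_norm_le1.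
have shlin z (a : R[i]) (f g : fn) :
    mult_shift z (a *: f + g) = a *: mult_shift z f + mult_shift z g.
  by apply/funext => x; rewrite /mult_shift [LHS]mulrDl -mulrA.
exists (tensor_map Z mult_shift mult_shift t); split.
- exact: finite_tensor_map.
- by move=> _ /allpairsP[[p z] /= [pt _ ->]] x xB; rewrite /= /mult_shift (tB _ pt _ xB) mul0r.
- move=> s; rewrite /tpairing (big_tensor_map _ _ _ (pairing s)) mulr_suml.
  apply: eq_big_seq => p pt; have pB := tB _ pt.
  rewrite (pairing_finite _ _ pB).
  rewrite (eq_bigr (fun z => \sum_(x <- B) p.1 (s^-1 * x)%g * p.2 x *
      (xi (s^-1 * x * z)%g * xi (x * z)%g)%:C%C)); last first.
    move=> z _; rewrite (@pairing_finite _ _ s _ _ B); last first.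
      by move=> x xB; rewrite /mult_shift pB ?mul0r.
    by apply: eq_bigr => x _; rewrite /mult_shift mulrACA rmorphM.
  rewrite exchange_big/= mulr_suml; apply: eq_big_seq => x xB.
  rewrite -mulr_sumr -rmorph_sum; congr (_ * _%:C%C).
  have inj : {in K &, injective (fun y => x^-1 * y)%g} by move=> y z _ _; apply: mulgI.
  have -> : \sum_(y <- K) xi (s^-1 * y)%g * xi y =
      \sum_(z <- [fset (x^-1 * y)%g | y in K]%fset) xi (s^-1 * x * z)%g * xi (x * z)%g.
    by rewrite big_imfset//=; apply: eq_bigr => y _; rewrite -mulgA !mulVKg.
  apply/esym/big_fset_incl.
    by apply/fsubsetP => _ /imfsetP[y yK ->]; apply/imfset2P; exists x => //; exists y.
  move=> z _ zK; rewrite [xi (x * z)%g]xiK ?mulr0//; apply: contra zK => xzK.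
  by apply/imfsetP; exists (x * z)%g => //; rewrite mulKg.
- apply: proj_norm_map => // f g Lf Lg.
  rewrite (le_trans (cauchy_schwarz_sum _ _ _))//.
  have key h : carrier L2 h -> Num.sqrt (\sum_(z <- Z) normof L2 (mult_shift z h) ^+ 2) <= normof L2 h.
    move=> Lh; rewrite -[leRHS]ger0_norm ?ell2_ge0// -sqrtr_sqr ler_wsqrtr//.
    apply: ell2_mul_sum => // [x|z]; last exact: shL.
    by rewrite (eq_bigr (fun z => xi (x * z)%g ^+ 2)) ?sum_xi_sqr_le// => z _;
       rewrite normc_real real_normK ?num_real.
  by apply: ler_pM; rewrite ?sqrtr_ge0//; apply: key.
Qed.

Section coefficient.
Context (n : nat) (rho : G -> 'M[R[i]]_n) (a b : 'rV[R[i]]_n).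
Hypotheses (rho_rep : unitary_mxrep rho) (au : a \is unitarymx) (bu : b \is unitarymx).

(* Fell's absorption: lambda (x) rho is a multiple of lambda, so the product
   of e with a coefficient of rho is again a coefficient of lambda. *)
Lemma coefficient_fourier :
  let u : fn := fun s => e s * (a *m rho s *m b^t*) 0 0 in
  carrier A u /\ normof A u <= 1.
Proof.
have [r1 rM rU] := rho_rep => u.
(* Coordinates of the vector-valued functions xi(x) b rho(x) (conjugated) and xi(x) a rho(x).
   Summing over l recovers the coefficient, because rho(x) rho(s^-1 x)^* = rho(s). *)
pose f l : fn := fun x => (xi x)%:C%C * ((b *m rho x) 0 l)^*.
pose g l : fn := fun x => (xi x)%:C%C * (a *m rho x) 0 l.
pose t := [seq (f l, g l) | l <- enum 'I_n].
have row1 (c : 'rV[R[i]]_n) x : c \is unitarymx -> \sum_l normc ((c *m rho x) 0 l) ^+ 2 = 1.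
  move=> cu; apply: complexI; rewrite rmorph_sum rmorph1.
  have /unitarymxP/matrixP/(_ 0 0) := mul_unitarymx cu (rU x).
  rewrite !mxE eqxx mulr1n => <-; apply: eq_bigr => l _.
  by rewrite rmorphXn/= -normr_normc normCK !mxE.
have fL l : carrier L2 (f l) /\ normof L2 (f l) ^+ 2 <= \sum_(x <- K) normc (f l x) ^+ 2.
  by apply: ell2_finite => x xK; rewrite /f xiK// mul0r.
have gK l x : x \notin K -> g l x = 0 by move=> xK; rewrite /g xiK// mul0r.
have gL l : carrier L2 (g l) /\ normof L2 (g l) ^+ 2 <= \sum_(x <- K) normc (g l x) ^+ 2.
  by apply: ell2_finite => x xK; apply: gK.
have tt : finite_tensor L2 L2 t.
  by move=> _ /mapP[l _ ->]; split; [apply: (fL l).1 | apply: (gL l).1].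
have -> : u = (fun s => tpairing s t).
  apply/funext => s; rewrite /tpairing big_map big_enum/=.
  rewrite (eq_bigr (fun l => \sum_(x <- K) (xi (s^-1 * x)%g * xi x)%:C%C *
      ((a *m rho x) 0 l * ((b *m rho (s^-1 * x)%g) 0 l)^*))); last first.
    move=> l _; rewrite (pairing_finite _ _ (gK l)); apply: eq_bigr => x _.
    by rewrite /f /g mulrACA rmorphM/= [_^* * _]mulrC.
  rewrite exchange_big/= /u /e rmorph_sum mulr_suml; apply: eq_bigr => x _.
  rewrite -mulr_sumr; congr (_ * _).
  have -> : a *m rho s *m b^t* = (a *m rho x) *m (b *m rho (s^-1 * x)%g)^t*.
    rewrite adjmxM -(unitary_mxrepV rho_rep) mulmxA -[in RHS](mulmxA a) -rM.
    by rewrite invgM invgK mulVKg.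
  by rewrite mxE; apply: eq_bigr => l _; rewrite [(_ ^t*) _ _]mxE [(_^T) _ _]mxE.
have [At nt] := fourier_tensor tt; split=> //.
rewrite (le_trans nt)// (le_trans (proj_norm_le_cost L2s L2s tt))// big_map big_enum/=.
rewrite (le_trans (cauchy_schwarz_sum _ _ _))//.
have key (h : 'I_n -> fn) (c : 'rV[R[i]]_n) : c \is unitarymx ->
    (forall l x, normc (h l x) = `|xi x| * normc ((c *m rho x) 0 l)) ->
    (forall l, normof L2 (h l) ^+ 2 <= \sum_(x <- K) normc (h l x) ^+ 2) ->
    Num.sqrt (\sum_l normof L2 (h l) ^+ 2) <= 1.
  move=> cu hE hL; rewrite -sqrtr1 ler_wsqrtr//.
  rewrite (le_trans (ler_sum _ (fun l _ => hL l)))// exchange_big/=.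
  rewrite -xi1 ler_sum// => x _.
  rewrite (eq_bigr (fun l => xi x ^+ 2 * normc ((c *m rho x) 0 l) ^+ 2)).
    by rewrite -mulr_sumr row1// mulr1.
  by move=> l _; rewrite hE exprMn real_normK ?num_real.
apply: mulr_ile1; rewrite ?sqrtr_ge0//.
  apply: (key f b) => // l; last exact: (fL l).2.
  by move=> x; rewrite /f normcM normc_real normc_conj.
apply: (key g a) => // l; last exact: (gL l).2.
by move=> x; rewrite /g normcM normc_real.
Qed.

End coefficient.
End autocorrelation.

(** * Almost invariant unit vectors *)

Section folner_vector.
Context (R : realType) (G : groupType).
Hypothesis hG : virtually_abelian G.

Lemma sum_count_mem (L : seq G) (K : {fset G}) :
  (\sum_(x <- K) count_mem x L <= size L)%N.
Proof.
elim: L => [|y L IH]; first by rewrite big1.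
rewrite /= big_split /= -add1n leq_add//.
have [yK|yK] := boolP (y \in K).
  rewrite (big_fsetD1 y)//= eqxx big1_seq// => x /andP[_].
  by rewrite !inE eq_sym => /andP[/negbTE ->].
rewrite big1_seq// => x /andP[_ xK]; case: eqP => // yx.
by rewrite yx xK in yK.
Qed.

Lemma sum_count_mem_support (L : seq G) (K : {fset G}) : {subset L <= K} ->
  (\sum_(x <- K) count_mem x L = size L)%N.
Proof.
elim: L => [|y L IH] LK; first by rewrite big1.
rewrite /= big_split /= IH; last by move=> x xL; apply: LK; rewrite inE xL orbT.
rewrite (big_fsetD1 y) ?LK ?mem_head//= eqxx big1_seq// => x /andP[_].
by rewrite !inE eq_sym => /andP[/negbTE ->].
Qed.

(** Let xi^2 be the normalized multiplicity in a Folner multiset L. A product xi(s^-1 x) xi(x) is at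
    least the smaller of the two squares, hence at least the multiplicity of x in L minus that in X,
    over |L|; summing gives e(s) >= 1 - |X|/|L|. The bound e(s) <= 1 comes from 2ab <= a^2 + b^2. *)
Lemma folner_vector (F : seq G) (J : nat) : (0 < J)%N ->
  exists (xi : G -> R) (K : {fset G}), [/\ forall x, x \notin K -> xi x = 0,
    \sum_(x <- K) xi x ^+ 2 = 1
    & forall s, s \in F -> normc (autocorrelation xi K s - 1) <= J%:R^-1].
Proof.
move=> J0; have [L [L0 LF]] := folner F hG J0.
pose N : R := (size L)%:R; have N0 : 0 < N by rewrite ltr0n.
pose K : {fset G} := [fset x in L]%fset.
pose xi x : R := Num.sqrt ((count_mem x L)%:R / N).
have xi0 x : 0 <= xi x by exact: sqrtr_ge0.
have xi2 x : xi x ^+ 2 = (count_mem x L)%:R / N.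
  by rewrite sqr_sqrtr// divr_ge0// ltW.
have xiK x : x \notin K -> xi x = 0.
  move=> xK; rewrite /xi (count_memPn _) ?mul0r ?sqrtr0//.
  by apply: contra xK; rewrite inE.
have xi1 : \sum_(x <- K) xi x ^+ 2 = 1.
  rewrite (eq_bigr _ (fun x _ => xi2 x)) -mulr_suml -natr_sum.
  rewrite sum_count_mem_support ?divff ?gt_eqF// => x xL.
  by rewrite inE.
exists xi, K; split=> // s /LF[X [Y [XY JX]]].
rewrite /autocorrelation -(rmorph1 (real_complex R)) -rmorphB normc_real.
rewrite ler_norml; apply/andP; split; last first.
  rewrite (@le_trans _ _ 0)// subr_le0.
  rewrite (@le_trans _ _ (\sum_(x <- K) (xi (s^-1 * x)%g ^+ 2 / 2 + xi x ^+ 2 / 2)))//.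
    apply: ler_sum => x _; have := sqr_ge0 (xi (s^-1 * x)%g - xi x); nra.
  rewrite big_split/= -!mulr_suml xi1.
  by have := sum_xi_sqr_le xiK xi1 s^-1%g K; lra.
have cs x : count_mem x [seq (s * y)%g | y <- L] = count_mem (s^-1 * x)%g L.
  rewrite count_map; apply: eq_count => y /=.
  by apply/eqP/eqP => [<-|->]; rewrite ?mulKg ?mulVKg.
have lb x : ((count_mem x L)%:R - (count_mem x X)%:R) / N <= xi (s^-1 * x)%g * xi x.
  have [cc|cc] := leqP (count_mem x L) (count_mem x X).
    rewrite (@le_trans _ _ 0) ?mulr_ge0// pmulr_lle0 ?invr_gt0// subr_le0 ler_nat//.
  have /permP/(_ (pred1 x)) := XY; rewrite !count_cat cs => E.
  have le1 : ((count_mem x L)%:R - (count_mem x X)%:R) / N <= xi (s^-1 * x)%g ^+ 2.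
    rewrite xi2 ler_pM2r ?invr_gt0// lerBlDr -natrD ler_nat.
    by rewrite E leq_addr.
  have le2 : ((count_mem x L)%:R - (count_mem x X)%:R) / N <= xi x ^+ 2.
    by rewrite xi2 ler_pM2r ?invr_gt0// lerBlDr lerDl.
  have [h|h] := leP (xi (s^-1 * x)%g) (xi x).
    by rewrite (le_trans le1)// expr2 ler_wpM2l.
  by rewrite (le_trans le2)// expr2 ler_wpM2r// ltW.
rewrite lerBrDr addrC.
apply: le_trans (ler_sum _ (fun x _ => lb x)).
rewrite -mulr_suml sumrB -!natr_sum sum_count_mem_support; last by move=> x xL; rewrite inE.
rewrite mulrBl divff ?gt_eqF// lerD2l lerN2.
rewrite ler_pdivrMr// mulrC ler_pdivlMr ?ltr0n// -natrM ler_nat.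
by apply: leq_trans JX; rewrite mulnC leq_mul2l sum_count_mem orbT.
Qed.

End folner_vector.

(** * Approximation by finite supports, and the approximate unit *)

Section approximation.
Context (R : realType) (G : groupType).
Local Notation fn := (G -> R[i]^o).
Local Notation L2 := (ell2 R G).
Local Notation A := (fourier R G).
Let L2s := @ell2_seminormed R G.
Let As := @fourier_seminormed R G.

Definition supported (B : {fset G}) (f : fn) : Prop := forall x, x \notin B -> f x = 0.

(** With P and Q the restrictions to a large finite B and to its complement, f (x) g - Pf (x) Pg =
    Pf (x) Qg + Qf (x) g. The constant c dominates the sum of both norms, so errors of eps / c in Qf
    and Qg suffice. *)
Lemma rank1_approx (f g : fn) eps : carrier L2 f -> carrier L2 g -> 0 < eps ->
  exists (f' g' : fn) (B : {fset G}), [/\ carrier L2 f' /\ carrier L2 g',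
    supported B f', supported B g'
    & proj_norm L2 L2 (tensor_sub [:: (f, g)] [:: (f', g')]) <= eps].
Proof.
move=> Lf Lg e0; pose c := normof L2 f + normof L2 g + 1.
have [f0 g0] := (ell2_ge0 f, ell2_ge0 g).
have c0 : 0 < c by rewrite /c; lra.
have d0 : 0 < eps / c by rewrite divr_gt0.
have [B1 B1P] := restrict_fun_approx Lf d0; have [B2 B2P] := restrict_fun_approx Lg d0.
pose B := (B1 `|` B2)%fset.
pose P := [pred x | x \in B]; pose Q := [pred x | x \notin B].
have PQ (h : fn) : h = restrict_fun P h + restrict_fun Q h.
  apply/funext => x; rewrite -[RHS]/(restrict_fun P h x + restrict_fun Q h x) /restrict_fun /=.
  by case: (x \in B); rewrite ?mulr1 ?mulr0 ?addr0 ?add0r.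
have [Lf1 nf1] := restrict_fun_ell2 P Lf; have [Lg1 ng1] := restrict_fun_ell2 P Lg.
have [Lf2 _] := restrict_fun_ell2 Q Lf; have [Lg2 _] := restrict_fun_ell2 Q Lg.
have nf2 : normof L2 (restrict_fun Q f) <= eps / c by apply: B1P; apply: fsubsetUl.
have ng2 : normof L2 (restrict_fun Q g) <= eps / c by apply: B2P; apply: fsubsetUr.
exists (restrict_fun P f), (restrict_fun P g), B; split=> //.
- by move=> x /negbTE xB; rewrite /restrict_fun /= xB mulr0.
- by move=> x /negbTE xB; rewrite /restrict_fun /= xB mulr0.
have ft1 : finite_tensor L2 L2 [:: (restrict_fun P f, restrict_fun P g)].
  by apply: finite_tensor_cons.
have ft2 : finite_tensor L2 L2 [:: (restrict_fun P f, restrict_fun Q g); (restrict_fun Q f, g)].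
  by do 2 apply: finite_tensor_cons => //.
have teq : tensor_eq L2 L2 (tensor_sub [:: (f, g)] [:: (restrict_fun P f, restrict_fun P g)])
    [:: (restrict_fun P f, restrict_fun Q g); (restrict_fun Q f, g)].
  move=> V b bb; rewrite (sum_tensor_sub L2s bb)// !big_cons !big_nil !addr0 /=.
  rewrite {1}(PQ f) (bilinear_onDl bb)// {1}(PQ g) (bilinear_onDr bb)//.
  by rewrite [LHS]addrC -addrA addKr.
rewrite (le_trans (proj_norm_le L2s L2s ft2 teq))// !big_cons big_nil addr0 /=.
have h1 : normof L2 (restrict_fun P f) * normof L2 (restrict_fun Q g) <= normof L2 f * (eps / c).
  by rewrite ler_pM ?ell2_ge0.
have h2 : normof L2 (restrict_fun Q f) * normof L2 g <= (eps / c) * normof L2 g.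
  by rewrite ler_pM ?ell2_ge0.
have q0 : 0 <= eps / c by rewrite ltW.
have eE : eps / c * (normof L2 f + normof L2 g + 1) = eps by rewrite divfK// gt_eqF.
apply: (le_trans (lerD h1 h2)); rewrite -[leRHS]eE !mulrDr mulr1.
by rewrite [_ * normof L2 f]mulrC lerDl.
Qed.

Lemma finite_support_approx (t : seq (fn * fn)) eps : finite_tensor L2 L2 t -> 0 < eps ->
  exists (t' : seq (fn * fn)) (B : {fset G}), [/\ finite_tensor L2 L2 t',
    forall p, p \in t' -> supported B p.1 /\ supported B p.2
    & proj_norm L2 L2 (tensor_sub t t') <= eps].
Proof.
move=> tt; elim: t tt eps => [_|[f g] t IH ft eps e0].
  move=> eps e0; exists [::], fset0; split=> //.
  rewrite (le_trans (proj_norm_le_cost L2s L2s _))//.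
  by rewrite big_nil ltW.
have [Lf Lg] := ft (f, g) (mem_head _ _).
have tt : finite_tensor L2 L2 t by move=> p pt; apply: ft; rewrite inE pt orbT.
have e20 : 0 < eps / 2 by rewrite divr_gt0.
have [t' [B [tt' tB te]]] := IH tt _ e20.
have [f' [g' [B' [[Lf' Lg'] fB gB fge]]]] := rank1_approx Lf Lg e20.
have ft1 : finite_tensor L2 L2 [:: (f, g)] by apply: finite_tensor_cons.
have ft1' : finite_tensor L2 L2 [:: (f', g')] by apply: finite_tensor_cons.
have ft' : finite_tensor L2 L2 ((f', g') :: t') by apply: finite_tensor_cons.
exists ((f', g') :: t'), (B `|` B')%fset; split=> //.
  move=> p; rewrite inE => /predU1P[->|/tB[p1 p2]].
    by split=> x; rewrite inE negb_or => /andP[_]; [apply: fB | apply: gB].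
  by split=> x; rewrite inE negb_or => /andP[xB _]; [apply: p1 | apply: p2].
have fts1 := finite_tensor_sub L2s ft1 ft1'; have fts2 := finite_tensor_sub L2s tt tt'.
have := proj_norm_cat L2s L2s fts1 fts2.
rewrite (@proj_norm_eq _ _ _ _ _ L2s L2s _ (tensor_sub ((f, g) :: t) ((f', g') :: t'))).
- lra.
- exact: finite_tensor_cat.
- exact: finite_tensor_sub.
- move=> V b bb; rewrite big_cat/= !(sum_tensor_sub L2s bb)// !big_cons !big_nil /=.
  by rewrite !addr0 opprD addrACA.
Qed.

Lemma tpairing_supported (t : seq (fn * fn)) (B : {fset G}) :
  (forall p, p \in t -> supported B p.1 /\ supported B p.2) ->
  supported [fset (x * y^-1)%g | x in B, y in B]%fset (fun s => tpairing s t).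
Proof.
move=> tB s sB; rewrite /tpairing big1_seq// => p /andP[_ /tB[p1 p2]].
rewrite (pairing_finite _ _ p2) big1_seq// => x /andP[_ xB].
rewrite p1 ?mul0r//; apply: contra sB => sxB.
apply/imfset2P; exists x => //; exists (s^-1 * x)%g => //.
by rewrite invgM invgK mulgA mulgV mul1g.
Qed.

Lemma fourier_sub_tensor (T : nat -> seq (fn * fn)) t eps : ptensor L2 L2 T ->
  finite_tensor L2 L2 t ->
  (exists N, forall n, (N <= n)%N -> proj_norm L2 L2 (tensor_sub (T n) t) <= eps) ->
  carrier A (alpha T - (fun s => tpairing s t)) /\
  normof A (alpha T - (fun s => tpairing s t)) <= eps.
Proof.
move=> Tp tt TN.
have cp := ptensor_scale L2s L2s (-1) (ptensor_const L2s L2s tt).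
have sp := ptensor_cat L2s L2s Tp cp.
have E : alpha (fun n => T n ++ tensor_scale (-1) t) = alpha T - (fun s => tpairing s t).
  rewrite (alpha_cat Tp cp) (alpha_scale _ (ptensor_const L2s L2s tt)) alpha_const.
  by rewrite scaleN1r.
rewrite -E; split; first by exists (fun n => T n ++ tensor_scale (-1) t).
rewrite (le_trans (fourier_norm_le sp))//.
have [N NP] := TN; apply: (ptensor_norm_eventually_le L2s L2s sp).
by exists N => n /NP; rewrite /tensor_sub tensor_scaleN1.
Qed.

Lemma autocorrelation_le1 (xi : G -> R) (K : {fset G}) s :
  (forall x, x \notin K -> xi x = 0) -> \sum_(x <- K) xi x ^+ 2 = 1 ->
  normc (autocorrelation xi K s) <= 1.
Proof.
move=> xiK xi1; rewrite /autocorrelation normc_real.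
rewrite (le_trans (ler_norm_sum _ _ _))//.
rewrite (@le_trans _ _ (\sum_(x <- K) (xi (s^-1 * x)%g ^+ 2 / 2 + xi x ^+ 2 / 2)))//.
  apply: ler_sum => x _; rewrite normrM.
  have := sqr_ge0 (`|xi (s^-1 * x)%g| - `|xi x|).
  have := real_normK (num_real (xi x)); have := real_normK (num_real (xi (s^-1 * x)%g)).
  nra.
rewrite big_split/= -!mulr_suml xi1.
by have := sum_xi_sqr_le xiK xi1 s^-1%g K; lra.
Qed.

Local Notation "u ** v" := (@pointwise_mul R G u v) (at level 40).

(* a e^2 - a = (a - b1) e^2 + (b1 - b0) e^2 + (b0 e^2 - b0) + (b0 - a), where the
   finitely supported b0 is chosen before e, so that e is close to 1 on its
   support, and b1 after e, so that (a - b1) e^2 is bounded by the sup norm on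
   the finite support of e. *)
Lemma approximate_unit (a : fn) eps : carrier A a -> 0 < eps ->
  exists (F : seq G) (J0 : nat), forall J xi (K : {fset G}), (J0 <= J)%N ->
    (forall x, x \notin K -> xi x = 0) -> \sum_(x <- K) xi x ^+ 2 = 1 ->
    (forall s, s \in F -> normc (autocorrelation xi K s - 1) <= J%:R^-1) ->
    normof A (a ** (autocorrelation xi K ** autocorrelation xi K) - a) <= eps.
Proof.
move=> [T Tp <-] eps0; have [Tft Tc] := Tp.
(* The four terms of the decomposition will cost 2d, 2d + d, d and 2d. *)
pose d := eps / 8; have d0 : 0 < d by rewrite divr_gt0.
have [N NP] := Tc _ d0.
have [t0 [B0 [ft0 t0B t0d]]] := finite_support_approx (Tft N) d0.
pose b0 : fn := fun s => tpairing s t0.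
have b0S := tpairing_supported t0B.
set S0 := [fset _ | _ in _, _ in _]%fset in b0S.
pose c0 := \sum_(x <- S0) normc (b0 x); have c00 : 0 <= c0 by apply: sumr_ge0 => x _; exact: normc_ge0.
(* On S0 the difference of e^2 and 1 is at most 2/J, so the term b0 e^2 - b0 has norm at most 2 c0 /
   J. *)
exists S0, (Num.truncn (2 * c0 / d)).+1 => J xi K J0J xiK xi1 eJ.
set e := autocorrelation xi K in eJ *.
have e1 s : normc (e s) <= 1 by exact: autocorrelation_le1.
have J0 : 0 < J%:R :> R by rewrite ltr0n; apply: leq_trans J0J.
have c0J : 2 * c0 * J%:R^-1 <= d.
  rewrite ler_pdivrMr// [d * _]mulrC -ler_pdivrMr//.
  by apply/ltW/(lt_le_trans (truncnS_gt _)); rewrite ler_nat.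
set Ke := autocorrelation_support K.
(* The sup norm of (a - b1) e^2 is multiplied by the size of [Ke], which m exceeds; the 1 also
   ensures d / m <= d. *)
pose m : R := (size (enum_fset Ke))%:R + 1; have m0 : 0 < m by rewrite ltr_wpDl.
have m1 : 1 <= m by rewrite lerDr.
pose d1 := d / m; have d10 : 0 < d1 by rewrite divr_gt0.
have d1d : d1 <= d by rewrite ler_pdivrMr// ler_peMr// ltW.
have [N1 N1P] := Tc _ d10; pose M := maxn N N1.
have [t1 [B1 [ft1 t1B t1d]]] := finite_support_approx (Tft M) d10.
pose b1 : fn := fun s => tpairing s t1.
have [Ab0 nb0] : carrier A (alpha T - b0) /\ normof A (alpha T - b0) <= 2 * d.
  apply: fourier_sub_tensor => //; exists N => n Nn.
  have := proj_norm_sub_triangle L2s L2s (Tft n) (Tft N) ft0.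
  by have := NP _ _ Nn (leqnn N); lra.
have [Ab1 nb1] : carrier A (alpha T - b1) /\ normof A (alpha T - b1) <= 2 * d1.
  apply: fourier_sub_tensor => //; exists M => n Mn.
  have := proj_norm_sub_triangle L2s L2s (Tft n) (Tft M) ft1.
  have := N1P n M (leq_trans (leq_maxr _ _) Mn) (leq_maxr _ _); lra.
have [u1A nu1] : carrier A ((alpha T - b1) ** (e ** e)) /\
    normof A ((alpha T - b1) ** (e ** e)) <= 2 * d.
  have [|? h] := @finite_support_fourier R G ((alpha T - b1) ** (e ** e)) Ke.
    by move=> x xK; rewrite /pointwise_mul /e autocorrelation0// !mulr0.
  split=> //; apply: (le_trans h).
  rewrite (@le_trans _ _ (\sum_(x <- Ke) (2 * d1)))//.
    apply: ler_sum => x _; rewrite /pointwise_mul !normcM.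
    rewrite -[leRHS]mulr1 ler_pM ?mulr_ge0 ?normc_ge0//.
      by rewrite (le_trans (fourier_le _ Ab1)).
    by rewrite mulr_ile1 ?normc_ge0.
  rewrite big_const_seq count_predT iter_addr_0 -[leLHS]mulr_natr.
  have -> : d = d1 * m by rewrite /d1 divfK// gt_eqF.
  by rewrite -mulrA ler_wpM2l// ler_wpM2l ?(ltW d10)// /m lerDl.
have [u2A nu2] : carrier A ((b1 - b0) ** (e ** e)) /\
    normof A ((b1 - b0) ** (e ** e)) <= 3 * d.
  have fs := finite_tensor_sub L2s ft1 ft0.
  have fB p : p \in tensor_sub t1 t0 -> supported (B0 `|` B1)%fset p.2.
    rewrite mem_cat => /orP[/t1B[_ p2]|/mapP[q /t0B[_ q2] ->]] x; rewrite inE negb_or.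
      by move=> /andP[_]; apply: p2.
    by move=> /andP[xB _]; apply: q2.
  (* Supports of the second legs are preserved, so each of the two factors e takes one
     application. *)
  have [t2 [ft2 t2B t2E t2n]] := tensor_mult xiK xi1 fs fB.
  have [t3 [ft3 _ t3E t3n]] := tensor_mult xiK xi1 ft2 t2B.
  have -> : (b1 - b0) ** (e ** e) = (fun s => tpairing s t3).
    by apply/funext => s; rewrite t3E t2E tpairing_sub//; exact: mulrA.
  have [? h] := fourier_tensor ft3; split=> //.
  apply: (le_trans h); apply: (le_trans t3n); apply: (le_trans t2n).
  have := proj_norm_sub_triangle L2s L2s ft1 (Tft M) ft0.
  have := proj_norm_sub_triangle L2s L2s (Tft M) (Tft N) ft0.
  have := proj_norm_subC L2s L2s ft1 (Tft M).
  have := NP M N (leq_maxl _ _) (leqnn _); lra.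
have [u3A nu3] : carrier A (b0 ** (e ** e) - b0) /\ normof A (b0 ** (e ** e) - b0) <= d.
  have E x : (b0 ** (e ** e) - b0) x = b0 x * (e x * e x - 1).
    by rewrite mulrBr mulr1.
  have [|? h] := @finite_support_fourier R G (b0 ** (e ** e) - b0) S0.
    by move=> x xK; rewrite E /b0 b0S// mul0r.
  split=> //; apply: (le_trans h); apply: le_trans c0J.
  rewrite [2 * c0]mulrC -mulrA /c0 mulr_suml big_seq [leRHS]big_seq; apply: ler_sum => x xS.
  rewrite E normcM ler_wpM2l ?normc_ge0//.
  have -> : e x * e x - 1 = e x * (e x - 1) + (e x - 1) by ring.
  have := ler_normcD (e x * (e x - 1)) (e x - 1); rewrite normcM.
  have := eJ _ xS; have := e1 x; have := normc_ge0 (e x); have := normc_ge0 (e x - 1); nra.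
have u4A : carrier A (b0 - alpha T) by rewrite -opprB; apply: carrierN.
have nu4 : normof A (b0 - alpha T) <= 2 * d.
  by rewrite -opprB (le_trans (normofN_le As Ab0)).
have -> : alpha T ** (e ** e) - alpha T = ((alpha T - b1) ** (e ** e) +
    (b1 - b0) ** (e ** e)) + ((b0 ** (e ** e) - b0) + (b0 - alpha T)).
  apply/funext => s.
  rewrite -[LHS]/(alpha T s * (e s * e s) - alpha T s).
  rewrite -[RHS]/((alpha T s - b1 s) * (e s * e s) + (b1 s - b0 s) * (e s * e s) +
    ((b0 s * (e s * e s) - b0 s) + (b0 s - alpha T s))).
  by ring.
have [v1A nv1] := fourierD u1A u2A; have [v2A nv2] := fourierD u3A u4A.
have [_ nv] := fourierD v1A v2A.
apply: (le_trans nv).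
have -> : eps = 8 * d by rewrite /d; field.
lra.
Qed.

End approximation.

(** * The approximate diagonal *)

Lemma conj_unitarymx (C : numClosedFieldType) m n (M : 'M[C]_(m, n)) :
  M \is unitarymx -> map_mx Num.conj M \is unitarymx.
Proof. by rewrite conjC_unitary. Qed.

Lemma conj_rep (C : numClosedFieldType) (G : groupType) n (rho : G -> 'M[C]_n) :
  unitary_mxrep rho -> unitary_mxrep (fun g => map_mx Num.conj (rho g)).
Proof.
move=> [r1 rM rU]; split=> [|g h|g].
- by rewrite r1 map_mx1.
- by rewrite rM map_mxM.
- exact: conj_unitarymx.
Qed.

Section diagonal.
Context (R : realType) (G : groupType).
Hypothesis hG : virtually_abelian G.
Local Notation fn := (G -> R[i]^o).
Local Notation A := (fourier R G).
Local Notation mul := (@pointwise_mul R G).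
Let As := @fourier_seminormed R G.
Implicit Types (f g a : fn).

Definition lmul_tensor a (t : seq (fn * fn)) := [seq (mul a p.1, p.2) | p <- t].
Definition rmul_tensor a (t : seq (fn * fn)) := [seq (p.1, mul p.2 a) | p <- t].

Lemma bilinear_on_finite (V : lmodType R[i]) (b : fn -> fn -> V) (K : {fset G}) f g :
  bilinear_on A A b -> supported K f -> supported K g ->
  b f g = \sum_(x <- K) \sum_(y <- K) (f x * g y) *: b (delta R x) (delta R y).
Proof.
move=> bb fK gK; have [Ag _] := finite_support_fourier gK.
have Ad1 x : carrier A (delta R x) := (delta_fourier R x).1.
have Ad x (z : R[i]) : carrier A (z *: delta R x) by apply: carrierZ.
rewrite {1}(finite_support_delta fK) (bilinear_on_suml As bb)//.
apply: eq_bigr => x _; rewrite {1}(finite_support_delta gK).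
rewrite (bilinear_on_sumr As bb)//.
apply: eq_bigr => y _.
by rewrite (bilinear_onZl As bb)// (bilinear_onZr As bb)// scalerA.
Qed.

Lemma supported_mul K f g : supported K g -> supported K (mul f g).
Proof. by move=> gK x /gK; rewrite /pointwise_mul => ->; rewrite mulr0. Qed.

Lemma supported_mulr K f g : supported K f -> supported K (mul f g).
Proof. by move=> fK x /fK; rewrite /pointwise_mul => ->; rewrite mul0r. Qed.

(** In the basis of point masses a.t - t.a has entries (a(x) - a(y)) t(x, y): zero on the diagonal,
    at most 2 M eta elsewhere. The |K|^2 entries are then added up. *)
Lemma commutator_tensor (K : {fset G}) a (t : seq (fn * fn)) (M eta : R) :
  (forall p, p \in t -> supported K p.1 /\ supported K p.2) ->
  (forall x, normc (a x) <= M) ->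
  (forall x y, x \in K -> y \in K -> x != y ->
     normc (\sum_(p <- t) p.1 x * p.2 y) <= eta) -> 0 <= eta ->
  proj_norm A A (tensor_sub (lmul_tensor a t) (rmul_tensor a t)) <=
    (size (enum_fset K) * size (enum_fset K))%:R * (2 * M * eta).
Proof.
move=> tK aM tE eta0.
pose c x y : R[i] := (a x - a y) * \sum_(p <- t) p.1 x * p.2 y.
pose u : seq (fn * fn) := [seq (c x y *: delta R x, delta R y) | x <- K, y <- K].
have Ad x : carrier A (delta R x) := (delta_fourier R x).1.
have M0 : 0 <= M by apply: le_trans (aM 1%g); exact: normc_ge0.
have tA p : p \in t -> carrier A p.1 /\ carrier A p.2.
  by move=> /tK[p1 p2]; split; [apply: (finite_support_fourier p1).1 | apply: (finite_support_fourier p2).1].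
have ftr : finite_tensor A A (rmul_tensor a t).
  move=> _ /mapP[p pt ->]; split; first exact: (tA _ pt).1.
  by have [] := finite_support_fourier (@supported_mulr K p.2 a (tK _ pt).2).
have ftu : finite_tensor A A u.
  by move=> _ /allpairsP[[x y] [_ _ ->]]; split; [apply: (carrierZ As); apply: Ad|apply: Ad].
have teq : tensor_eq A A (tensor_sub (lmul_tensor a t) (rmul_tensor a t)) u.
  move=> V b bb; rewrite (sum_tensor_sub As bb)// big_allpairs_dep !big_map -sumrB.
  rewrite (eq_big_seq (fun p => \sum_(x <- K) \sum_(y <- K)
     ((a x - a y) * (p.1 x * p.2 y)) *: b (delta R x) (delta R y))); last first.
    move=> p pt; have [p1 p2] := tK _ pt.
    rewrite /= (bilinear_on_finite bb (@supported_mul K a _ p1) p2).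
    rewrite (bilinear_on_finite bb p1 (@supported_mulr K _ a p2)) -sumrB; apply: eq_bigr => x _.
    rewrite -sumrB; apply: eq_bigr => y _; rewrite -scalerBl; congr (_ *: _).
    by rewrite /pointwise_mul; ring.
  rewrite exchange_big/=; apply: eq_bigr => x _; rewrite exchange_big/=; apply: eq_bigr => y _.
  by rewrite (bilinear_onZl As bb)// -scaler_suml -mulr_sumr.
rewrite (le_trans (proj_norm_le As As ftu teq))// big_allpairs_dep /=.
rewrite (@le_trans _ _ (\sum_(x <- K) \sum_(y <- K) (2 * M * eta)))//; last first.
  rewrite !big_const_seq !count_predT !iter_addr_0.
  by rewrite -mulrnA -[leLHS]mulr_natl.
rewrite big_seq [leRHS]big_seq; apply: ler_sum => x xK.
rewrite big_seq [leRHS]big_seq; apply: ler_sum => y yK.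
rewrite (@le_trans _ _ (normc (c x y)))//.
  have [_ nx] := delta_fourier R x; have [_ ny] := delta_fourier R y.
  have h := (fourierZ (c x y) (Ad x)).2.
  rewrite -[leRHS]mulr1 ler_pM ?fourier_norm_ge0// (le_trans h)//.
  by rewrite ler_piMr ?normc_ge0.
have [->|xy] := eqVneq x y.
  by rewrite /c subrr mul0r Normc.normc0 !mulr_ge0.
rewrite /c normcM ler_pM ?normc_ge0 ?tE//.
rewrite (le_trans (ler_normcD _ _))// normcN.
by have := aM x; have := aM y; lra.
Qed.

Section construction.
Context (xi : G -> R) (K0 : {fset G}).
Hypotheses (xiK : forall x, x \notin K0 -> xi x = 0)
  (xi1 : \sum_(x <- K0) xi x ^+ 2 = 1).
Local Notation e := (autocorrelation xi K0).
Local Notation K := (autocorrelation_support K0).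
Context (n : nat) (rho : G -> 'M[R[i]]_n) (s : seq ('rV[R[i]]_n * 'rV[R[i]]_n)).
Hypotheses (n0 : (0 < n)%N) (rho_rep : unitary_mxrep rho)
  (s_unit : forall p, p \in s -> p.1 \is unitarymx /\ p.2 \is unitarymx)
  (s_trace : forall x y, \tr (1%:M *m rho (x^-1 * y)%g) =
        \sum_(p <- s) ((p.1 *m rho x *m p.2^t*) 0 0)^* * (p.1 *m rho y *m p.2^t*) 0 0).

Definition coef (p : 'rV[R[i]]_n * 'rV[R[i]]_n) : fn :=
  fun x => (p.1 *m rho x *m p.2^t*) 0 0.

Definition diagonal_tensor : seq (fn * fn) :=
  [seq ((n%:R^-1 : R[i]) *: (fun x => e x * (coef p x)^* : R[i]^o), (fun x => e x * coef p x)) | p <- s].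

(** The conjugate of a coefficient of rho is a coefficient of the conjugate representation, so
    Fell's absorption covers both legs. *)
Lemma coef_fourier p : p \in s ->
  [/\ carrier A (fun x => e x * coef p x), normof A (fun x => e x * coef p x) <= 1,
      carrier A (fun x => e x * (coef p x)^*) &
      normof A (fun x => e x * (coef p x)^*) <= 1].
Proof.
move=> /s_unit[p1 p2]; have [c1 c2] := coefficient_fourier xiK xi1 rho_rep p1 p2.
have p1' := conj_unitarymx p1.
have p2' := conj_unitarymx p2.
have [c3 c4] := coefficient_fourier xiK xi1 (conj_rep rho_rep) p1' p2'.
suff E : (fun x => e x * (coef p x)^*) = (fun s => e s *
  (map_mx Num.conj p.1 *m map_mx Num.conj (rho s) *m (map_mx Num.conj p.2)^t*) 0 0) :> fn.
  by rewrite E; exact: And4 c1 c2 c3 c4.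
apply/funext => x; congr (_ * _).
have -> : map_mx Num.conj p.1 *m map_mx Num.conj (rho x) *m (map_mx Num.conj p.2)^t* =
  map_mx Num.conj (p.1 *m rho x *m p.2^t*) by rewrite !map_mxM map_trmx.
by rewrite [RHS]mxE.
Qed.

Lemma supported_diagonal p : p \in diagonal_tensor -> supported K p.1 /\ supported K p.2.
Proof.
move=> /mapP[q _ ->] /=; split=> x xK.
  by rewrite -[LHS]/(_ * (e x * _)) autocorrelation0// mul0r mulr0.
by rewrite autocorrelation0// mul0r.
Qed.

Lemma finite_tensor_diagonal : finite_tensor A A diagonal_tensor.
Proof.
move=> _ /mapP[p /coef_fourier[c1 _ c3 _] ->]; split=> //=.
exact: (carrierZ As _ c3).
Qed.

Lemma diagonal_tensor_norm : proj_norm A A diagonal_tensor <= (size s)%:R / n%:R.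
Proof.
rewrite (le_trans (proj_norm_le_cost As As finite_tensor_diagonal))// big_map.
rewrite (@le_trans _ _ (\sum_(p <- s) n%:R^-1))//; last first.
  by rewrite big_const_seq count_predT iter_addr_0 -[leLHS]mulr_natl.
rewrite big_seq [leRHS]big_seq; apply: ler_sum => p /coef_fourier[c1 c2 c3 c4] /=.
rewrite -[leRHS]mulr1 ler_pM ?fourier_norm_ge0//.
rewrite (le_trans (fourierZ _ c3).2)//.
rewrite (_ : normc n%:R^-1 = n%:R^-1) ?ler_piMr ?invr_ge0//.
rewrite -(rmorph_nat (real_complex R)) -fmorphV normc_real ger0_norm ?invr_ge0//.
Qed.

Lemma diagonal_tensor_pair x y :
  \sum_(p <- diagonal_tensor) p.1 x * p.2 y =
    n%:R^-1 * \tr (rho (x^-1 * y)%g) * (e x * e y).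
Proof.
rewrite big_map -[rho _]mul1mx s_trace mulr_sumr mulr_suml; apply: eq_bigr => p _.
rewrite -[X in X * _ = _]/(n%:R^-1 * (e x * (coef p x)^*)) /= /coef.
by rewrite -!mulrA; congr (_ * _); rewrite mulrC -!mulrA; congr (_ * _); rewrite mulrC -!mulrA; ring.
Qed.

Lemma diagonal_tensor_Delta :
  \sum_(p <- diagonal_tensor) mul p.1 p.2 = mul e e.
Proof.
apply/funext => x; rewrite fct_sumE -[LHS]/(\sum_(p <- diagonal_tensor) p.1 x * p.2 x).
rewrite diagonal_tensor_pair mulVg; have [-> _ _] := rho_rep.
by rewrite mxtrace1 mulVf ?mul1r// pnatr_eq0 -lt0n.
Qed.

End construction.

Variable C : R.
Hypothesis HC : forall (F : seq G) (eps : R), 1%g \notin F -> 0 < eps ->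
  exists n (rho : G -> 'M[R[i]]_n) c, [/\ (0 < n)%N, unitary_mxrep rho,
    forall z, z \in F -> `|\tr (rho z)| <= (eps * n%:R)%:C%C,
    coef_decomposition rho 1%:M c & c%:R <= (C + eps) * n%:R].

(** The two tolerances are independent: eps for the module and unit conditions on L, eps1 for the
    excess of the norm over C. *)
Lemma exists_diagonal (L : seq fn) (eps eps1 : R) : 0 < eps -> 0 < eps1 ->
  (forall a, a \in L -> carrier A a) ->
  exists t : seq (fn * fn), [/\ finite_tensor A A t,
    proj_norm A A t <= C + eps1,
    carrier A (\sum_(p <- t) mul p.1 p.2),
    forall a, a \in L -> proj_norm A A (tensor_sub (lmul_tensor a t) (rmul_tensor a t)) <= eps
    & forall a, a \in L -> normof A (mul a (\sum_(p <- t) mul p.1 p.2) - a) <= eps].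
Proof.
move=> eps0 eps10 LA.
have [F [J0 [J00 FP]]] : exists (F : seq G) (J : nat), (0 < J)%N /\ forall a, a \in L ->
    forall xi (K : {fset G}),
    (forall x, x \notin K -> xi x = 0) -> \sum_(x <- K) xi x ^+ 2 = 1 ->
    (forall s, s \in F -> normc (autocorrelation xi K s - 1) <= J%:R^-1) ->
    normof A (mul a (mul (autocorrelation xi K) (autocorrelation xi K)) - a) <= eps.
  (* With a threshold on J, the data for the members of L combine by concatenation and maximum;
     [J0.+1] is then taken to be positive. *)
  suff [F [J0 FP]] : exists (F : seq G) (J0 : nat), forall a, a \in L ->
      forall J xi (K : {fset G}), (J0 <= J)%N ->
      (forall x, x \notin K -> xi x = 0) -> \sum_(x <- K) xi x ^+ 2 = 1 ->
      (forall s, s \in F -> normc (autocorrelation xi K s - 1) <= J%:R^-1) ->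
      normof A (mul a (mul (autocorrelation xi K) (autocorrelation xi K)) - a) <= eps.
    by exists F, J0.+1; split=> // a aL xi K; apply: FP.
  elim: L LA => [_|a L IH LA]; first by exists [::], 0%N.
  have [|F [J FP]] := IH; first by move=> b bL; apply: LA; rewrite inE bL orbT.
  have [F' [J' FP']] := approximate_unit (LA a (mem_head _ _)) eps0.
  exists (F ++ F'), (maxn J J') => b; rewrite inE => /predU1P[->|bL] I xi K;
    rewrite geq_max => /andP[JI JI'] xiK xi1 H.
    by apply: (FP' I) => // s sF; apply: H; rewrite mem_cat sF orbT.
  by apply: (FP b bL I) => // s sF; apply: H; rewrite mem_cat sF.
have [xi [K0 [xiK xi1 xiF]]] := folner_vector R hG F J00.
pose K := autocorrelation_support K0; pose k : R := (size (enum_fset K) * size (enum_fset K))%:R.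
pose M := \sum_(a <- L) normof A a.
have M0 : 0 <= M by apply: sumr_ge0 => a _; exact: fourier_norm_ge0.
have LM a x : a \in L -> normc (a x) <= M.
  move=> aL; rewrite (le_trans (fourier_le x (LA _ aL)))// /M (big_rem a)//= lerDl.
  by apply: sumr_ge0 => b _; exact: fourier_norm_ge0.
(* The first bound serves the norm; the second gives k * 2M * eta <= eps in [commutator_tensor]. *)
pose eta := Num.min eps1 (eps / (k * (2 * M) + 1)).
have kM : 0 < k * (2 * M) + 1 by rewrite ltr_wpDl// !mulr_ge0.
have eta0 : 0 < eta by rewrite lt_min eps10 divr_gt0.
pose F1 := [seq z <- [seq (x^-1 * y)%g | x <- K, y <- K] | z != 1%g].
have F11 : 1%g \notin F1 by rewrite mem_filter eqxx.
have [n [rho [c [n0 rho_rep rF [s [sc su st]] cC]]]] := HC F11 eta0.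
have nR0 : 0 < n%:R :> R by rewrite ltr0n.
exists (diagonal_tensor xi K0 rho s); split.
- exact: finite_tensor_diagonal.
- rewrite (le_trans (diagonal_tensor_norm xiK xi1 rho_rep su))// ler_pdivrMr//.
  rewrite (@le_trans _ _ c%:R) ?ler_nat// (le_trans cC)// ler_wpM2r// lerD2l.
  by rewrite ge_min lexx.
- rewrite diagonal_tensor_Delta//.
  apply: (finite_support_fourier (K := K) _).1 => x xK.
  by rewrite /pointwise_mul autocorrelation0// mul0r.
- move=> a aL.
  apply: le_trans (@commutator_tensor K a _ M eta _ _ _ _) _.
  + exact: supported_diagonal.
  + by move=> x; apply: LM.
  + move=> x y xK yK xy; rewrite diagonal_tensor_pair// !normcM.
    have e1 z : normc (autocorrelation xi K0 z) <= 1 by apply: autocorrelation_le1.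
    rewrite -[leRHS]mulr1 ler_pM ?mulr_ge0 ?normc_ge0//; last by rewrite mulr_ile1 ?normc_ge0.
    have : (x^-1 * y)%g \in F1.
      rewrite mem_filter; apply/andP; split; last exact: allpairs_f.
      by apply: contra_neq xy => h; rewrite -[x]mulg1 -h mulVKg.
    move=> /rF; rewrite normr_normc lecR => trn.
    rewrite -(rmorph_nat (real_complex R)) -fmorphV normc_real ger0_norm ?invr_ge0//.
    by rewrite mulrC ler_pdivrMr.
  + exact: ltW.
  + rewrite -/k mulrA (@le_trans _ _ (k * (2 * M) * (eps / (k * (2 * M) + 1))))//.
      by rewrite ler_wpM2l ?mulr_ge0// ge_min lexx orbT.
    by rewrite mulrCA ger_pMr// ler_pdivrMr// mul1r lerDl.
- move=> a aL; rewrite diagonal_tensor_Delta//; apply: FP => //.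
Qed.

End diagonal.

(** * Bounding the number of coefficients *)

Section commutator.
Context (G : groupType).
Local Notation G' := (@commutator_subgroup G).

Lemma commutator_subgroup_is_subgroup : is_subgroup G'.
Proof.
split=> [M [[]] //|x y Gx Gy M MP|x Gx M MP].
  by have [[_ + _] _] := MP; apply; [apply: Gx | apply: Gy].
by have [[_ _ +] _] := MP; apply; apply: Gx.
Qed.

Lemma commg_commutator_subgroup x y : G' (commg x y).
Proof. by move=> M [_ +]; apply; exists x, y. Qed.

(** The elements whose conjugate by g lies in [G, G] form a subgroup containing all commutators. *)
Lemma commutator_subgroup_conj g x : G' x -> G' (g * x * g^-1)%g.
Proof.
move=> Gx; apply: (Gx [set x | G' (g * x * g^-1)%g]); split.
  have [S1 SM SV] := commutator_subgroup_is_subgroup; split=> /=.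
  - by rewrite mulg1 mulgV.
  - by move=> a b /SM h /h; rewrite !mulgA mulgVK.
  - by move=> a /SV; rewrite !invgM invgK mulgA.
move=> _ [a [b ->]] /=.
have -> : (g * commg a b * g^-1)%g = commg (g * a * g^-1)%g (g * b * g^-1)%g.
  by rewrite /commg /conjg !invgM !invgK !mulgA !mulgVK.
exact: commg_commutator_subgroup.
Qed.

End commutator.

Section core.
Context (R : realType) (G : groupType).
Hypothesis hG : virtually_abelian G.
Variable D : nat.
Hypotheses (D1 : (0 < D)%N)
  (HD : forall n (rho : G -> 'M[R[i]]_n), unitary_mxrep rho ->
    forall e (B : 'M[R[i]]_(e, n)), B \is unitarymx -> mxstable rho B -> mxirr rho B ->
    (e <= D)%N).

(** C is an asymptotic number of matrix coefficients per dimension; [AM_le] turns it into a bound on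
    the amenability constant. *)
Definition coefficient_bound (C : R) : Prop := forall (F : seq G) (eps : R), 1%g \notin F -> 0 < eps ->
  exists n (rho : G -> 'M[R[i]]_n) c, [/\ (0 < n)%N, unitary_mxrep rho,
    forall z, z \in F -> `|\tr (rho z)| <= (eps * n%:R)%:C%C,
    coef_decomposition rho 1%:M c & c%:R <= (C + eps) * n%:R].

Lemma coefficient_bound_infinite : coefficient_bound D%:R.
Proof.
move=> F eps F1 eps0; have [n [rho [n0 rep rF]]] := small_trace hG F1 eps0.
exists n, rho, (D * n)%N; split=> //.
  have [r1 rM rU] := rep.
  have u1 : (1%:M : 'M[R[i]]_n) \is unitarymx.
    by apply/unitarymxP; rewrite trmx1 map_mx1 mulmx1.
  have := @coef_decomposition_irr _ _ _ rho rep D _ _ u1.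
  rewrite trmx1 map_mx1 mulmx1; apply; first by move=> g; rewrite submx1.
  by move=> e B Bu _; apply: HD.
by rewrite natrM ler_wpM2r// lerDl ltW.
Qed.

(** The rank m of the average over [G, G] is n/l plus the mean of the traces at its nontrivial
    elements. Asking for small trace there too gives m >= n/l - eta n, which enters the count m +
    D(n - m) with the factor D - 1. *)
Lemma coefficient_bound_finite : finite_set (@commutator_subgroup G) ->
  coefficient_bound (1 + (D%:R - 1) * (1 - (#|` fset_set (@commutator_subgroup G)|)%:R^-1)).
Proof.
move=> fin F eps F1 eps0; set L := fset_set _.
have LP x : x \in L <-> @commutator_subgroup G x.
  have -> : (x \in L) = (x \in @commutator_subgroup G) by rewrite -in_fset_set.
  by split=> [/set_mem|/mem_set].
have [S1 SM SV] := @commutator_subgroup_is_subgroup G.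
have L1 : 1%g \in L by apply/LP.
have D0 : 0 < D%:R :> R by rewrite ltr0n.
(* Chosen so that the loss (D - 1) eta n stays below eps n. *)
pose eta : R := eps / D%:R.
have eta0 : 0 < eta by rewrite divr_gt0.
have etaeps : eta <= eps by rewrite ler_pdivrMr// ler_peMr ?ler1n// ltW.
pose F' := F ++ [seq x <- L | x != 1%g].
have F1' : 1%g \notin F' by rewrite mem_cat negb_or F1 mem_filter eqxx.
have [n [rho [n0 rep rF]]] := small_trace hG F1' eta0.
have nR0 : 0 < n%:R :> R by rewrite ltr0n.
have [m [mn trm dec]] := @coef_decomposition_average _ _ _ rho rep L (fset_uniq L) L1
  (fun x y xL yL => (LP _).2 (SM _ _ ((LP _).1 xL) ((LP _).1 yL)))
  (fun x xL => (LP _).2 (SV _ ((LP _).1 xL)))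
  (fun g x xL => (LP _).2 (commutator_subgroup_conj g ((LP _).1 xL)))
  (fun x y => (LP _).2 (commg_commutator_subgroup x y)) D (HD rep).
exists n, rho, (m + D * (n - m))%N; split=> //.
  move=> z zF; apply: (le_trans (rF z _)); first by rewrite mem_cat zF.
  by rewrite lecR ler_wpM2r.
pose l : R := #|` L|%:R.
have l1 : 1 <= l by rewrite ler1n cardfs_gt0; apply/fset0Pn; exists 1%g.
have l0 : 0 < l by apply: lt_le_trans l1.
have mlow : n%:R * l^-1 - eta * n%:R <= m%:R :> R.
  have lm : (l * m%:R)%:C%C = n%:R + \sum_(h <- L | h != 1%g) \tr (rho h) :> R[i].
    rewrite rmorphM !rmorph_nat -trm /mxaverage linearZ /= mulrA divff ?mul1r; last first.
      by rewrite pnatr_eq0 -lt0n cardfs_gt0; apply/fset0Pn; exists 1%g.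
    rewrite raddf_sum/= (bigD1_seq 1%g) ?fset_uniq//=.
    by have [-> _ _] := rep; rewrite mxtrace1.
  have h : `|(n%:R - l * m%:R)%:C%C| <= (l * (eta * n%:R))%:C%C :> R[i].
    rewrite rmorphB/= lm rmorph_nat opprD addNKr normrN.
    rewrite (le_trans (ler_norm_sum _ _ _))//.
    rewrite (@le_trans _ _ (\sum_(h <- L | h != 1%g) (eta * n%:R)%:C%C))//.
      rewrite -[leLHS]big_filter -[leRHS]big_filter big_seq [leRHS]big_seq.
      by apply: ler_sum => h hL; apply: rF; rewrite mem_cat hL orbT.
    rewrite -rmorph_sum lecR (@le_trans _ _ (\sum_(h <- L) (eta * n%:R)))//.
      rewrite big_mkcond ler_sum// => h _; case: ifP => // _.
      by rewrite mulr_ge0 ?ltW.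
    by rewrite big_const_seq count_predT iter_addr_0 -[leLHS]mulr_natl.
  move: h; rewrite normr_normc normc_real lecR => h.
  have h2 : n%:R - l * m%:R <= l * (eta * n%:R) by apply: le_trans (ler_norm _) h.
  rewrite lerBlDr ler_pdivrMr// mulrDl; lra.
rewrite natrD natrM natrB//.
have D1R : 1 <= D%:R :> R by rewrite ler1n.
have key : D%:R * eta = eps by rewrite /eta mulrC divfK// gt_eqF.
have h3 : (D%:R - 1) * (n%:R * l^-1 - eta * n%:R) <= (D%:R - 1) * m%:R.
  by rewrite ler_wpM2l// subr_ge0.
have h4 : (D%:R - 1) * (eta * n%:R) <= eps * n%:R.
  have en0 : 0 <= eta * n%:R by rewrite mulr_ge0// ltW.
  by rewrite -key -[leRHS]mulrA ler_wpM2r// gerBl.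
rewrite -/l; move: h3 h4; move: (l^-1) (eta * n%:R) => li en; nra.
Qed.

End core.

Section maxdeg_cases.
Context (R : realType) (G : groupType).

Lemma maxdeg_nat (d : R) n (rho : G -> 'M[R[i]]_n) e (B : 'M[R[i]]_(e, n)) :
  maxdeg R G = d%:E -> unitary_mxrep rho ->
  B \is unitarymx -> mxstable rho B -> mxirr rho B -> (e <= Num.truncn d)%N.
Proof.
move=> dE rep Bu Bst Birr; have := maxdeg_ge rep Bu Bst Birr.
rewrite dE lee_fin => ed; rewrite truncn_ge_nat//.
by apply: le_trans ed.
Qed.

Lemma maxdeg_ge1 : (1 <= maxdeg R G)%E.
Proof.
pose rho (g : G) : 'M[R[i]]_1 := 1%:M.
have u1 : (1%:M : 'M[R[i]]_1) \is unitarymx.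
  by apply/unitarymxP; rewrite trmx1 map_mx1 mulmx1.
have rep : unitary_mxrep rho by split=> // g h; rewrite mulmx1.
apply: (maxdeg_ge rep u1); first by move=> g; rewrite submx1.
split=> [|k U _ _ U0]; first by rewrite -mxrank_eq0 mxrank1.
have : (0 < \rank U)%N by rewrite lt0n mxrank_eq0.
by rewrite sub1mx /row_full eqn_leq rank_leq_col.
Qed.

End maxdeg_cases.

(** * The amenability constant *)

Section amenability_constant.
Context (R : realType) (G : groupType).
Hypothesis hG : virtually_abelian G.
Local Notation fn := (G -> R[i]^o).
Local Notation A := (fourier R G).
Local Notation mul := (@pointwise_mul R G).
Let As := @fourier_seminormed R G.

Lemma net_cvg0 (I : Type) (le : I -> I -> Prop) (f : I -> R) :
  (forall e : R, 0 < e -> exists i, forall j, le i j -> `|f j| < e) ->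
  f i @[i --> net_tails le] --> (0 : R).
Proof.
move=> fP P /nbhs_ballP[e /= e0 eP]; have [i ij] := fP _ e0.
exists i => // j /ij fj; apply: eP; rewrite -ball_normE /= sub0r normrN//.
Qed.

(** [Delta] picks some limit; it is unique because the norm of A(G) dominates the values at every
    point. *)
Lemma Delta_const (t : seq (fn * fn)) : carrier A (\sum_(p <- t) mul p.1 p.2) ->
  Delta A mul (fun=> t) = \sum_(p <- t) mul p.1 p.2.
Proof.
set d := \sum_(p <- t) _ => Ad; rewrite /Delta -/d.
have nA0 : normof A 0 = 0.
  apply/eqP; rewrite eq_le fourier_norm_ge0 andbT.
  have [A0 _ _ AZ] := As.
  by have := AZ 0 0 A0; rewrite scale0r Normc.normc0 mul0r.
case: xgetP => [d' _ [Ad' /= dd]|/(_ d)]; last first.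
  by case; split=> //; rewrite subrr nA0; apply: cvg_cst.
have nd : normof A (d - d') = 0 by apply: (cvg_unique (@Rhausdorff R) (cvg_cst _) dd).
apply/funext => x; apply/eqP; rewrite eq_sym -subr_eq0 -normc_eq0; apply/eqP/le_anti.
by rewrite normc_ge0 andbT -nd (fourier_le x (carrierB As Ad Ad')).
Qed.

(** For each excess e1 there is a net of finite tensors, seen as constant sequences, of norm at most
    C + e1. It is indexed by finite lists of functions and a precision. *)
Lemma AM_le (C : R) : coefficient_bound G C -> (AM A mul <= C%:E)%E.
Proof.
move=> HC; apply/lee_addgt0Pr => e1 e10.
pose I := (seq fn * nat)%type.
pose le (i j : I) := {subset i.1 <= j.1} /\ (i.2 <= j.2)%N.
(* Arbitrary lists of functions serve as indices; members outside A(G) impose no condition. *)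
pose Li (i : I) := [seq a <- i.1 | `[< carrier A a >]].
have ex (i : I) : exists t : seq (fn * fn), [/\ finite_tensor A A t,
    proj_norm A A t <= C + e1, carrier A (\sum_(p <- t) mul p.1 p.2),
    forall a, a \in Li i -> proj_norm A A (tensor_sub (lmul_tensor a t) (rmul_tensor a t)) <= i.2.+1%:R^-1
    & forall a, a \in Li i -> normof A (mul a (\sum_(p <- t) mul p.1 p.2) - a) <= i.2.+1%:R^-1].
  apply: exists_diagonal => //.
  by move=> a; rewrite mem_filter => /andP[/asboolP].
have [m mP] := choice ex.
have tail a (e : R) : carrier A a -> 0 < e -> exists i : I, forall j, le i j ->
    a \in Li j /\ j.2.+1%:R^-1 < e.
  move=> Aa e0; exists ([:: a], Num.truncn e^-1) => -[L k] [/= aL ek]; split.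
    by rewrite mem_filter aL ?mem_head// andbT; apply/asboolP.
  rewrite -[ltRHS]invrK ltf_pV2 ?posrE ?invr_gt0//.
  by apply: (lt_le_trans (truncnS_gt _)); rewrite ler_nat.
have nle i : ptensor_norm A A (fun=> m i) <= C + e1.
  by rewrite ptensor_norm_const; have [_ + _ _ _] := mP i.
have bad : bounded_approximate_diagonal A mul le (fun i => fun=> m i).
  split.
  - split; first by constructor; exact: ([::], 0%N).
    + by move=> i; split.
    + by move=> i j k [ij1 ij2] [jk1 jk2]; split; [move=> a /ij1/jk1 | apply: leq_trans jk2].
    + move=> i j; exists (i.1 ++ j.1, maxn i.2 j.2); split; split=> /=.
      * by move=> a ai; rewrite mem_cat ai.
      * exact: leq_maxl.
      * by move=> a aj; rewrite mem_cat aj orbT.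
      * exact: leq_maxr.
  - by move=> i; apply: ptensor_const => //; have [] := mP i.
  - by exists (C + e1).
  - move=> a Aa; apply: net_cvg0 => e e0; have [i iP] := tail _ _ Aa e0.
    exists i => j /iP[aL je]; have [_ _ _ + _] := mP j.
    move=> /(_ _ aL) h; apply: le_lt_trans je.
    rewrite -[ptensor_sub _ _]/(fun=> tensor_sub (lmul_tensor a (m j)) (rmul_tensor a (m j))).
    by rewrite ptensor_norm_const ger0_norm// proj_norm_ge0.
  - move=> a Aa; apply: net_cvg0 => e e0; have [i iP] := tail _ _ Aa e0.
    exists i => j /iP[aL je]; have [_ _ c _ +] := mP j.
    move=> /(_ _ aL) h; apply: le_lt_trans je.
    by rewrite Delta_const// ger0_norm// fourier_norm_ge0.
apply: (@le_trans _ _ (ereal_sup (range (fun i => (ptensor_norm A A (fun=> m i))%:E)))).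
  by apply: ereal_inf_lbound; exists I, le, (fun i => fun=> m i).
by apply: ge_ereal_sup => _ [i _ <-]; rewrite -EFinD lee_fin.
Qed.

End amenability_constant.

Lemma abelian_irr_dim1 (R : realType) (G : groupType) n (rho : G -> 'M[R[i]]_n) e
    (B : 'M[R[i]]_(e, n)) : (forall x y : G, commg x y = 1%g) ->
  unitary_mxrep rho -> B \is unitarymx -> mxstable rho B -> mxirr rho B -> (e <= 1)%N.
Proof.
move=> ab rep Bu Bst Birr; apply: (commuting_irr_dim1 rep Bu Bst Birr) => g h.
by congr (_ *m rho _); rewrite commgCV ab mul1g.
Qed.

Theorem theorem4p1 (R : realType) (G : groupType) (hG : virtually_abelian G) :
  (AM (fourier R G) (@pointwise_mul R G) <=
     1 + (maxdeg R G - 1) * (1 - inv_card_commutator R G))%E.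
Proof.
have m1 := maxdeg_ge1 R G.
have dnat d : maxdeg R G = d%:E -> [/\ (0 < Num.truncn d)%N, (Num.truncn d)%:R <= d & 1 <= d].
  move=> dE; move: m1; rewrite dE lee_fin => d1; split=> //.
    by rewrite truncn_gt0.
  by rewrite truncn_le// (le_trans _ d1).
have [fin|inf] := pselect (finite_set (@commutator_subgroup G)); last first.
  have -> : inv_card_commutator R G = 0%E.
    by rewrite /inv_card_commutator /counting asboolF// invey.
  (* The bound collapses to maxdeg itself; block dimensions being integers, a finite maxdeg may be
     rounded down. *)
  rewrite sube0 mule1 addeC subeK//.
  case dE : (maxdeg R G) => [d| |]; [|by rewrite leey|by rewrite dE in m1].
  have [D0 Dd d1] := dnat d dE.
  apply: (@le_trans _ _ (Num.truncn d)%:R%:E); last by rewrite lee_fin.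
  apply: AM_le => //; apply: coefficient_bound_infinite => // n rho rep e B.
  exact: maxdeg_nat.
have [S1 SM SV] := @commutator_subgroup_is_subgroup G.
pose l := #|` fset_set (@commutator_subgroup G)|.
have l0 : (0 < l)%N.
  by rewrite cardfs_gt0; apply/fset0Pn; exists 1%g; rewrite in_fset_set//; apply/mem_set.
have -> : inv_card_commutator R G = (l%:R^-1)%:E.
  by rewrite /inv_card_commutator /counting asboolT// inver pnatr_eq0 gtn_eqF.
(* For l = 1 the bound is 1 even if maxdeg were +oo, since oo * 0 = 0. Commutativity of G then
   supplies D = 1. *)
have [l1|l1] := eqVneq l 1%N.
  rewrite l1 invr1 subee// mule0 adde0.
  have ab (x y : G) : commg x y = 1%g.
    have [z zE] : exists z, fset_set (@commutator_subgroup G) = [fset z]%fset.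
      by apply/cardfs1P; rewrite -/l l1.
    have in1 w : @commutator_subgroup G w -> w = z.
      by move=> /mem_set; rewrite -in_fset_set// zE inE => /eqP.
    by rewrite (in1 _ (commg_commutator_subgroup x y)) (in1 _ S1).
  have := @coefficient_bound_finite R G hG 1 isT _ fin; rewrite -/l l1 subrr mul0r addr0.
  move=> H; apply: AM_le => //; apply: H => n rho rep e B Bu Bst Birr.
  exact: abelian_irr_dim1 ab rep Bu Bst Birr.
(* Positivity of this factor makes the bound +oo when maxdeg is. *)
have lR : 0 < 1 - l%:R^-1 :> R.
  by rewrite subr_gt0 invf_lt1 ?ltr0n// ltr1n ltn_neqAle eq_sym l1.
rewrite -EFinB; case dE : (maxdeg R G) => [d| |]; last by rewrite dE in m1.
  have [D0 Dd d1] := dnat d dE.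
  apply: (@le_trans _ _ (1 + ((Num.truncn d)%:R - 1) * (1 - l%:R^-1))%:E).
    apply: AM_le => //; apply: coefficient_bound_finite => // n rho rep e B.
    exact: maxdeg_nat.
  by rewrite -EFinB -EFinM -EFinD lee_fin lerD2l ler_wpM2r ?(ltW lR)// lerD2r.
by rewrite gt0_mulye ?lte_fin// addey// leey.
Qed.
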